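(* Fix $\beta\in[0,2)$ and let $\sigma = 2\sqrt{2-\beta}\,\pi$. For a positive integer $N_1$ let $p_j = -\exp\!\big(-\sigma(\sqrt{N_1}-\sqrt{j}\,)\big)$, $1\le j\le N_1$. Assume, with $h=(2-\beta)\pi^2$ and $T=\sqrt{N_t h/4}$, that there is a constant $K$ such that for all sufficiently large positive integers $N_t$ and all $z = r e^{\pm i\beta\pi/2}$ with $r\in[e^{4+2\beta-2T},1]$, $$\left|\int_\Gamma f(u,z)\,\delta(u)\,du\right| \le K e^{-T},$$ with $f,\delta,\Gamma$ as in the context. Then there exist coefficients $a_1,\dots,a_{N_1}$ and a polynomial $b$ of degree $N_2=\mathcal{O}(\sqrt{N_1}\,)$ such that, with $N=N_1+N_2$, the rational function $r(z)=\sum_{j=1}^{N_1}\frac{a_j}{z-p_j}+b(z)$ satisfies $$|r(z)-\sqrt{z}\,| = \mathcal{O}\big(e^{-\pi\sqrt{(2-\beta)N}}\big)$$ as $N\to\infty$, uniformly for $z\in\{re^{i\beta\pi/2}: r\in[0,1]\}\cup\{re^{-i\beta\pi/2}: r\in[0,1]\}$.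
   Context: Here $\sqrt{\cdot}$ denotes the principal branch of the square root. For $u,z\in\mathbb{C}$, $f(u,z) = \frac{z}{\pi}\,\frac{1}{\sqrt{u}}\,\frac{e^{\sqrt{u}-T}}{e^{2(\sqrt{u}-T)}+z}$. The function $\delta(u)=\mu(u)-m(u)$, where $\mu(u)=-\tfrac12$ if $\operatorname{Im}u\ge 0$ and $\mu(u)=\tfrac12$ if $\operatorname{Im}u<0$, and $m(u) = -\tfrac{i}{2}\cot(\pi u/h)$. For $z=re^{\pm i\beta\pi/2}$, the contour $\Gamma$ is the positively oriented boundary of the rectangle $\{u: 1-\beta/2\le \operatorname{Re}u\le 4T^2+1-\beta/2,\ |\operatorname{Im}u|\le a\}$ with $a = 2\pi(T+\tfrac12\log r)$. *)

(* Defs.v *)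
From Stdlib Require Import Reals.
From Coquelicot Require Import Coquelicot.
Open Scope R_scope.

Definition Cexp (z : C) : C :=
  (exp (Re z) * cos (Im z), exp (Re z) * sin (Im z)).

(* principal branch of the square root (branch cut on the negative reals,
   sqrt(-x) = i sqrt x for x > 0) *)
Definition Csqrt (z : C) : C :=
  (sqrt ((Cmod z + Re z) / 2),
   (if Rle_dec 0 (Im z) then 1 else -1) * sqrt ((Cmod z - Re z) / 2)).

Definition Ci : C := (0, 1).
Definition Ccos (w : C) : C := ((Cexp (Ci * w) + Cexp (- (Ci * w))) / 2)%C.
Definition Csin (w : C) : C := ((Cexp (Ci * w) - Cexp (- (Ci * w))) / (2 * Ci))%C.
Definition Ccot (w : C) : C := (Ccos w / Csin w)%C.

Fixpoint Cpow (z : C) (n : nat) : C :=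
  match n with O => 1%C | S k => (z * Cpow z k)%C end.

Fixpoint csum (f : nat -> C) (n : nat) : C :=
  match n with O => 0%C | S k => (csum f k + f k)%C end.

Definition hh (beta : R) : R := (2 - beta) * PI ^ 2.
Definition TT (beta : R) (Nt : nat) : R := sqrt (INR Nt * hh beta / 4).
Definition sigma (beta : R) : R := 2 * sqrt (2 - beta) * PI.

Definition fT (T : R) (u z : C) : C :=
  (z / RtoC PI * / Csqrt u * Cexp (Csqrt u - RtoC T)
     / (Cexp (2 * (Csqrt u - RtoC T)) + z))%C.

Definition mu (u : C) : C := if Rle_dec 0 (Im u) then RtoC (-1/2) else RtoC (1/2).
Definition mm (h : R) (u : C) : C := (- (Ci / 2) * Ccot (RtoC PI * u / RtoC h))%C.
Definition delta (h : R) (u : C) : C := (mu u - mm h u)%C.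

(* integral of g over the positively oriented boundary of the rectangle
   {x0 <= Re u <= x1, |Im u| <= a}: bottom (left to right), right side
   (upwards), top (right to left), left side (downwards). *)
Definition rect_integral (x0 x1 a : R) (g : C -> C) : C :=
  (RInt (V := C_R_CompleteNormedModule) (fun t => g (t, (- a)%R)) x0 x1
   + Ci * RInt (V := C_R_CompleteNormedModule) (fun t => g (x1, t)) (- a)%R a
   - RInt (V := C_R_CompleteNormedModule) (fun t => g (t, a)) x0 x1
   - Ci * RInt (V := C_R_CompleteNormedModule) (fun t => g (x0, t)) (- a)%R a)%C.

(* the contour Gamma for z = r e^{+- i beta pi/2} *)
Definition Gamma_integral (beta : R) (Nt : nat) (r : R) (g : C -> C) : C :=
  let T := TT beta Nt in
  rect_integral (1 - beta / 2) (4 * T ^ 2 + 1 - beta / 2)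
                (2 * PI * (T + / 2 * ln r)) g.

Definition ray_pt (beta r : R) (s : bool) : C :=
  (RtoC r * Cexp (0, ((if s then 1 else -1) * beta * PI / 2)%R))%C.

Definition pole (beta : R) (N1 j : nat) : R :=
  - exp (- sigma beta * (sqrt (INR N1) - sqrt (INR j))).

Definition rat_approx (beta : R) (N1 N2 : nat) (a c : nat -> C) (z : C) : C :=
  (csum (fun k => a (S k) / (z - RtoC (pole beta N1 (S k)))) N1
   + csum (fun k => c k * Cpow z k) (S N2))%C.

(* Main.v *)
(** The substitution x = exp (2 (sqrt u - T)) in
    sqrt z = (1 / pi) int_0^oo z / (x + z) x^(-1/2) dx gives
    sqrt z = int_0^oo f (u, z) du + O(e^-T), and the integral may be cut to
    [1 - beta/2, 4 T^2 + 1 - beta/2] at the cost of another O(e^-T).  With Nt = 4 N1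
    and step h, the trapezoidal sum over u = j h has exactly the poles p_j for j <= N1.
    Integral minus sum is the contour integral of f delta, up to the residues at the
    two zeros u_+, u_- of the denominator of f inside Gamma; there
    sqrt u = L + i theta with L = T + (log r) / 2 and |theta| >= (2 - beta) pi / 4, so
    |delta| <= 2 e^-L cancels the size e^(L - T) of the residue of f and each
    contributes O(e^-T).  The terms with N1 < j <= 4 N1 have poles -X with X >= 1;
    since |1 - z| <= 2 kappa with kappa < 1 on the two rays, expanding 1 / (X + z) in
    powers of (1 - z) / (1 + X) to order O(T) = O(sqrt N1) replaces them by a
    polynomial.  When r < e^(4 + 2 beta - 2 T) the sum and sqrt z are both O(e^-T). *)

Require Import Defs.
From Stdlib Require Import Reals ZArith Lra Lia.
From Coquelicot Require Import Coquelicot.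
Open Scope R_scope.

(** The product of f and delta is not meromorphic in the rectangle: [mu] jumps across the real axis,
    exactly where [mm] has its poles. The rectangle is therefore cut into three horizontal strips.
    In the middle one, Cauchy's theorem on each half turns the [mu] part into the integral of f
    along the axis, and the residues of [mm] give the trapezoidal sum. Each outer strip holds one
    simple pole of f.

    Since Nt = 4 N1, T = sqrt (N1 h), so the node j = N1 sits at X = 1 and the first N1 poles lie in
    [-1, 0). The step h = (2 - beta) pi^2 is the largest with h <= 4 pi |theta| at the pole of f
    nearer the axis, and T = pi sqrt ((2 - beta) N1) is then the exponent sought; adding N2 = O(sqrt
    N1) to N1 shifts sqrt N by a bounded amount only. The threshold on r means L >= 2 + beta, which
    keeps both poles of f to the right of the left side of Gamma. The terms replaced by the
    polynomial are only known to sum to O(e^T), hence the relative accuracy e^(-2 T) demanded of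
    it. *)

Lemma Cmod_minus_sym (u v : C) : Cmod (u - v) = Cmod (v - u).
Proof. rewrite <- Cmod_opp. f_equal. ring. Qed.

Lemma Cmod_minus_le (u v : C) : Cmod u - Cmod v <= Cmod (u - v).
Proof.
  pose proof (Cmod_triangle (u - v) v) as H.
  replace (u - v + v)%C with u in H by ring. lra.
Qed.

Lemma Cmod_pos (u : C) : u <> 0 -> 0 < Cmod u.
Proof. apply Cmod_gt_0. Qed.

Lemma Cmod_pos_neq0 (u : C) : 0 < Cmod u -> u <> 0.
Proof. apply Cmod_gt_0. Qed.

Lemma Cminus_eq_0 (u v : C) : (u - v = 0)%C -> u = v.
Proof. intros H. replace u with (u - v + v)%C by ring. rewrite H. ring. Qed.

Lemma C_integral (u v : C) : (u * v = 0)%C -> u = 0 \/ v = 0.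
Proof.
  intros H. destruct (Ceq_dec u 0) as [e|e]; [now left|right].
  replace v with (/ u * (u * v))%C by (field; exact e). rewrite H. ring.
Qed.

Lemma Cdiv_neq_0 (u v : C) : u <> 0 -> v <> 0 -> (u / v)%C <> 0.
Proof.
  intros Hu Hv H. apply Hu. replace u with (u / v * v)%C by (field; exact Hv).
  rewrite H. ring.
Qed.

Lemma Im_le_Cmod (c : C) : Rabs (Im c) <= Cmod c.
Proof. eapply Rle_trans; [|apply Rmax_Cmod]. apply Rmax_r. Qed.

Lemma Cmod_le_abs (u : C) : Cmod u <= Rabs (Re u) + Rabs (Im u).
Proof.
  destruct u as [x y]; simpl.
  replace (x, y) with (RtoC x + Ci * RtoC y)%C
    by (unfold RtoC, Ci, Cplus, Cmult; simpl; f_equal; ring).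
  eapply Rle_trans; [apply Cmod_triangle|].
  rewrite Cmod_mult, Cmod_Ci, !Cmod_R. lra.
Qed.

(** * Complex differentiability *)

(** An epsilon-delta form without filters, so that every estimate is a plain inequality;
    [ccont_hpath] and [ccont_vpath] lead back to the continuity that integration needs. *)
Definition ccont (g : C -> C) (u : C) : Prop :=
  forall eps, 0 < eps -> exists d, 0 < d /\
    forall w, Cmod (w - u) < d -> Cmod (g w - g u) < eps.

Lemma ccont_ext_loc (f g : C -> C) u d : 0 < d ->
  (forall w, Cmod (w - u) < d -> f w = g w) -> ccont f u -> ccont g u.
Proof.
  intros Hd E Hf eps He. destruct (Hf eps He) as [d1 [Hd1 H1]].
  exists (Rmin d d1). split; [now apply Rmin_pos|]. intros w Hw.
  pose proof (Rmin_l d d1). pose proof (Rmin_r d d1).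
  rewrite <- !E; [apply H1; lra| |lra].
  replace (u - u)%C with (RtoC 0) by ring. rewrite Cmod_0. lra.
Qed.

Lemma ccont_const c u : ccont (fun _ => c) u.
Proof.
  intros eps He. exists 1. split; [lra|]. intros w _.
  replace (c - c)%C with (RtoC 0) by ring. rewrite Cmod_0. lra.
Qed.

Lemma ccont_id u : ccont (fun w => w) u.
Proof. intros eps He. exists eps. auto. Qed.

Lemma ccont_plus f g u : ccont f u -> ccont g u -> ccont (fun w => (f w + g w)%C) u.
Proof.
  intros Hf Hg eps He.
  destruct (Hf (eps / 2)) as [d1 [Hd1 H1]]; [lra|].
  destruct (Hg (eps / 2)) as [d2 [Hd2 H2]]; [lra|].
  exists (Rmin d1 d2). split; [now apply Rmin_pos|]. intros w Hw.
  pose proof (Rmin_l d1 d2). pose proof (Rmin_r d1 d2).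
  replace (f w + g w - (f u + g u))%C with ((f w - f u) + (g w - g u))%C by ring.
  eapply Rle_lt_trans; [apply Cmod_triangle|].
  specialize (H1 w). specialize (H2 w). lra.
Qed.

Lemma ccont_mult f g u : ccont f u -> ccont g u -> ccont (fun w => (f w * g w)%C) u.
Proof.
  intros Hf Hg eps He.
  set (A := Cmod (f u) + 1). set (B := Cmod (g u) + 1).
  assert (HA : 0 < A) by (unfold A; pose proof (Cmod_ge_0 (f u)); lra).
  assert (HB : 0 < B) by (unfold B; pose proof (Cmod_ge_0 (g u)); lra).
  destruct (Hf (Rmin 1 (eps / (2 * B)))) as [d1 [Hd1 H1]].
  { apply Rmin_pos; [lra|]. apply Rdiv_lt_0_compat; lra. }
  destruct (Hg (eps / (2 * A))) as [d2 [Hd2 H2]].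
  { apply Rdiv_lt_0_compat; lra. }
  exists (Rmin d1 d2). split; [now apply Rmin_pos|]. intros w Hw.
  pose proof (Rmin_l d1 d2). pose proof (Rmin_r d1 d2).
  specialize (H1 w ltac:(lra)). specialize (H2 w ltac:(lra)).
  pose proof (Rmin_l 1 (eps / (2 * B))). pose proof (Rmin_r 1 (eps / (2 * B))).
  replace (f w * g w - f u * g u)%C
    with (f w * (g w - g u) + (f w - f u) * g u)%C by ring.
  eapply Rle_lt_trans; [apply Cmod_triangle|]. rewrite !Cmod_mult.
  pose proof (Cmod_minus_le (f w) (f u)).
  assert (E1 : Cmod (f w) * Cmod (g w - g u) <= A * Cmod (g w - g u)).
  { apply Rmult_le_compat_r; [apply Cmod_ge_0|]. unfold A. lra. }
  assert (E2 : A * Cmod (g w - g u) < A * (eps / (2 * A)))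
    by (apply Rmult_lt_compat_l; assumption).
  assert (E3 : Cmod (f w - f u) * Cmod (g u) <= eps / (2 * B) * B).
  { apply Rmult_le_compat; try apply Cmod_ge_0; [lra|unfold B; lra]. }
  replace (A * (eps / (2 * A))) with (eps / 2) in E2 by (field; lra).
  replace (eps / (2 * B) * B) with (eps / 2) in E3 by (field; lra).
  lra.
Qed.

Lemma ccont_opp f u : ccont f u -> ccont (fun w => (- f w)%C) u.
Proof.
  intros Hf eps He. destruct (Hf eps He) as [d [Hd H]]. exists d. split; [easy|].
  intros w Hw. replace (- f w - - f u)%C with (- (f w - f u))%C by ring.
  rewrite Cmod_opp. auto.
Qed.

Lemma ccont_minus f g u : ccont f u -> ccont g u -> ccont (fun w => (f w - g w)%C) u.
Proof. intros Hf Hg. apply ccont_plus; [exact Hf|]. now apply ccont_opp. Qed.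

Lemma ccont_neq0 f u : ccont f u -> f u <> 0 ->
  exists d, 0 < d /\ forall w, Cmod (w - u) < d -> Cmod (f u) / 2 < Cmod (f w).
Proof.
  intros Hf Hn. apply Cmod_pos in Hn.
  destruct (Hf (Cmod (f u) / 2)) as [d [Hd H]]; [lra|].
  exists d. split; [easy|]. intros w Hw. specialize (H w Hw).
  rewrite Cmod_minus_sym in H. pose proof (Cmod_minus_le (f u) (f w)). lra.
Qed.

Lemma ccont_inv f u : ccont f u -> f u <> 0 -> ccont (fun w => (/ f w)%C) u.
Proof.
  intros Hf Hn eps He.
  destruct (ccont_neq0 f u Hf Hn) as [d1 [Hd1 H1]].
  pose proof (Cmod_pos _ Hn) as Hp. set (A := Cmod (f u)) in *.
  destruct (Hf (eps * (A * A / 2))) as [d2 [Hd2 H2]].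
  { pose proof (Rmult_lt_0_compat _ _ Hp Hp). apply Rmult_lt_0_compat; lra. }
  exists (Rmin d1 d2). split; [now apply Rmin_pos|]. intros w Hw.
  pose proof (Rmin_l d1 d2). pose proof (Rmin_r d1 d2).
  specialize (H1 w ltac:(lra)). specialize (H2 w ltac:(lra)).
  assert (Hw0 : f w <> 0) by (apply Cmod_pos_neq0; lra).
  replace (/ f w - / f u)%C with (- (f w - f u) / (f w * f u))%C by (field; auto).
  rewrite Cmod_div by (intros E; apply C_integral in E; tauto).
  rewrite Cmod_opp, Cmod_mult. fold A.
  assert (HP : 0 < Cmod (f w) * A) by (apply Rmult_lt_0_compat; lra).
  apply Rmult_lt_reg_r with (Cmod (f w) * A); [exact HP|].
  unfold Rdiv. rewrite Rmult_assoc, Rinv_l by (apply Rgt_not_eq, HP).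
  assert (A * (A / 2) < A * Cmod (f w)) by (apply Rmult_lt_compat_l; lra).
  nra.
Qed.

Lemma ccont_div f g u : ccont f u -> ccont g u -> g u <> 0 -> ccont (fun w => (f w / g w)%C) u.
Proof. intros Hf Hg Hn. apply ccont_mult; [exact Hf|]. now apply ccont_inv. Qed.

Lemma ccont_comp f g u : ccont g u -> ccont f (g u) -> ccont (fun w => f (g w)) u.
Proof.
  intros Hg Hf eps He. destruct (Hf eps He) as [d1 [Hd1 H1]].
  destruct (Hg d1 Hd1) as [d2 [Hd2 H2]]. exists d2. split; auto.
Qed.

(* Caratheodory's form of the derivative, which needs no division. *)
Definition cderiv (g : C -> C) (u l : C) : Prop :=
  exists phi d, 0 < d /\ ccont phi u /\ phi u = l /\
    forall w, Cmod (w - u) < d -> (g w - g u = phi w * (w - u))%C.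

Definition hol (g : C -> C) (u : C) : Prop := exists l, cderiv g u l.

Lemma Cmod_self (u : C) : Cmod (u - u) = 0.
Proof. replace (u - u)%C with (RtoC 0) by ring. apply Cmod_0. Qed.

Lemma cderiv_ext_loc f g u l d : 0 < d ->
  (forall w, Cmod (w - u) < d -> f w = g w) -> cderiv f u l -> cderiv g u l.
Proof.
  intros Hd E [phi [d1 [Hd1 [Hc [Hl H]]]]]. exists phi, (Rmin d d1).
  split; [now apply Rmin_pos|]. repeat split; auto. intros w Hw.
  pose proof (Rmin_l d d1). pose proof (Rmin_r d d1).
  rewrite <- !E; [apply H; lra| |lra]. rewrite Cmod_self. lra.
Qed.

Lemma cderiv_ccont g u l : cderiv g u l -> ccont g u.
Proof.
  intros [phi [d [Hd [Hc [Hl H]]]]].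
  apply (ccont_ext_loc (fun w => g u + phi w * (w - u))%C g u d Hd).
  - intros w Hw. rewrite <- H by exact Hw. ring.
  - apply ccont_plus; [apply ccont_const|]. apply ccont_mult; [exact Hc|].
    apply ccont_minus; [apply ccont_id|apply ccont_const].
Qed.

Lemma hol_ccont g u : hol g u -> ccont g u.
Proof. intros [l H]. eapply cderiv_ccont, H. Qed.

(* At [w = u] the prescribed value [l] replaces Rocq's junk quotient. *)
Lemma cderiv_of_quotient g u l :
  (forall eps, 0 < eps -> exists d, 0 < d /\ forall w, Cmod (w - u) < d ->
     Cmod (g w - g u - l * (w - u)) <= eps * Cmod (w - u)) ->
  cderiv g u l.
Proof.
  intros H.
  exists (fun w => if Ceq_dec w u then l else ((g w - g u) / (w - u))%C), 1.
  split; [lra|]. split; [|split].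
  - intros eps He. destruct (H (eps / 2)) as [d [Hd H1]]; [lra|].
    exists d. split; [easy|]. intros w Hw.
    destruct (Ceq_dec u u) as [_|n]; [|now destruct n].
    destruct (Ceq_dec w u) as [e|n]; [rewrite Cmod_self; lra|].
    assert (Hn : (w - u)%C <> 0) by (intros E; apply n, Cminus_eq_0, E).
    replace ((g w - g u) / (w - u) - l)%C
      with ((g w - g u - l * (w - u)) / (w - u))%C by (field; auto).
    rewrite Cmod_div by auto. specialize (H1 w Hw). apply Cmod_pos in Hn.
    apply Rle_lt_trans with (eps / 2); [|lra].
    apply Rmult_le_reg_r with (Cmod (w - u)); [auto|].
    unfold Rdiv at 1. rewrite Rmult_assoc, Rinv_l by lra. lra.
  - destruct (Ceq_dec u u) as [_|n]; [easy|now destruct n].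
  - intros w _. destruct (Ceq_dec w u) as [e|n]; [rewrite e; ring|].
    field. intros E; apply n, Cminus_eq_0, E.
Qed.

(** The way back from Caratheodory's form to the first-order expansion, which is what Goursat's
    argument consumes. *)
Lemma cderiv_affine g u l : cderiv g u l ->
  forall eps, 0 < eps -> exists d, 0 < d /\ forall w, Cmod (w - u) < d ->
     Cmod (g w - g u - l * (w - u)) <= eps * Cmod (w - u).
Proof.
  intros [phi [d [Hd [Hc [Hl H]]]]] eps He.
  destruct (Hc eps He) as [d1 [Hd1 H1]]. exists (Rmin d d1).
  split; [now apply Rmin_pos|]. intros w Hw.
  pose proof (Rmin_l d d1). pose proof (Rmin_r d d1).
  rewrite H by lra. rewrite <- Hl.
  replace (phi w * (w - u) - phi u * (w - u))%C with ((phi w - phi u) * (w - u))%C by ring.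
  rewrite Cmod_mult. apply Rmult_le_compat_r; [apply Cmod_ge_0|].
  apply Rlt_le, H1. lra.
Qed.

Lemma cderiv_const c u : cderiv (fun _ => c) u 0.
Proof.
  exists (fun _ => RtoC 0), 1. split; [lra|]. split; [apply ccont_const|].
  split; [easy|]. intros; ring.
Qed.

Lemma cderiv_id u : cderiv (fun w => w) u 1.
Proof.
  exists (fun _ => RtoC 1), 1. split; [lra|]. split; [apply ccont_const|].
  split; [easy|]. intros; ring.
Qed.

Lemma cderiv_plus f g u a b : cderiv f u a -> cderiv g u b ->
  cderiv (fun w => (f w + g w)%C) u (a + b)%C.
Proof.
  intros [p [d [Hd [Hc [Hl H]]]]] [q [d' [Hd' [Hc' [Hl' H']]]]].
  exists (fun w => p w + q w)%C, (Rmin d d'). split; [now apply Rmin_pos|].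
  split; [now apply ccont_plus|]. split; [now rewrite Hl, Hl'|]. intros w Hw.
  pose proof (Rmin_l d d'). pose proof (Rmin_r d d').
  replace (f w + g w - (f u + g u))%C with ((f w - f u) + (g w - g u))%C by ring.
  rewrite H, H' by lra. ring.
Qed.

Lemma cderiv_mult f g u a b : cderiv f u a -> cderiv g u b ->
  cderiv (fun w => (f w * g w)%C) u (a * g u + f u * b)%C.
Proof.
  intros Hf Hg. pose proof (cderiv_ccont _ _ _ Hg) as Cg.
  destruct Hf as [p [d [Hd [Hc [Hl H]]]]], Hg as [q [d' [Hd' [Hc' [Hl' H']]]]].
  exists (fun w => p w * g w + f u * q w)%C, (Rmin d d'). split; [now apply Rmin_pos|].
  split.
  { apply ccont_plus; apply ccont_mult; auto. apply ccont_const. }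
  split; [now rewrite Hl, Hl'|]. intros w Hw.
  pose proof (Rmin_l d d'). pose proof (Rmin_r d d').
  replace (f w * g w - f u * g u)%C with ((f w - f u) * g w + f u * (g w - g u))%C by ring.
  rewrite H, H' by lra. ring.
Qed.

Lemma cderiv_inv f u a : cderiv f u a -> f u <> 0 ->
  cderiv (fun w => (/ f w)%C) u (- a / (f u * f u))%C.
Proof.
  intros Hf Hn. pose proof (cderiv_ccont _ _ _ Hf) as Cf.
  destruct Hf as [p [d [Hd [Hc [Hl H]]]]].
  destruct (ccont_neq0 f u Cf Hn) as [d1 [Hd1 H1]].
  assert (Hne : forall w, Cmod (w - u) < d1 -> f w <> 0).
  { intros w Hw. apply Cmod_pos_neq0. specialize (H1 w Hw).
    pose proof (Cmod_pos _ Hn). lra. }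
  exists (fun w => - p w / (f w * f u))%C, (Rmin d d1). split; [now apply Rmin_pos|].
  split.
  { apply ccont_div; [now apply ccont_opp| |].
    - apply ccont_mult; [auto|apply ccont_const].
    - intros E; apply C_integral in E; tauto. }
  split; [now rewrite Hl|]. intros w Hw.
  pose proof (Rmin_l d d1). pose proof (Rmin_r d d1).
  assert (f w <> 0) by (apply Hne; lra).
  replace (/ f w - / f u)%C with (- (f w - f u) / (f w * f u))%C by (field; auto).
  rewrite H by lra. field; auto.
Qed.

Lemma cderiv_comp f g u a b : cderiv g u b -> cderiv f (g u) a ->
  cderiv (fun w => f (g w)) u (a * b)%C.
Proof.
  intros Hg Hf. pose proof (cderiv_ccont _ _ _ Hg) as Cg.
  destruct Hf as [p [d [Hd [Hc [Hl H]]]]], Hg as [q [d' [Hd' [Hc' [Hl' H']]]]].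
  destruct (Cg d Hd) as [d1 [Hd1 H1]].
  exists (fun w => p (g w) * q w)%C, (Rmin d1 d'). split; [now apply Rmin_pos|].
  split.
  { apply ccont_mult; auto. now apply ccont_comp. }
  split; [now rewrite Hl, Hl'|]. intros w Hw.
  pose proof (Rmin_l d1 d'). pose proof (Rmin_r d1 d').
  rewrite H by (apply H1; lra). rewrite H' by lra. ring.
Qed.

Lemma hol_const c u : hol (fun _ => c) u.
Proof. eexists; apply cderiv_const. Qed.

Lemma hol_id u : hol (fun w => w) u.
Proof. eexists; apply cderiv_id. Qed.

Lemma hol_plus f g u : hol f u -> hol g u -> hol (fun w => (f w + g w)%C) u.
Proof. intros [a Ha] [b Hb]. eexists. apply cderiv_plus; eassumption. Qed.

Lemma hol_mult f g u : hol f u -> hol g u -> hol (fun w => (f w * g w)%C) u.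
Proof. intros [a Ha] [b Hb]. eexists. apply cderiv_mult; eassumption. Qed.

Lemma hol_opp f u : hol f u -> hol (fun w => (- f w)%C) u.
Proof.
  intros H. destruct (hol_mult (fun _ => (- 1)%C) f u (hol_const _ _) H) as [l Hl].
  exists l. apply (cderiv_ext_loc _ _ u l 1 ltac:(lra)) with (2 := Hl). intros; ring.
Qed.

Lemma hol_minus f g u : hol f u -> hol g u -> hol (fun w => (f w - g w)%C) u.
Proof. intros Hf Hg. apply hol_plus; [exact Hf|]. now apply hol_opp. Qed.

Lemma hol_inv f u : hol f u -> f u <> 0 -> hol (fun w => (/ f w)%C) u.
Proof. intros [a Ha] Hn. eexists. now apply cderiv_inv with (a := a). Qed.

Lemma hol_div f g u : hol f u -> hol g u -> g u <> 0 -> hol (fun w => (f w / g w)%C) u.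
Proof. intros Hf Hg Hn. apply hol_mult; [exact Hf|]. now apply hol_inv. Qed.

Lemma hol_comp f g u : hol g u -> hol f (g u) -> hol (fun w => f (g w)) u.
Proof. intros [b Hb] [a Ha]. eexists. eapply cderiv_comp; eassumption. Qed.

Lemma hol_ext_loc f g u d : 0 < d ->
  (forall w, Cmod (w - u) < d -> f w = g w) -> hol f u -> hol g u.
Proof. intros Hd E [l Hl]. exists l. eapply cderiv_ext_loc; eassumption. Qed.

(** * The complex exponential and the principal square root *)

Lemma Cexp_plus u v : Cexp (u + v) = (Cexp u * Cexp v)%C.
Proof.
  destruct u as [a b], v as [c d]. unfold Cexp, Cmult; simpl.
  rewrite exp_plus, cos_plus, sin_plus. f_equal; ring.
Qed.

Lemma Cexp_0 : Cexp 0 = 1.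
Proof. unfold Cexp; simpl. rewrite exp_0, cos_0, sin_0. unfold RtoC. f_equal; ring. Qed.

Lemma Cmod_Cexp u : Cmod (Cexp u) = exp (Re u).
Proof.
  unfold Cexp, Cmod; simpl.
  transitivity (sqrt (Rsqr (exp (Re u)))); [|apply sqrt_Rsqr, Rlt_le, exp_pos].
  f_equal. unfold Rsqr. pose proof (sin2_cos2 (Im u)) as H. unfold Rsqr in H.
  transitivity (exp (Re u) * exp (Re u) * (sin (Im u) * sin (Im u) + cos (Im u) * cos (Im u)));
    [ring|rewrite H; ring].
Qed.

Lemma Cexp_neq_0 u : Cexp u <> 0.
Proof. apply Cmod_pos_neq0. rewrite Cmod_Cexp. apply exp_pos. Qed.

Lemma Cexp_opp u : Cexp (- u) = (/ Cexp u)%C.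
Proof.
  pose proof (Cexp_neq_0 u).
  replace (Cexp (- u)) with (Cexp (- u) * Cexp u / Cexp u)%C by (field; auto).
  rewrite <- Cexp_plus. replace (- u + u)%C with (RtoC 0) by ring.
  rewrite Cexp_0. field; auto.
Qed.

Lemma real_affine_0 (f : R -> R) l : is_derive f 0 l ->
  forall eps, 0 < eps -> exists d, 0 < d /\ forall x, Rabs x < d ->
    Rabs (f x - f 0 - l * x) <= eps * Rabs x.
Proof.
  intros H eps He. apply is_derive_Reals in H.
  destruct (H eps He) as [d Hd]. exists d. split; [apply cond_pos|].
  intros x Hx. destruct (Req_dec x 0) as [->|Hn].
  { rewrite Rmult_0_r. replace (f 0 - f 0 - 0) with 0 by ring. rewrite Rabs_R0. lra. }
  specialize (Hd x Hn Hx). rewrite Rplus_0_l in Hd.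
  replace (f x - f 0 - l * x) with (((f x - f 0) / x - l) * x) by (field; auto).
  rewrite Rabs_mult. apply Rmult_le_compat_r; [apply Rabs_pos|lra].
Qed.

(** Only the point 0 needs estimates, taken from the first-order expansions of exp, cos and sin;
    [Cexp_plus] then carries the derivative to every point. *)
Lemma cderiv_Cexp_0 : cderiv Cexp 0 1.
Proof.
  apply cderiv_of_quotient. intros eps He.
  assert (D1 : is_derive exp 0 1).
  { auto_derive; [easy|]. rewrite exp_0; ring. }
  assert (D2 : is_derive cos 0 0).
  { auto_derive; [easy|]. rewrite sin_0; ring. }
  assert (D3 : is_derive sin 0 1).
  { auto_derive; [easy|]. rewrite cos_0; ring. }
  (* Each elementary error is worth at most eps / 10 times the modulus: the real part collects three
     such shares and the imaginary part four. *)
  set (e1 := Rmin 1 (eps / 10)).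
  assert (He1 : 0 < e1) by (apply Rmin_pos; lra).
  destruct (real_affine_0 _ _ D1 e1 He1) as [d1 [Hd1 H1]].
  destruct (real_affine_0 _ _ D2 e1 He1) as [d2 [Hd2 H2]].
  destruct (real_affine_0 _ _ D3 e1 He1) as [d3 [Hd3 H3]].
  pose (d4 := Rmin (1 / 2) (eps / 10)).
  assert (Hd4 : 0 < d4) by (apply Rmin_pos; lra).
  exists (Rmin (Rmin d1 d2) (Rmin d3 d4)). split; [apply Rmin_pos; apply Rmin_pos; assumption|].
  intros [x y] Hw. replace ((x, y) - 0)%C with (x, y) in * by (unfold Cminus, Copp, Cplus, RtoC; simpl; f_equal; ring).
  set (k := Cmod (x, y)) in *.
  pose proof (re_le_Cmod (x, y)) as Hx. pose proof (Im_le_Cmod (x, y)) as Hy.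
  simpl in Hx, Hy. fold k in Hx, Hy.
  pose proof (Rmin_l (Rmin d1 d2) (Rmin d3 d4)). pose proof (Rmin_r (Rmin d1 d2) (Rmin d3 d4)).
  pose proof (Rmin_l d1 d2). pose proof (Rmin_r d1 d2). pose proof (Rmin_l d3 d4).
  pose proof (Rmin_r d3 d4).
  specialize (H1 x ltac:(lra)). specialize (H2 y ltac:(lra)). specialize (H3 y ltac:(lra)).
  rewrite exp_0 in H1. rewrite cos_0 in H2. rewrite sin_0 in H3.
  rewrite Cexp_0.
  assert (Hk : k <= 1 / 2) by (pose proof (Rmin_l (1/2) (eps / 10)); unfold d4 in *; lra).
  assert (Hk2 : k <= eps / 10) by (pose proof (Rmin_r (1/2) (eps / 10)); unfold d4 in *; lra).
  assert (He2 : e1 <= eps / 10) by apply Rmin_r.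
  assert (He3 : e1 <= 1) by apply Rmin_l.
  assert (Hk0 : 0 <= k) by apply Cmod_ge_0.
  assert (E1 : Rabs (exp x - 1) <= 2 * k).
  { replace (exp x - 1) with ((exp x - 1 - 1 * x) + x) by ring.
    eapply Rle_trans; [apply Rabs_triang|]. pose proof (Rabs_pos x).
    assert (e1 * Rabs x <= 1 * k) by (apply Rmult_le_compat; lra). lra. }
  assert (E2 : Rabs (exp x) <= 2).
  { replace (exp x) with ((exp x - 1) + 1) by ring.
    eapply Rle_trans; [apply Rabs_triang|]. rewrite Rabs_R1. lra. }
  assert (X1 : e1 * Rabs x <= eps / 10 * k)
    by (apply Rmult_le_compat; try lra; apply Rabs_pos).
  assert (X2 : e1 * Rabs y <= eps / 10 * k)
    by (apply Rmult_le_compat; try lra; apply Rabs_pos).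
  eapply Rle_trans; [apply Cmod_le_abs|]. unfold Cexp; simpl.
  set (A := Rabs _). set (B := Rabs _).
  assert (HA : A <= 3 * (eps / 10 * k)).
  { unfold A.
    replace (exp x * cos y + - (1) + - (1 * x - 0 * y))
      with (exp x * (cos y - 1 - 0 * y) + (exp x - 1 - 1 * x)) by ring.
    eapply Rle_trans; [apply Rabs_triang|]. rewrite Rabs_mult.
    assert (Rabs (exp x) * Rabs (cos y - 1 - 0 * y) <= 2 * (eps / 10 * k))
      by (apply Rmult_le_compat; try apply Rabs_pos; lra). lra. }
  assert (HB : B <= 4 * (eps / 10 * k)).
  { unfold B.
    replace (exp x * sin y + - 0 + - (1 * y + 0 * x))
      with (exp x * (sin y - 0 - 1 * y) + (exp x - 1) * y) by ring.
    eapply Rle_trans; [apply Rabs_triang|]. rewrite !Rabs_mult.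
    assert (Rabs (exp x) * Rabs (sin y - 0 - 1 * y) <= 2 * (eps / 10 * k))
      by (apply Rmult_le_compat; try apply Rabs_pos; lra).
    assert (Rabs (exp x - 1) * Rabs y <= (2 * (eps / 10)) * k)
      by (apply Rmult_le_compat; try apply Rabs_pos; lra). lra. }
  nra.
Qed.

Lemma cderiv_Cexp u : cderiv Cexp u (Cexp u).
Proof.
  assert (H : cderiv (fun w => Cexp u * Cexp (w - u))%C u
                (0 * Cexp (u - u) + Cexp u * (1 * (1 + 0)))%C).
  { apply (cderiv_mult (fun _ => Cexp u) (fun w => Cexp (w - u))); [apply cderiv_const|].
    apply (cderiv_comp Cexp (fun w => (w - u)%C)).
    - apply cderiv_plus; [apply cderiv_id|apply cderiv_const].
    - replace (u - u)%C with (RtoC 0) by ring. apply cderiv_Cexp_0. }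
  replace (0 * Cexp (u - u) + Cexp u * (1 * (1 + 0)))%C with (Cexp u) in H by ring.
  apply (cderiv_ext_loc _ _ u _ 1 ltac:(lra)) with (2 := H).
  intros w _. rewrite <- Cexp_plus. f_equal. ring.
Qed.

Lemma hol_Cexp f u : hol f u -> hol (fun w => Cexp (f w)) u.
Proof. intros H. apply hol_comp; [exact H|]. eexists; apply cderiv_Cexp. Qed.

Lemma Csqrt_sqr u : (Csqrt u * Csqrt u = u)%C.
Proof.
  destruct u as [x y]. unfold Csqrt; simpl.
  pose proof (re_le_Cmod (x, y)) as Hx; simpl in Hx.
  pose proof (Cmod2_alt (x, y)) as H2. change (Re (x, y)) with x in H2. change (Im (x, y)) with y in H2.
  pose proof (Rle_abs x). pose proof (Rle_abs (- x)) as Hx'. rewrite Rabs_Ropp in Hx'.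
  set (m := Cmod (x, y)) in *.
  assert (S1 : sqrt ((m + x) / 2) * sqrt ((m + x) / 2) = (m + x) / 2) by (apply sqrt_sqrt; lra).
  assert (S2 : sqrt ((m - x) / 2) * sqrt ((m - x) / 2) = (m - x) / 2) by (apply sqrt_sqrt; lra).
  assert (S3 : sqrt ((m + x) / 2) * sqrt ((m - x) / 2) = Rabs y / 2).
  { rewrite <- sqrt_mult by lra.
    replace ((m + x) / 2 * ((m - x) / 2)) with (Rsqr (y / 2)) by (unfold Rsqr; nra).
    rewrite sqrt_Rsqr_abs. unfold Rdiv. rewrite Rabs_mult, (Rabs_pos_eq (/ 2)); lra. }
  set (A := sqrt ((m + x) / 2)) in *. set (B := sqrt ((m - x) / 2)) in *.
  unfold Cmult, fst, snd. destruct (Rle_dec 0 y) as [h|h].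
  - rewrite Rabs_pos_eq in S3 by exact h. f_equal; lra.
  - rewrite Rabs_left in S3 by lra. f_equal; lra.
Qed.

Lemma Re_Csqrt_ge_0 u : 0 <= Re (Csqrt u).
Proof. apply sqrt_pos. Qed.

(** With s the principal root, (s - v) (s + v) = 0, and s + v cannot vanish because its real part is
    positive. Later principal roots are all identified this way. *)
Lemma Csqrt_unique u v : 0 < Re v -> (v * v = u)%C -> Csqrt u = v.
Proof.
  intros Hv E. pose proof (Csqrt_sqr u) as H.
  assert (P : ((Csqrt u - v) * (Csqrt u + v) = 0)%C).
  { replace ((Csqrt u - v) * (Csqrt u + v))%C with (Csqrt u * Csqrt u - v * v)%C by ring.
    rewrite H, E. ring. }
  apply C_integral in P. destruct P as [P|P]; [now apply Cminus_eq_0|].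
  apply (f_equal Re) in P. pose proof (Re_Csqrt_ge_0 u).
  change (Re (Csqrt u) + Re v = 0) in P. lra.
Qed.

Lemma Re_Csqrt_pos u : 0 < Re u -> 0 < Re (Csqrt u).
Proof.
  intros H. unfold Csqrt; simpl. apply sqrt_lt_R0. pose proof (Cmod_ge_0 u). lra.
Qed.

Lemma Csqrt_neq_0 u : 0 < Re u -> Csqrt u <> 0.
Proof. intros H E. apply Re_Csqrt_pos in H. rewrite E in H. simpl in H. lra. Qed.

Lemma Cmod_Csqrt u : Cmod (Csqrt u) = sqrt (Cmod u).
Proof.
  rewrite <- (Csqrt_sqr u) at 2. rewrite Cmod_mult. symmetry. apply sqrt_square, Cmod_ge_0.
Qed.

Lemma Csqrt_RtoC t : 0 < t -> Csqrt (RtoC t) = RtoC (sqrt t).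
Proof.
  intros H. apply Csqrt_unique; simpl.
  - now apply sqrt_lt_R0.
  - rewrite <- RtoC_mult, sqrt_sqrt; [easy|lra].
Qed.

(** From (sqrt w - sqrt u) (sqrt w + sqrt u) = w - u, Caratheodory's quotient is 1 / (sqrt w + sqrt
    u). Its denominator has real part at least Re (sqrt u) > 0 for every w, so the branch cut never
    has to be discussed. *)
Lemma cderiv_Csqrt u : 0 < Re u -> cderiv Csqrt u (/ (2 * Csqrt u))%C.
Proof.
  intros Hu. pose proof (Re_Csqrt_pos u Hu) as Hp. set (s := Csqrt u) in *.
  assert (Hsum : forall w, Re s <= Cmod (Csqrt w + s)).
  { intros w. eapply Rle_trans; [|apply re_le_Cmod]. eapply Rle_trans; [|apply Rle_abs].
    change (Re s <= Re (Csqrt w) + Re s). pose proof (Re_Csqrt_ge_0 w). lra. }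
  assert (Hsum0 : forall w, (Csqrt w + s)%C <> 0).
  { intros w. apply Cmod_pos_neq0. specialize (Hsum w). lra. }
  assert (Hfac : forall w, ((Csqrt w - s) * (Csqrt w + s) = w - u)%C).
  { intros w. replace ((Csqrt w - s) * (Csqrt w + s))%C with (Csqrt w * Csqrt w - s * s)%C by ring.
    unfold s. now rewrite !Csqrt_sqr. }
  assert (Hc : ccont Csqrt u).
  { intros eps He. exists (eps * Re s). split; [nra|]. intros w Hw.
    rewrite <- Hfac, Cmod_mult in Hw. fold s. specialize (Hsum w).
    pose proof (Cmod_ge_0 (Csqrt w - s)).
    destruct (Rlt_le_dec (Cmod (Csqrt w - s)) eps); [easy|nra]. }
  exists (fun w => / (Csqrt w + s))%C, 1. split; [lra|]. split; [|split].
  - apply ccont_inv; [|apply Hsum0]. apply ccont_plus; [exact Hc|apply ccont_const].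
  - fold s. f_equal. ring.
  - intros w _. fold s. rewrite <- Hfac. field. apply Hsum0.
Qed.

Lemma hol_Csqrt u : 0 < Re u -> hol Csqrt u.
Proof. intros H. eexists. now apply cderiv_Csqrt. Qed.

(** * Rectangle integrals, Goursat's lemma and simple residues *)

Notation CInt := (RInt (V := C_R_CompleteNormedModule)).
Notation ex_CInt := (ex_RInt (V := C_R_NormedModule)).
Notation is_CInt := (is_RInt (V := C_R_NormedModule)).

Lemma is_CInt_unique f a b l : is_CInt f a b l -> CInt f a b = l.
Proof. apply (is_RInt_unique (V := C_R_CompleteNormedModule)). Qed.

Lemma CInt_correct f a b : ex_CInt f a b -> is_CInt f a b (CInt f a b).
Proof. apply (RInt_correct (V := C_R_CompleteNormedModule)). Qed.

Lemma CInt_Chasles f a b c : ex_CInt f a b -> ex_CInt f b c ->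
  (CInt f a b + CInt f b c)%C = CInt f a c.
Proof. apply (RInt_Chasles (V := C_R_CompleteNormedModule)). Qed.

Lemma is_CInt_plus f g a b lf lg : is_CInt f a b lf -> is_CInt g a b lg ->
  is_CInt (fun t => f t + g t)%C a b (lf + lg)%C.
Proof. apply (is_RInt_plus (V := C_R_NormedModule)). Qed.

Lemma is_CInt_pair (f : R -> C) a b lu lv :
  is_RInt (fun t => Re (f t)) a b lu -> is_RInt (fun t => Im (f t)) a b lv ->
  is_CInt f a b (lu, lv).
Proof. apply is_RInt_fct_extend_pair. Qed.

(** Integration treats C as a real module, so a complex factor is pulled out through real and
    imaginary parts. *)
Lemma is_CInt_scal c f a b l : is_CInt f a b l ->
  is_CInt (fun t => c * f t)%C a b (c * l)%C.
Proof.
  intros H.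
  pose proof (is_RInt_fct_extend_fst f a b l H) as H1.
  pose proof (is_RInt_fct_extend_snd f a b l H) as H2.
  apply is_CInt_pair.
  - exact (is_RInt_minus _ _ _ _ _ _ (is_RInt_scal _ _ _ (fst c) _ H1) (is_RInt_scal _ _ _ (snd c) _ H2)).
  - exact (is_RInt_plus _ _ _ _ _ _ (is_RInt_scal _ _ _ (fst c) _ H2) (is_RInt_scal _ _ _ (snd c) _ H1)).
Qed.

Lemma CInt_lin c f g a b : ex_CInt f a b -> ex_CInt g a b ->
  CInt (fun t => f t + c * g t)%C a b = (CInt f a b + c * CInt g a b)%C.
Proof.
  intros Hf Hg. apply is_CInt_unique, is_CInt_plus; [|apply is_CInt_scal]; now apply CInt_correct.
Qed.

Lemma ex_CInt_lin c f g a b : ex_CInt f a b -> ex_CInt g a b ->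
  ex_CInt (fun t => f t + c * g t)%C a b.
Proof.
  intros [l Hl] [m Hm]. eexists. apply is_CInt_plus; [exact Hl|apply is_CInt_scal, Hm].
Qed.

Lemma norm_C_R (u : C) : @norm R_AbsRing C_R_NormedModule u = Cmod u.
Proof.
  destruct u as [x y]. unfold Cmod. simpl. unfold norm; simpl. unfold prod_norm; simpl.
  unfold norm; simpl. unfold abs; simpl. f_equal.
  rewrite !Rmult_1_r. rewrite <- !Rabs_mult. rewrite !Rabs_pos_eq by nra. ring.
Qed.

Lemma Cmod_CInt_le f a b M : a <= b -> ex_CInt f a b ->
  (forall t, a <= t <= b -> Cmod (f t) <= M) -> Cmod (CInt f a b) <= (b - a) * M.
Proof.
  intros Hab Hf H. rewrite <- norm_C_R.
  apply (norm_RInt_le_const (V := C_R_NormedModule) f a b); [easy| |now apply CInt_correct].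
  intros t Ht. rewrite norm_C_R. now apply H.
Qed.

Lemma ccont_hpath g x y : ccont g (x, y) ->
  continuous (U := C_R_NormedModule) (fun t => g (t, y)) x.
Proof.
  intros H. apply filterlim_locally. intros eps.
  destruct (H eps (cond_pos eps)) as [d [Hd H1]]. exists (mkposreal d Hd). intros t Ht.
  assert (E : Cmod ((t, y) - (x, y)) < d).
  { replace ((t, y) - (x, y))%C with (RtoC (t - x))
      by (unfold RtoC, Cminus, Cplus, Copp; simpl; f_equal; ring).
    rewrite Cmod_R. exact Ht. }
  specialize (H1 _ E).
  pose proof (re_le_Cmod (g (t, y) - g (x, y))) as A1.
  pose proof (Im_le_Cmod (g (t, y) - g (x, y))) as A2.
  split; [change (Rabs (Re (g (t, y) - g (x, y))%C) < eps)|change (Rabs (Im (g (t, y) - g (x, y))%C) < eps)]; lra.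
Qed.

Lemma ccont_vpath g x y : ccont g (x, y) ->
  continuous (U := C_R_NormedModule) (fun t => g (x, t)) y.
Proof.
  intros H. apply filterlim_locally. intros eps.
  destruct (H eps (cond_pos eps)) as [d [Hd H1]]. exists (mkposreal d Hd). intros t Ht.
  assert (E : Cmod ((x, t) - (x, y)) < d).
  { replace ((x, t) - (x, y))%C with (Ci * RtoC (t - y))%C
      by (unfold RtoC, Ci, Cminus, Cmult, Cplus, Copp; simpl; f_equal; ring).
    rewrite Cmod_mult, Cmod_Ci, Cmod_R, Rmult_1_l. exact Ht. }
  specialize (H1 _ E).
  pose proof (re_le_Cmod (g (x, t) - g (x, y))) as A1.
  pose proof (Im_le_Cmod (g (x, t) - g (x, y))) as A2.
  split; [change (Rabs (Re (g (x, t) - g (x, y))%C) < eps)|change (Rabs (Im (g (x, t) - g (x, y))%C) < eps)]; lra.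
Qed.

Lemma ex_CInt_h g a b y : a <= b -> (forall t, a <= t <= b -> ccont g (t, y)) ->
  ex_CInt (fun t => g (t, y)) a b.
Proof.
  intros Hab H. apply (ex_RInt_continuous (V := C_R_CompleteNormedModule)).
  rewrite Rmin_left, Rmax_right by exact Hab. intros t Ht. apply ccont_hpath, H, Ht.
Qed.

Lemma ex_CInt_v g a b x : a <= b -> (forall t, a <= t <= b -> ccont g (x, t)) ->
  ex_CInt (fun t => g (x, t)) a b.
Proof.
  intros Hab H. apply (ex_RInt_continuous (V := C_R_CompleteNormedModule)).
  rewrite Rmin_left, Rmax_right by exact Hab. intros t Ht. apply ccont_vpath, H, Ht.
Qed.

(** The shape of [rect_integral], but with independent lower and upper heights, so that rectangles
    can be cut and translated. *)
Definition RI (g : C -> C) (x0 x1 y0 y1 : R) : C :=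
  (CInt (fun t => g (t, y0)) x0 x1
   + Ci * CInt (fun t => g (x1, t)) y0 y1
   - CInt (fun t => g (t, y1)) x0 x1
   - Ci * CInt (fun t => g (x0, t)) y0 y1)%C.

(** [RInt] is total, so additivity and linearity of [RI] require this side condition. Integrability
    is asked rather than continuity because [mu] jumps where the vertical sides cross the real
    axis. *)
Definition edges_int (g : C -> C) (x0 x1 y0 y1 : R) : Prop :=
  ex_CInt (fun t => g (t, y0)) x0 x1 /\ ex_CInt (fun t => g (x1, t)) y0 y1 /\
  ex_CInt (fun t => g (t, y1)) x0 x1 /\ ex_CInt (fun t => g (x0, t)) y0 y1.

Lemma edges_int_ccont g x0 x1 y0 y1 : x0 <= x1 -> y0 <= y1 ->
  (forall x y, x0 <= x <= x1 -> y0 <= y <= y1 ->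
     x = x0 \/ x = x1 \/ y = y0 \/ y = y1 -> ccont g (x, y)) ->
  edges_int g x0 x1 y0 y1.
Proof.
  intros Hx Hy H. unfold edges_int. split; [|split; [|split]].
  - apply (ex_CInt_h g x0 x1 y0); auto. intros; apply H; auto; lra.
  - apply (ex_CInt_v g y0 y1 x1); auto. intros; apply H; auto; lra.
  - apply (ex_CInt_h g x0 x1 y1); auto. intros; apply H; auto; lra.
  - apply (ex_CInt_v g y0 y1 x0); auto. intros; apply H; auto; lra.
Qed.

Lemma RI_split_v g x0 xm x1 y0 y1 :
  edges_int g x0 xm y0 y1 -> edges_int g xm x1 y0 y1 ->
  RI g x0 x1 y0 y1 = (RI g x0 xm y0 y1 + RI g xm x1 y0 y1)%C.
Proof.
  intros [A1 [_ [A2 _]]] [B1 [_ [B2 _]]]. unfold RI.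
  rewrite <- (CInt_Chasles _ x0 xm x1 A1 B1), <- (CInt_Chasles _ x0 xm x1 A2 B2). ring.
Qed.

Lemma RI_split_h g x0 x1 y0 ym y1 :
  edges_int g x0 x1 y0 ym -> edges_int g x0 x1 ym y1 ->
  RI g x0 x1 y0 y1 = (RI g x0 x1 y0 ym + RI g x0 x1 ym y1)%C.
Proof.
  intros [_ [A1 [_ A2]]] [_ [B1 [_ B2]]]. unfold RI.
  rewrite <- (CInt_Chasles _ y0 ym y1 A1 B1), <- (CInt_Chasles _ y0 ym y1 A2 B2). ring.
Qed.

Lemma RI_lin c f g x0 x1 y0 y1 : edges_int f x0 x1 y0 y1 -> edges_int g x0 x1 y0 y1 ->
  RI (fun w => f w + c * g w)%C x0 x1 y0 y1 = (RI f x0 x1 y0 y1 + c * RI g x0 x1 y0 y1)%C.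
Proof.
  intros [A1 [A2 [A3 A4]]] [B1 [B2 [B3 B4]]]. unfold RI.
  rewrite !CInt_lin by assumption. ring.
Qed.

Lemma edges_int_lin c f g x0 x1 y0 y1 : edges_int f x0 x1 y0 y1 -> edges_int g x0 x1 y0 y1 ->
  edges_int (fun w => f w + c * g w)%C x0 x1 y0 y1.
Proof.
  intros [A1 [A2 [A3 A4]]] [B1 [B2 [B3 B4]]].
  unfold edges_int. split; [|split; [|split]]; now apply ex_CInt_lin.
Qed.

Lemma Cmod_RI_le g x0 x1 y0 y1 M : x0 <= x1 -> y0 <= y1 -> edges_int g x0 x1 y0 y1 ->
  (forall x y, x0 <= x <= x1 -> y0 <= y <= y1 ->
     x = x0 \/ x = x1 \/ y = y0 \/ y = y1 -> Cmod (g (x, y)) <= M) ->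
  Cmod (RI g x0 x1 y0 y1) <= 2 * ((x1 - x0) + (y1 - y0)) * M.
Proof.
  intros Hx Hy [A1 [A2 [A3 A4]]] H. unfold RI, Cminus.
  eapply Rle_trans; [apply Cmod_triangle|].
  eapply Rle_trans; [apply Rplus_le_compat_r, Cmod_triangle|].
  eapply Rle_trans; [apply Rplus_le_compat_r, Rplus_le_compat_r, Cmod_triangle|].
  rewrite !Cmod_opp, !Cmod_mult, Cmod_Ci, !Rmult_1_l.
  pose proof (Cmod_CInt_le _ _ _ M Hx A1 ltac:(intros; apply H; auto; lra)).
  pose proof (Cmod_CInt_le _ _ _ M Hy A2 ltac:(intros; apply H; auto; lra)).
  pose proof (Cmod_CInt_le _ _ _ M Hx A3 ltac:(intros; apply H; auto; lra)).
  pose proof (Cmod_CInt_le _ _ _ M Hy A4 ltac:(intros; apply H; auto; lra)).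
  lra.
Qed.

(** Every side has an explicit primitive. This case of Cauchy's theorem is computed directly, and it
    removes the first-order part in Goursat's argument. *)
Lemma RI_affine A B x0 x1 y0 y1 : RI (fun w => A + B * w)%C x0 x1 y0 y1 = 0.
Proof.
  assert (I1 : forall a b y, is_CInt (fun t => (t, y)) a b ((b * b - a * a) / 2, y * (b - a))).
  { intros a b y. apply is_CInt_pair; simpl.
    - replace ((b * b - a * a) / 2) with (minus (b * b / 2) (a * a / 2)) by (unfold minus, plus, opp; simpl; field).
      apply (is_RInt_derive (fun t => t * t / 2)); intros x _.
      + auto_derive; [easy|field].
      + apply continuous_id.
    - replace (y * (b - a)) with (scal (b - a) y) by (unfold scal; simpl; unfold mult; simpl; ring).
      apply (is_RInt_const (V := R_NormedModule)). }
  assert (I2 : forall a b x, is_CInt (fun t => (x, t)) a b (x * (b - a), (b * b - a * a) / 2)).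
  { intros a b x. apply is_CInt_pair; simpl.
    - replace (x * (b - a)) with (scal (b - a) x) by (unfold scal; simpl; unfold mult; simpl; ring).
      apply (is_RInt_const (V := R_NormedModule)).
    - replace ((b * b - a * a) / 2) with (minus (b * b / 2) (a * a / 2)) by (unfold minus, plus, opp; simpl; field).
      apply (is_RInt_derive (fun t => t * t / 2)); intros t _.
      + auto_derive; [easy|field].
      + apply continuous_id. }
  assert (I0 : forall a b : R, is_CInt (fun _ => A) a b (RtoC (b - a) * A)%C).
  { intros a b. replace (RtoC (b - a) * A)%C with (scal (V := C_R_NormedModule) (b - a) A).
    - apply (is_RInt_const (V := C_R_NormedModule)).
    - destruct A as [p q]. unfold scal; simpl. unfold prod_scal, scal; simpl. unfold mult, Cmult, RtoC; simpl.
      f_equal; ring. }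
  unfold RI.
  rewrite (is_CInt_unique _ _ _ _ (is_CInt_plus _ _ _ _ _ _ (I0 x0 x1) (is_CInt_scal B _ _ _ _ (I1 x0 x1 y0)))).
  rewrite (is_CInt_unique _ _ _ _ (is_CInt_plus _ _ _ _ _ _ (I0 x0 x1) (is_CInt_scal B _ _ _ _ (I1 x0 x1 y1)))).
  rewrite (is_CInt_unique _ _ _ _ (is_CInt_plus _ _ _ _ _ _ (I0 y0 y1) (is_CInt_scal B _ _ _ _ (I2 y0 y1 x1)))).
  rewrite (is_CInt_unique _ _ _ _ (is_CInt_plus _ _ _ _ _ _ (I0 y0 y1) (is_CInt_scal B _ _ _ _ (I2 y0 y1 x0)))).
  destruct A, B. unfold RtoC, Ci, Cmult, Cminus, Cplus, Copp; simpl. f_equal; field.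
Qed.

(** * Goursat's lemma by repeated quartering *)

Lemma nested_intervals (a b : nat -> R) :
  (forall n, a n <= a (S n)) -> (forall n, b (S n) <= b n) -> (forall n, a n <= b n) ->
  exists x, forall n, a n <= x <= b n.
Proof.
  intros Ha Hb Hab.
  assert (Ma : forall n k, a n <= a (n + k)%nat).
  { intros n k. induction k as [|k IH]; [rewrite Nat.add_0_r; lra|].
    rewrite Nat.add_succ_r. specialize (Ha (n + k)%nat). lra. }
  assert (Mb : forall n k, b (n + k)%nat <= b n).
  { intros n k. induction k as [|k IH]; [rewrite Nat.add_0_r; lra|].
    rewrite Nat.add_succ_r. specialize (Hb (n + k)%nat). lra. }
  assert (M : forall n m, a n <= b m).
  { intros n m. specialize (Ma n m). specialize (Mb m n). rewrite Nat.add_comm in Mb.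
    specialize (Hab (n + m)%nat). lra. }
  destruct (completeness (fun x => exists n, x = a n)) as [x [H1 H2]].
  - exists (b 0%nat). intros x [n ->]. apply M.
  - exists (a 0%nat). now exists 0%nat.
  - exists x. intros n. split.
    + apply H1. now exists n.
    + apply H2. intros y [m ->]. apply M.
Qed.

Section Goursat.
Variables (g : C -> C) (eps : R).
Hypothesis eps_pos : 0 < eps.

Record rect := mkrect { rx0 : R; rx1 : R; ry0 : R; ry1 : R }.
Definition semiper (Q : rect) := (rx1 Q - rx0 Q) + (ry1 Q - ry0 Q).
Definition RIr (Q : rect) := RI g (rx0 Q) (rx1 Q) (ry0 Q) (ry1 Q).
Definition wf (Q : rect) := rx0 Q <= rx1 Q /\ ry0 Q <= ry1 Q.
(** The squared semiperimeter is the right scale: quartering divides it by four, so if all four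
    quarters satisfied the opposite bound, the whole rectangle would too. *)
Definition bad (Q : rect) := eps * (semiper Q * semiper Q) < Cmod (RIr Q).
Definition quarter (i j : bool) (Q : rect) : rect :=
  let xm := (rx0 Q + rx1 Q) / 2 in let ym := (ry0 Q + ry1 Q) / 2 in
  mkrect (if i then xm else rx0 Q) (if i then rx1 Q else xm)
         (if j then ym else ry0 Q) (if j then ry1 Q else ym).
Definition bad_dec (Q : rect) : {bad Q} + {~ bad Q} :=
  Rlt_dec (eps * (semiper Q * semiper Q)) (Cmod (RIr Q)).
(** The last quarter is a fallback, returned without a test; [bad_quarter_bad] shows that it is bad
    whenever [Q] is and the other three are not. *)
Definition bad_quarter (Q : rect) : rect :=
  if bad_dec (quarter false false Q) then quarter false false Q else
  if bad_dec (quarter false true Q) then quarter false true Q else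
  if bad_dec (quarter true false Q) then quarter true false Q else quarter true true Q.
Fixpoint bad_seq (Q : rect) (n : nat) : rect :=
  match n with O => Q | S k => bad_quarter (bad_seq Q k) end.

Lemma bad_quarter_is_quarter Q : exists i j, bad_quarter Q = quarter i j Q.
Proof. unfold bad_quarter. repeat destruct bad_dec; eauto. Qed.

Lemma semiper_quarter i j Q : semiper (quarter i j Q) = semiper Q / 2.
Proof. unfold semiper, quarter; destruct i, j; simpl; field. Qed.

Definition hol_in (Q : rect) : Prop :=
  forall x y, rx0 Q <= x <= rx1 Q -> ry0 Q <= y <= ry1 Q -> hol g (x, y).

Lemma quarter_incl i j Q : wf Q ->
  wf (quarter i j Q) /\ rx0 Q <= rx0 (quarter i j Q) /\ rx1 (quarter i j Q) <= rx1 Q /\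
  ry0 Q <= ry0 (quarter i j Q) /\ ry1 (quarter i j Q) <= ry1 Q.
Proof. intros [Hx Hy]. unfold wf, quarter; destruct i, j; simpl; repeat split; lra. Qed.

Lemma edges_int_hol_in Q : wf Q -> hol_in Q -> edges_int g (rx0 Q) (rx1 Q) (ry0 Q) (ry1 Q).
Proof.
  intros [Hx Hy] H. apply edges_int_ccont; auto. intros; now apply hol_ccont, H.
Qed.

Lemma bad_quarter_bad Q : wf Q -> hol_in Q -> bad Q -> bad (bad_quarter Q).
Proof.
  intros HQ H HB. unfold bad_quarter. repeat (destruct bad_dec as [?|?]; [assumption|]).
  destruct (bad_dec (quarter true true Q)) as [?|n4]; [assumption|]. exfalso.
  unfold bad in *. rewrite semiper_quarter in *. apply Rnot_lt_le in n, n0, n1, n4.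
  assert (E : RIr Q = (RIr (quarter false false Q) + RIr (quarter false true Q)
                     + (RIr (quarter true false Q) + RIr (quarter true true Q)))%C).
  { destruct HQ as [Hx Hy]. unfold RIr, quarter; simpl.
    assert (EI : forall x0 x1 y0 y1, rx0 Q <= x0 -> x0 <= x1 -> x1 <= rx1 Q ->
       ry0 Q <= y0 -> y0 <= y1 -> y1 <= ry1 Q -> edges_int g x0 x1 y0 y1).
    { intros. apply edges_int_ccont; auto. intros. apply hol_ccont, H; lra. }
    rewrite (RI_split_v g _ ((rx0 Q + rx1 Q) / 2)) by (apply EI; lra).
    rewrite (RI_split_h g (rx0 Q) _ _ ((ry0 Q + ry1 Q) / 2)) by (apply EI; lra).
    rewrite (RI_split_h g _ (rx1 Q) _ ((ry0 Q + ry1 Q) / 2)) by (apply EI; lra).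
    reflexivity. }
  rewrite E in HB.
  pose proof (Cmod_triangle (RIr (quarter false false Q) + RIr (quarter false true Q))
       (RIr (quarter true false Q) + RIr (quarter true true Q))).
  pose proof (Cmod_triangle (RIr (quarter false false Q)) (RIr (quarter false true Q))).
  pose proof (Cmod_triangle (RIr (quarter true false Q)) (RIr (quarter true true Q))).
  nra.
Qed.

(** Otherwise quartering yields nested bad rectangles shrinking to a point. Near that point g is its
    affine part, whose integral vanishes, plus an error too small for a bad rectangle. *)
Lemma goursat_eps Q : wf Q -> hol_in Q -> Cmod (RIr Q) <= eps * (semiper Q * semiper Q).
Proof.
  intros HQ HH. destruct (bad_dec Q) as [HB|n]; [exfalso|now apply Rnot_lt_le].
  assert (Inv : forall n, wf (bad_seq Q n) /\ hol_in (bad_seq Q n) /\ bad (bad_seq Q n)).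
  { induction n as [|n [I1 [I2 I3]]]; [easy|]. simpl.
    split; [|split; [|now apply bad_quarter_bad]];
      destruct (bad_quarter_is_quarter (bad_seq Q n)) as [i [j ->]];
      destruct (quarter_incl i j _ I1) as [W K]; [easy|].
    intros x y Hx Hy. apply I2; lra. }
  assert (Mono : forall n, rx0 (bad_seq Q n) <= rx0 (bad_seq Q (S n)) /\
     rx1 (bad_seq Q (S n)) <= rx1 (bad_seq Q n) /\ ry0 (bad_seq Q n) <= ry0 (bad_seq Q (S n)) /\
     ry1 (bad_seq Q (S n)) <= ry1 (bad_seq Q n)).
  { intros n. simpl. destruct (bad_quarter_is_quarter (bad_seq Q n)) as [i [j ->]].
    apply quarter_incl, Inv. }
  assert (Sz : forall n, semiper (bad_seq Q n) = semiper Q * (/ 2) ^ n).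
  { induction n as [|n IH]; simpl; [ring|].
    destruct (bad_quarter_is_quarter (bad_seq Q n)) as [i [j ->]].
    rewrite semiper_quarter, IH. field. }
  destruct (nested_intervals (fun n => rx0 (bad_seq Q n)) (fun n => rx1 (bad_seq Q n))) as [x Hx];
    [intros n; apply (Mono n)..|intros n; apply (Inv n)|].
  destruct (nested_intervals (fun n => ry0 (bad_seq Q n)) (fun n => ry1 (bad_seq Q n))) as [y Hy];
    [intros n; apply (Mono n)..|intros n; apply (Inv n)|].
  destruct (HH x y (Hx 0%nat) (Hy 0%nat)) as [l Hl].
  (* The perimeter is twice the semiperimeter, so eps / 4 here gives half of what a bad rectangle
     must exceed. *)
  destruct (cderiv_affine g (x, y) l Hl (eps / 4) ltac:(lra)) as [d [Hd Ha]].
  assert (HSP : 0 <= semiper Q) by (destruct HQ; unfold semiper; lra).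
  (* The 1 added to the semiperimeter keeps the quotient meaningful for a degenerate rectangle. *)
  destruct (pow_lt_1_zero (/ 2) ltac:(rewrite Rabs_pos_eq; lra) (d / (semiper Q + 1))
      ltac:(apply Rdiv_lt_0_compat; lra)) as [n Hn].
  specialize (Hn n (Nat.le_refl n)). specialize (Sz n).
  destruct (Inv n) as [W [HI Bn]]. specialize (Hx n). specialize (Hy n). simpl in Hx, Hy.
  set (P := bad_seq Q n) in *.
  assert (Hs : semiper P < d).
  { rewrite Sz. rewrite Rabs_pos_eq in Hn by (apply pow_le; lra).
    apply Rle_lt_trans with ((semiper Q + 1) * (/ 2) ^ n).
    - apply Rmult_le_compat_r; [apply pow_le|]; lra.
    - replace d with ((semiper Q + 1) * (d / (semiper Q + 1))) by (field; lra).
      apply Rmult_lt_compat_l; lra. }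
  assert (HsP : 0 <= semiper P) by (destruct W; unfold semiper; lra).
  apply (Rlt_irrefl (eps * (semiper P * semiper P))).
  eapply Rlt_le_trans; [exact Bn|].
  set (A := (g (x, y) - l * (x, y))%C).
  assert (EA : edges_int (fun w => A + l * w)%C (rx0 P) (rx1 P) (ry0 P) (ry1 P)).
  { destruct W. apply edges_int_ccont; auto. intros.
    apply ccont_plus; [apply ccont_const|]. apply ccont_mult; [apply ccont_const|apply ccont_id]. }
  pose proof (edges_int_hol_in P W HI) as EG.
  replace (RIr P) with (RI (fun w => g w + (- 1) * (A + l * w))%C (rx0 P) (rx1 P) (ry0 P) (ry1 P)).
  2:{ rewrite (RI_lin (- 1)%C g (fun w => A + l * w)%C) by assumption. rewrite RI_affine. unfold RIr. ring. }
  eapply Rle_trans.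
  - apply Cmod_RI_le with (M := eps / 4 * semiper P); [apply W|apply W|now apply edges_int_lin|].
    intros x' y' Hx' Hy' _.
    replace (g (x', y') + -1 * (A + l * (x', y')))%C
      with (g (x', y') - g (x, y) - l * ((x', y') - (x, y)))%C by (unfold A; ring).
    assert (D : Cmod ((x', y') - (x, y)) <= semiper P).
    { eapply Rle_trans; [apply Cmod_le_abs|]. simpl. unfold semiper.
      apply Rplus_le_compat; apply Rabs_le; lra. }
    eapply Rle_trans; [apply Ha; lra|]. apply Rmult_le_compat_l; lra.
  - fold (semiper P). nra.
Qed.
End Goursat.

(** The bound of [goursat_eps] is available for every positive eps; taking eps proportional to the
    modulus of the integral bounds that modulus by half of itself. *)
Lemma goursat g x0 x1 y0 y1 : x0 <= x1 -> y0 <= y1 ->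
  (forall x y, x0 <= x <= x1 -> y0 <= y <= y1 -> hol g (x, y)) -> RI g x0 x1 y0 y1 = 0.
Proof.
  intros Hx Hy H. apply Cmod_eq_0.
  pose (Q := mkrect x0 x1 y0 y1). pose (S := semiper Q * semiper Q + 1).
  assert (HS : 0 < S) by (unfold S; nra).
  apply Rle_antisym; [|apply Cmod_ge_0]. apply Rnot_lt_le. intros Hp.
  pose proof (goursat_eps g (Cmod (RI g x0 x1 y0 y1) / (2 * S)) ltac:(apply Rdiv_lt_0_compat; lra)
    Q ltac:(split; simpl; lra) H) as B.
  unfold RIr in B; simpl in B. set (m := Cmod (RI g x0 x1 y0 y1)) in *.
  assert (m / (2 * S) * (semiper Q * semiper Q) <= m / (2 * S) * S).
  { apply Rmult_le_compat_l; [apply Rlt_le, Rdiv_lt_0_compat; lra|unfold S; lra]. }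
  replace (m / (2 * S) * S) with (m / 2) in H0 by (field; lra). lra.
Qed.

(** * The residue formula for one simple pole in a rectangle *)

Lemma sqsum_pos (a e : R) : 0 < e -> 0 < a * a + e * e.
Proof. intros. nra. Qed.

Lemma is_RInt_odd_quotient c e : 0 < e ->
  is_RInt (fun t => (t - c) / ((t - c) * (t - c) + e * e)) (c - e) (c + e) 0.
Proof.
  intros He.
  replace 0 with (minus (ln ((c + e - c) * (c + e - c) + e * e) / 2) (ln ((c - e - c) * (c - e - c) + e * e) / 2)).
  2:{ unfold minus, plus, opp; simpl.
      replace ((c + e - c) * (c + e - c)) with (e * e) by ring.
      replace ((c - e - c) * (c - e - c)) with (e * e) by ring. ring. }
  apply (is_RInt_derive (fun t => ln ((t - c) * (t - c) + e * e) / 2)); intros x _.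
  - auto_derive; [now apply sqsum_pos|]. field. now apply Rgt_not_eq, sqsum_pos.
  - apply (ex_derive_continuous (V := R_NormedModule)). auto_derive. now apply Rgt_not_eq, sqsum_pos.
Qed.

Lemma is_RInt_cauchy_quotient c e : 0 < e ->
  is_RInt (fun t => e / ((t - c) * (t - c) + e * e)) (c - e) (c + e) (PI / 2).
Proof.
  intros He.
  replace (PI / 2) with (minus (atan ((c + e - c) / e)) (atan ((c - e - c) / e))).
  2:{ unfold minus, plus, opp; simpl.
      replace ((c + e - c) / e) with 1 by (field; lra).
      replace ((c - e - c) / e) with (- (1)) by (field; lra).
      rewrite atan_opp, atan_1. field. }
  apply (is_RInt_derive (fun t => atan ((t - c) / e))); intros x _.
  - auto_derive; [easy|]. field.
    assert (0 < (x - c) * (x - c) + e * e) by now apply sqsum_pos.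
    repeat split; apply Rgt_not_eq; nra.
  - apply (ex_derive_continuous (V := R_NormedModule)). auto_derive. now apply Rgt_not_eq, sqsum_pos.
Qed.

(** On a square centred at the pole, the logarithmic part of each side vanishes by symmetry and the
    arctangent part is a quarter turn, so the four sides add up to 2 pi i. *)
Lemma RI_inv_square p e : 0 < e ->
  RI (fun w => / (w - p))%C (Re p - e) (Re p + e) (Im p - e) (Im p + e) = (2 * PI * Ci)%C.
Proof.
  intros He. destruct p as [a b]. simpl.
  pose proof (is_RInt_odd_quotient a e He) as Oa. pose proof (is_RInt_odd_quotient b e He) as Ob.
  pose proof (is_RInt_cauchy_quotient a e He) as Qa. pose proof (is_RInt_cauchy_quotient b e He) as Qb.
  pose proof (is_RInt_opp _ _ _ _ Ob) as Ob'. pose proof (is_RInt_opp _ _ _ _ Qa) as Qa'.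
  pose proof (is_RInt_opp _ _ _ _ Qb) as Qb'.
  unfold RI.
  rewrite (is_CInt_unique (fun t => / ((t, (b - e)%R) - (a, b)))%C (a - e) (a + e) (0, PI / 2)).
  2:{ apply is_CInt_pair; [eapply is_RInt_ext; [|exact Oa]|eapply is_RInt_ext; [|exact Qa]];
      intros t _; simpl; field;
      pose proof (sqsum_pos (t - a) e He); pose proof (sqsum_pos (t - b) e He);
      repeat split; apply Rgt_not_eq; lra. }
  rewrite (is_CInt_unique (fun t => / ((t, (b + e)%R) - (a, b)))%C (a - e) (a + e) (0, - (PI / 2))).
  2:{ apply is_CInt_pair; [eapply is_RInt_ext; [|exact Oa]|eapply is_RInt_ext; [|exact Qa']];
      intros t _; unfold opp; simpl; field;
      pose proof (sqsum_pos (t - a) e He); pose proof (sqsum_pos (t - b) e He);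
      repeat split; apply Rgt_not_eq; lra. }
  rewrite (is_CInt_unique (fun t => / (((a + e)%R, t) - (a, b)))%C (b - e) (b + e) (PI / 2, - 0)).
  2:{ apply is_CInt_pair; [eapply is_RInt_ext; [|exact Qb]|eapply is_RInt_ext; [|exact Ob']];
      intros t _; unfold opp; simpl; field;
      pose proof (sqsum_pos (t - a) e He); pose proof (sqsum_pos (t - b) e He);
      repeat split; apply Rgt_not_eq; lra. }
  rewrite (is_CInt_unique (fun t => / (((a - e)%R, t) - (a, b)))%C (b - e) (b + e) (- (PI / 2), - 0)).
  2:{ apply is_CInt_pair; [eapply is_RInt_ext; [|exact Qb']|eapply is_RInt_ext; [|exact Ob']];
      intros t _; unfold opp; simpl; field;
      pose proof (sqsum_pos (t - a) e He); pose proof (sqsum_pos (t - b) e He);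
      repeat split; apply Rgt_not_eq; lra. }
  unfold RtoC, Ci, Cmult, Cminus, Cplus, Copp; simpl. f_equal; field.
Qed.

(** The number [c] is the residue. The value c = 0, a removable singularity, is allowed. *)
Definition simple_pole (g : C -> C) (p c : C) : Prop :=
  forall eps, 0 < eps -> exists d, 0 < d /\
    forall w, 0 < Cmod (w - p) < d -> Cmod ((w - p) * g w - c) <= eps.

(** Goursat on the four rectangles around a small square centred at p shrinks the contour to that
    square; there g differs from c / (w - p) by at most a small multiple of 1 / |w - p|, while the
    perimeter is proportional to the side. *)
Lemma residue_rect g x0 x1 y0 y1 p c :
  x0 < Re p < x1 -> y0 < Im p < y1 ->
  (forall x y, x0 <= x <= x1 -> y0 <= y <= y1 -> (x, y) <> p -> hol g (x, y)) ->
  simple_pole g p c ->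
  RI g x0 x1 y0 y1 = (2 * PI * Ci * c)%C.
Proof.
  destruct p as [a b]. intros Hx Hy Hg Hp. simpl in Hx, Hy.
  assert (EI : forall l r u v, x0 <= l -> l <= r -> r <= x1 -> y0 <= u -> u <= v -> v <= y1 ->
      (l <> a) -> (r <> a) -> u <> b -> v <> b -> edges_int g l r u v).
  { intros. apply edges_int_ccont; auto. intros x y ? ? Hb. apply hol_ccont, Hg; try lra.
    intros E. injection E as -> ->. destruct Hb as [E|[E|[E|E]]]; congruence. }
  assert (Shrink : forall e, 0 < e -> e < a - x0 -> e < x1 - a -> e < b - y0 -> e < y1 - b ->
     RI g x0 x1 y0 y1 = RI g (a - e) (a + e) (b - e) (b + e)).
  { intros e He E1 E2 E3 E4.
    rewrite (RI_split_v g x0 (a - e) x1), (RI_split_v g (a - e) (a + e) x1) by (apply EI; lra).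
    rewrite (goursat g x0 (a - e)), (goursat g (a + e) x1); try lra;
      try (intros; apply Hg; try lra; intros E; injection E as -> ->; lra).
    assert (EH : forall u v, y0 <= u -> u <= v -> v <= y1 -> u <> b -> v <> b ->
       edges_int g (a - e) (a + e) u v) by (intros; apply EI; lra).
    rewrite (RI_split_h g (a - e) (a + e) y0 (b - e) y1), (RI_split_h g (a - e) (a + e) (b - e) (b + e) y1)
      by (apply EH; lra).
    rewrite (goursat g (a - e) (a + e) y0), (goursat g (a - e) (a + e) (b + e)); try lra;
      try (intros; apply Hg; try lra; intros E; injection E as -> ->; lra).
    ring. }
  apply Cminus_eq_0, Cmod_eq_0.
  apply Rle_antisym; [|apply Cmod_ge_0]. apply Rnot_lt_le. intros HM.
  set (M := Cmod _) in HM.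
  (* The square has perimeter 8 e and its boundary keeps distance at least e from p, so the
     discrepancy M would be at most 8 e (M / 16) / e = M / 2. *)
  destruct (Hp (M / 16) ltac:(lra)) as [d [Hd HD]].
  set (e := Rmin (d / 3) (Rmin (Rmin (a - x0) (x1 - a) / 2) (Rmin (b - y0) (y1 - b) / 2))).
  assert (He : 0 < e /\ e <= d / 3 /\ e < a - x0 /\ e < x1 - a /\ e < b - y0 /\ e < y1 - b).
  { unfold e, Rmin. repeat destruct Rle_dec; lra. }
  destruct He as [He [E0 [E1 [E2 [E3 E4]]]]].
  pose proof (RI_inv_square (a, b) e He) as HI. simpl in HI.
  assert (W : forall x y, a - e <= x <= a + e -> b - e <= y <= b + e ->
      x = a - e \/ x = a + e \/ y = b - e \/ y = b + e -> e <= Cmod ((x, y) - (a, b)) <= 2 * e).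
  { intros x y Wx Wy Wb. split.
    - destruct Wb as [E|[E|[E|E]]]; rewrite E.
      + eapply Rle_trans; [|apply re_le_Cmod]. simpl. rewrite Rabs_left; lra.
      + eapply Rle_trans; [|apply re_le_Cmod]. simpl. rewrite Rabs_right; lra.
      + eapply Rle_trans; [|apply Im_le_Cmod]. simpl. rewrite Rabs_left; lra.
      + eapply Rle_trans; [|apply Im_le_Cmod]. simpl. rewrite Rabs_right; lra.
    - eapply Rle_trans; [apply Cmod_le_abs|]. simpl.
      assert (Rabs (x + - a) <= e) by (apply Rabs_le; lra).
      assert (Rabs (y + - b) <= e) by (apply Rabs_le; lra). lra. }
  assert (EP : edges_int (fun w => / (w - (a, b)))%C (a - e) (a + e) (b - e) (b + e)).
  { apply edges_int_ccont; try lra. intros x y Wx Wy Wb. apply ccont_inv.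
    - apply ccont_minus; [apply ccont_id|apply ccont_const].
    - apply Cmod_pos_neq0. specialize (W x y Wx Wy Wb). lra. }
  assert (EG : edges_int g (a - e) (a + e) (b - e) (b + e)) by (apply EI; lra).
  assert (HB : M <= 2 * (((a + e) - (a - e)) + ((b + e) - (b - e))) * (M / 16 / e)).
  { assert (EM : M = Cmod (RI g (a - e) (a + e) (b - e) (b + e) - 2 * PI * Ci * c)).
    { unfold M. now rewrite (Shrink e) by assumption. }
    rewrite EM at 1.
    replace (RI g (a - e) (a + e) (b - e) (b + e) - 2 * PI * Ci * c)%C
      with (RI (fun w => g w + (- c) * / (w - (a, b)))%C (a - e) (a + e) (b - e) (b + e)).
    2:{ rewrite RI_lin, HI by assumption. ring. }
    apply Cmod_RI_le; try lra; [now apply edges_int_lin|].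
    intros x y Wx Wy Wb. specialize (W x y Wx Wy Wb).
    set (k := ((x, y) - (a, b))%C) in *.
    assert (Hk : k <> 0) by (apply Cmod_pos_neq0; lra).
    replace (g (x, y) + - c * / k)%C with ((k * g (x, y) - c) / k)%C by (field; auto).
    rewrite Cmod_div by auto.
    assert (HH : Cmod (k * g (x, y) - c) <= M / 16) by (apply HD; fold k; lra).
    unfold Rdiv at 1 2. apply Rmult_le_compat; [apply Cmod_ge_0| |exact HH|].
    - apply Rlt_le, Rinv_0_lt_compat; lra.
    - apply Rinv_le_contravar; lra. }
  replace (2 * (((a + e) - (a - e)) + ((b + e) - (b - e))) * (M / 16 / e)) with (M / 2) in HB by (field; lra).
  lra.
Qed.

(** * The trapezoidal rule as a contour integral *)

(* [CInt] has the coerced carrier type, which [ring] does not recognize as [C]. *)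
Ltac as_C := match goal with |- @eq _ ?a ?b => change (@eq C a b) end.

(** Caratheodory's form gives D w = phi w (w - p) near p; the factor w - p cancels and continuity of
    N / phi does the rest. *)
Lemma simple_pole_quotient N D p l :
  ccont N p -> cderiv D p l -> D p = 0 -> l <> 0 ->
  simple_pole (fun w => N w / D w)%C p (N p / l)%C.
Proof.
  intros HN [phi [d [Hd [Hc [Hl HD]]]]] H0 Hn eps He.
  assert (Hphi : phi p <> 0) by now rewrite Hl.
  destruct (ccont_neq0 phi p Hc Hphi) as [d1 [Hd1 H1]].
  destruct (ccont_div N phi p HN Hc Hphi eps He) as [d2 [Hd2 H2]].
  exists (Rmin d (Rmin d1 d2)). split; [apply Rmin_pos; [easy|now apply Rmin_pos]|].
  intros w [Hw0 Hw].
  pose proof (Rmin_l d (Rmin d1 d2)). pose proof (Rmin_r d (Rmin d1 d2)).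
  pose proof (Rmin_l d1 d2). pose proof (Rmin_r d1 d2).
  specialize (HD w ltac:(lra)). specialize (H1 w ltac:(lra)). specialize (H2 w ltac:(lra)).
  assert (Hw1 : (w - p)%C <> 0) by now apply Cmod_pos_neq0.
  assert (Hw2 : phi w <> 0) by (apply Cmod_pos_neq0; pose proof (Cmod_pos _ Hphi); lra).
  replace (D w) with (phi w * (w - p))%C by (rewrite <- HD, H0; ring).
  replace ((w - p) * (N w / (phi w * (w - p))) - N p / l)%C with (N w / phi w - N p / phi p)%C
    by (rewrite Hl; field; auto).
  lra.
Qed.

Lemma simple_pole_ext f g p c : (forall w, f w = g w) -> simple_pole f p c -> simple_pole g p c.
Proof. intros E H eps He. destruct (H eps He) as [d Hd]. exists d. now setoid_rewrite <- E. Qed.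

Lemma hol_Ccos u : hol Ccos u.
Proof.
  unfold Ccos. apply hol_div; [|apply hol_const|].
  - apply hol_plus; apply hol_Cexp; [|apply hol_opp]; (apply hol_mult; [apply hol_const|apply hol_id]).
  - intros E. injection E. lra.
Qed.

Lemma Ci_neq_0 : Ci <> 0.
Proof. intros E. injection E. lra. Qed.

Lemma RtoC_neq_0 x : x <> 0 -> RtoC x <> 0.
Proof. intros H E. apply H. now injection E. Qed.

Lemma Ci_sqr : (Ci * Ci = -1)%C.
Proof. unfold Ci, Cmult, RtoC; simpl; f_equal; ring. Qed.

Lemma cderiv_Csin u : cderiv Csin u (Ccos u).
Proof.
  assert (D1 : cderiv (fun w => Defs.Ci * w)%C u (0 * u + Defs.Ci * 1)%C)
    by (apply cderiv_mult; [apply cderiv_const|apply cderiv_id]).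
  assert (D2 : cderiv (fun w => - 1 * (Defs.Ci * w))%C u (0 * (Defs.Ci * u) + - 1 * (0 * u + Defs.Ci * 1))%C)
    by (apply (cderiv_mult (fun _ => - 1)%C); [apply cderiv_const|exact D1]).
  pose proof (cderiv_comp Cexp _ u _ _ D1 (cderiv_Cexp _)) as E1.
  pose proof (cderiv_comp Cexp _ u _ _ D2 (cderiv_Cexp _)) as E2. cbv beta in E1, E2.
  pose proof (cderiv_mult _ _ u _ _ (cderiv_const (- 1)%C u) E2) as E3.
  pose proof (cderiv_plus _ _ u _ _ E1 E3) as E4.
  pose proof (cderiv_mult _ _ u _ _ E4 (cderiv_const (/ (2 * Defs.Ci))%C u)) as E5.
  cbv beta in E5.
  assert (Hi : Defs.Ci <> 0) by apply Ci_neq_0.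
  assert (H2 : RtoC 2 <> 0) by (apply RtoC_neq_0; lra).
  match type of E5 with cderiv _ _ ?l => replace l with (Ccos u) in E5 end.
  - apply (cderiv_ext_loc _ _ u _ 1 ltac:(lra)) with (2 := E5).
    intros w _. unfold Csin. replace (- (Defs.Ci * w))%C with (- 1 * (Defs.Ci * w))%C by ring.
    unfold Cdiv. ring.
  - unfold Ccos. replace (- (Defs.Ci * u))%C with (- 1 * (Defs.Ci * u))%C by ring.
    set (A := Cexp (Defs.Ci * u)%C). set (B := Cexp (- 1 * (Defs.Ci * u))%C). field. auto.
Qed.

(** A zero means e^(i w) = e^(-i w); comparing moduli gives Im w = 0, and then comparing imaginary
    parts gives the real sine. *)
Lemma Csin_0_imp w : Csin w = 0 -> Im w = 0 /\ sin (Re w) = 0.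
Proof.
  intros H.
  assert (Hi : Defs.Ci <> 0) by apply Ci_neq_0.
  assert (H2 : RtoC 2 <> 0) by (apply RtoC_neq_0; lra).
  assert (E : Cexp (Defs.Ci * w) = Cexp (- (Defs.Ci * w))).
  { apply Cminus_eq_0.
    replace (Cexp (Defs.Ci * w) - Cexp (- (Defs.Ci * w)))%C with (Csin w * (2 * Defs.Ci))%C
      by (unfold Csin; field; auto).
    rewrite H. ring. }
  destruct w as [x y].
  assert (Ey : y = 0).
  { apply (f_equal Cmod) in E. rewrite !Cmod_Cexp in E. apply exp_inv in E. simpl in E. lra. }
  subst y. split; [easy|]. apply (f_equal Im) in E. unfold Cexp in E. simpl in E.
  replace (- (0 * x - 1 * 0)) with 0 in E by ring. replace (0 * x - 1 * 0) with 0 in E by ring.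
  replace (- (0 * 0 + 1 * x)) with (- x) in E by ring. replace (0 * 0 + 1 * x) with x in E by ring.
  rewrite exp_0, sin_neg in E. simpl. lra.
Qed.

Lemma Csin_RtoC x : Csin (RtoC x) = RtoC (sin x).
Proof.
  unfold Csin, Cexp. unfold RtoC, Defs.Ci, Cdiv, Cmult, Cplus, Cminus, Copp, Cinv; simpl.
  replace (0 * x - 1 * 0) with 0 by ring. replace (0 * 0 + 1 * x) with x by ring.
  rewrite Ropp_0, exp_0, sin_neg, cos_neg. f_equal; field.
Qed.

Lemma Ccos_neq_0 w : Csin w = 0 -> Ccos w <> 0.
Proof.
  intros H E. apply (Cexp_neq_0 (Defs.Ci * w)).
  assert (Hi : Defs.Ci <> 0) by apply Ci_neq_0.
  assert (H2 : RtoC 2 <> 0) by (apply RtoC_neq_0; lra).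
  replace (Cexp (Defs.Ci * w)) with (Ccos w + Defs.Ci * Csin w)%C.
  - rewrite E, H. ring.
  - unfold Ccos, Csin. field. auto.
Qed.

Section Trapezoid.
Variables (h : R).
Hypothesis h_pos : 0 < h.

Definition warg (u : C) : C := (RtoC PI * u / RtoC h)%C.

Lemma RtoC_h_neq_0 : RtoC h <> 0.
Proof. apply RtoC_neq_0; lra. Qed.

Lemma warg_pair x y : warg (x, y) = (PI * x / h, PI * y / h).
Proof.
  unfold warg, RtoC, Cdiv, Cmult, Cinv; simpl. f_equal; field; lra.
Qed.

Lemma cderiv_warg u : cderiv warg u (RtoC PI / RtoC h)%C.
Proof.
  pose proof (cderiv_mult _ _ u _ _ (cderiv_const (RtoC PI / RtoC h)%C u) (cderiv_id u)) as H.
  cbv beta in H.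
  replace (0 * u + RtoC PI / RtoC h * 1)%C with (RtoC PI / RtoC h)%C in H by ring.
  apply (cderiv_ext_loc _ _ u _ 1 ltac:(lra)) with (2 := H).
  intros w _. unfold warg, Cdiv. ring.
Qed.

Lemma hol_mm u : Csin (warg u) <> 0 -> hol (mm h) u.
Proof.
  intros H. unfold mm. apply hol_mult; [apply hol_const|]. unfold Ccot. apply hol_div; auto.
  - apply (hol_comp Ccos warg); [eexists; apply cderiv_warg|apply hol_Ccos].
  - apply (hol_comp Csin warg); [eexists; apply cderiv_warg|eexists; apply cderiv_Csin].
Qed.

Lemma Csin_warg_0_imp x y : Csin (warg (x, y)) = 0 -> y = 0 /\ exists k : Z, x = IZR k * h.
Proof.
  intros H. rewrite warg_pair in H. apply Csin_0_imp in H. simpl in H. destruct H as [Hy Hx].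
  pose proof PI_RGT_0 as HP. split.
  - apply Rmult_eq_reg_l with (PI / h); [|apply Rgt_not_eq, Rdiv_lt_0_compat; lra].
    unfold Rdiv in *. lra.
  - apply sin_eq_0_0 in Hx. destruct Hx as [k Hk]. exists k.
    replace x with (PI * x / h * (h / PI)) by (field; lra). rewrite Hk. field. lra.
Qed.

Lemma Csin_warg_neq_0_x x y (n : Z) : IZR n * h < x < (IZR n + 1) * h -> Csin (warg (x, y)) <> 0.
Proof.
  intros Hx E. apply Csin_warg_0_imp in E. destruct E as [_ [k ->]].
  assert (IZR n < IZR k < IZR (n + 1)).
  { rewrite plus_IZR. split; apply Rmult_lt_reg_r with h; lra. }
  destruct H as [H1 H2]. apply lt_IZR in H1, H2. lia.
Qed.

Lemma Csin_warg_neq_0_y x y : y <> 0 -> Csin (warg (x, y)) <> 0.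
Proof. intros Hy E. apply Csin_warg_0_imp in E. tauto. Qed.

(** The cotangent of pi u / h has residue h / pi at each multiple of h. Multiplied by -i / 2 and
    then by 2 pi i, it becomes the weight h of the trapezoidal rule. *)
Lemma simple_pole_mm f (j : nat) : ccont f (RtoC (INR j * h)) ->
  simple_pole (fun u => f u * mm h u)%C (RtoC (INR j * h))
    (- (Ci / 2) * (RtoC h / RtoC PI) * f (RtoC (INR j * h)))%C.
Proof.
  intros Hf. set (p := RtoC (INR j * h)) in *.
  assert (HP : RtoC PI <> 0) by (apply RtoC_neq_0, Rgt_not_eq, PI_RGT_0).
  pose proof RtoC_h_neq_0 as Hh.
  assert (S0 : Csin (warg p) = 0).
  { unfold p. unfold RtoC at 1. rewrite warg_pair.
    replace (PI * INR j * h / h) with (INR j * PI) by (field; lra).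
    replace (PI * (INR j * h) / h) with (INR j * PI) by (field; lra).
    replace (PI * 0 / h) with 0 by (field; lra).
    change (Csin (RtoC (INR j * PI)) = 0). rewrite Csin_RtoC. f_equal.
    apply sin_eq_0_1. exists (Z.of_nat j). now rewrite INR_IZR_INZ. }
  pose proof (Ccos_neq_0 _ S0) as C0.
  pose proof (simple_pole_quotient (fun u => f u * (- (Defs.Ci / 2)) * Ccos (warg u))%C (fun u => Csin (warg u))
     p (Ccos (warg p) * (RtoC PI / RtoC h))%C) as Q.
  replace (- (Ci / 2) * (RtoC h / RtoC PI) * f p)%C
    with (f p * - (Defs.Ci / 2) * Ccos (warg p) / (Ccos (warg p) * (RtoC PI / RtoC h)))%C.
  2:{ change Defs.Ci with Ci. field. auto. }
  eapply simple_pole_ext; [|apply Q]; auto.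
  - intros w. unfold mm, Ccot, warg, Cdiv. ring.
  - apply ccont_mult; [apply ccont_mult; [exact Hf|apply ccont_const]|].
    apply hol_ccont. apply (hol_comp Ccos warg); [eexists; apply cderiv_warg|apply hol_Ccos].
  - apply (cderiv_comp Csin warg); [apply cderiv_warg|apply cderiv_Csin].
  - intros E. apply C_integral in E. destruct E as [E|E]; [tauto|].
    revert E. now apply Cdiv_neq_0.
Qed.

(** Induction on the number of enclosed nodes j h, so that each step meets a single pole and the
    one-pole residue formula suffices. *)
Lemma RI_mm f x0 eta : 0 < x0 < h / 2 -> 0 < eta ->
  forall n e, INR n * h < e < (INR n + 1) * h -> x0 <= e ->
  (forall x y, x0 <= x <= e -> - eta <= y <= eta -> hol f (x, y)) ->
  RI (fun u => f u * mm h u)%C x0 e (- eta) eta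
  = (RtoC h * csum (fun k => f (RtoC (INR (S k) * h))) n)%C.
Proof.
  intros Hx0 Heta.
  assert (HPI : RtoC PI <> 0) by (apply RtoC_neq_0, Rgt_not_eq, PI_RGT_0).
  induction n as [|n IH]; intros e He Hxe Hf.
  - simpl INR in He. rewrite goursat; [simpl; ring|lra|lra|]. intros x y Hx Hy.
    apply hol_mult; [now apply Hf|]. apply hol_mm, (Csin_warg_neq_0_x x y 0). lra.
  - rewrite S_INR in He. pose proof (pos_INR n) as Hn.
    (* The cut is placed midway between two nodes; x0 < h / 2 keeps it to the right of x0 also for n
       = 0. *)
    set (e' := INR n * h + h / 2).
    assert (He' : x0 <= e' <= e) by (unfold e'; nra).
    assert (HG : forall x y, e' <= x <= e -> - eta <= y <= eta ->
       (x, y) <> RtoC (INR (S n) * h) -> hol (fun u => f u * mm h u)%C (x, y)).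
    { intros x y Hx Hy Hne. apply hol_mult; [apply Hf; lra|]. apply hol_mm. intros E.
      apply Csin_warg_0_imp in E. destruct E as [-> [k ->]]. apply Hne. unfold RtoC. f_equal.
      assert (H : IZR (Z.of_nat n) < IZR k < IZR (Z.of_nat n + 2)).
      { rewrite plus_IZR, <- INR_IZR_INZ. unfold e' in Hx.
        split; apply Rmult_lt_reg_r with h; lra. }
      destruct H as [H1 H2]. apply lt_IZR in H1, H2.
      replace k with (Z.of_nat (S n)) by lia. now rewrite <- INR_IZR_INZ. }
    assert (IN : INR n * h < e' < (INR n + 1) * h) by (unfold e'; lra).
    assert (PN : e' < INR (S n) * h < e) by (rewrite S_INR; unfold e'; lra).
    rewrite (RI_split_v _ x0 e' e).
    + rewrite IH; auto; [|lra|intros; apply Hf; lra].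
      rewrite (residue_rect _ e' e (- eta) eta (RtoC (INR (S n) * h)) _) with (4 := simple_pole_mm f (S n)
          ltac:(apply hol_ccont, Hf; lra)); try (unfold RtoC, Re, Im, fst, snd; lra); auto.
      cbn [csum].
      transitivity (RtoC h * csum (fun k => f (RtoC (INR (S k) * h))) n
         - (Ci * Ci) * (RtoC h * f (RtoC (INR (S n) * h))))%C; [|rewrite Ci_sqr; ring].
      field. auto.
    + apply edges_int_ccont; try lra. intros x y Hx Hy Hb. apply hol_ccont, hol_mult; [apply Hf; lra|].
      apply hol_mm. intros E. apply Csin_warg_0_imp in E. destruct E as [-> [k ->]].
      destruct Hb as [Hb|[Hb|[Hb|Hb]]]; try lra.
      * apply (Csin_warg_neq_0_x x0 0 0); [lra|]. rewrite <- Hb, warg_pair.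
        replace (PI * (IZR k * h) / h) with (IZR k * PI) by (field; lra).
        replace (PI * 0 / h) with 0 by (field; lra).
        change (Csin (RtoC (IZR k * PI)) = 0). rewrite Csin_RtoC. f_equal.
        apply sin_eq_0_1. now exists k.
      * assert (H : IZR (Z.of_nat n) < IZR k < IZR (Z.of_nat n + 1)).
        { rewrite plus_IZR, <- INR_IZR_INZ. split; apply Rmult_lt_reg_r with h; lra. }
        destruct H as [H1 H2]. apply lt_IZR in H1, H2. lia.
    + apply edges_int_ccont; try lra. intros x y Hx Hy Hb. apply hol_ccont, HG; auto.
      intros X. pose proof (f_equal Re X) as X1. pose proof (f_equal Im X) as X2.
      change (x = INR (S n) * h) in X1. change (y = 0) in X2.
      destruct Hb as [E|[E|[E|E]]]; lra.
Qed.

Lemma mu_up x y : 0 <= y -> mu (x, y) = RtoC (-1/2).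
Proof. intros H. unfold mu; simpl. destruct Rle_dec; [easy|lra]. Qed.

Lemma mu_down x y : y < 0 -> mu (x, y) = RtoC (1/2).
Proof. intros H. unfold mu; simpl. destruct Rle_dec; [lra|easy]. Qed.

Lemma is_CInt_ext f g a b l : a <= b -> (forall t, a < t < b -> f t = g t) ->
  is_CInt f a b l -> is_CInt g a b l.
Proof.
  intros Hab E. apply (is_RInt_ext (V := C_R_NormedModule)).
  now rewrite Rmin_left, Rmax_right by exact Hab.
Qed.

Lemma is_CInt_mu_v f x eta : 0 < eta -> (forall y, - eta <= y <= eta -> ccont f (x, y)) ->
  is_CInt (fun t => f (x, t) * mu (x, t))%C (- eta) eta
   (RtoC (1/2) * CInt (fun t => f (x, t)) (- eta) 0 + RtoC (-1/2) * CInt (fun t => f (x, t)) 0 eta)%C.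
Proof.
  intros He Hf. apply (is_RInt_Chasles (V := C_R_NormedModule)) with 0.
  - eapply is_CInt_ext; [lra| |apply (is_CInt_scal (RtoC (1/2))), CInt_correct, ex_CInt_v; [lra|intros; apply Hf; lra]].
    intros t Ht. cbv beta. rewrite mu_down by lra. apply Cmult_comm.
  - eapply is_CInt_ext; [lra| |apply (is_CInt_scal (RtoC (-1/2))), CInt_correct, ex_CInt_v; [lra|intros; apply Hf; lra]].
    intros t Ht. cbv beta. rewrite mu_up by lra. apply Cmult_comm.
Qed.

Lemma is_CInt_mu_h f x0 x1 y : x0 <= x1 -> (forall x, x0 <= x <= x1 -> ccont f (x, y)) ->
  is_CInt (fun t => f (t, y) * mu (t, y))%C x0 x1 (mu (0, y) * CInt (fun t => f (t, y)) x0 x1)%C.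
Proof.
  intros Hx Hf.
  eapply is_CInt_ext; [lra| |apply (is_CInt_scal (mu (0, y))), CInt_correct, ex_CInt_h; [lra|intros; apply Hf; lra]].
  intros t Ht. apply Cmult_comm.
Qed.

Lemma RI_ext f g x0 x1 y0 y1 : (forall w, f w = g w) -> RI f x0 x1 y0 y1 = RI g x0 x1 y0 y1.
Proof.
  intros E. unfold RI.
  assert (X : forall a b (p : R -> C), CInt (fun t => f (p t)) a b = CInt (fun t => g (p t)) a b).
  { intros a b p. apply (RInt_ext (V := C_R_CompleteNormedModule)). intros; apply E. }
  rewrite (X _ _ (fun t => (t, y0))), (X _ _ (fun t => (x1, t))), (X _ _ (fun t => (t, y1))),
    (X _ _ (fun t => (x0, t))). reflexivity.
Qed.

Lemma edges_int_ext f g x0 x1 y0 y1 : (forall w, f w = g w) ->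
  edges_int f x0 x1 y0 y1 -> edges_int g x0 x1 y0 y1.
Proof.
  intros E [A1 [A2 [A3 A4]]].
  assert (X : forall a b (p : R -> C), ex_CInt (fun t => f (p t)) a b -> ex_CInt (fun t => g (p t)) a b).
  { intros a b p. apply (ex_RInt_ext (V := C_R_NormedModule)). intros; apply E. }
  unfold edges_int. split; [|split; [|split]].
  - exact (X _ _ (fun t => (t, y0)) A1).
  - exact (X _ _ (fun t => (x1, t)) A2).
  - exact (X _ _ (fun t => (t, y1)) A3).
  - exact (X _ _ (fun t => (x0, t)) A4).
Qed.

(** The [mm] part gives the trapezoidal sum by residues. The [mu] part is constant on each half of
    the strip, where Goursat moves the outer path onto the real axis; the two halves contribute one
    half of the axis integral each. *)
Lemma middle_strip f x0 x1 eta n : 0 < x0 < h / 2 -> 0 < eta ->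
  INR n * h < x1 < (INR n + 1) * h -> x0 <= x1 ->
  (forall x y, x0 <= x <= x1 -> - eta <= y <= eta -> hol f (x, y)) ->
  edges_int (fun u => f u * delta h u)%C x0 x1 (- eta) eta /\
  RI (fun u => f u * delta h u)%C x0 x1 (- eta) eta
  = (CInt (fun t => f (RtoC t)) x0 x1 - RtoC h * csum (fun k => f (RtoC (INR (S k) * h))) n)%C.
Proof.
  intros Hx0 Heta Hx1 Hx Hf.
  assert (Hcont : forall x y, x0 <= x <= x1 -> - eta <= y <= eta -> ccont f (x, y))
    by (intros; now apply hol_ccont, Hf).
  pose proof (is_CInt_mu_h f x0 x1 (- eta) Hx ltac:(intros; apply Hcont; lra)) as M1.
  pose proof (is_CInt_mu_h f x0 x1 eta Hx ltac:(intros; apply Hcont; lra)) as M2.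
  pose proof (is_CInt_mu_v f x0 eta Heta ltac:(intros; apply Hcont; lra)) as M3.
  pose proof (is_CInt_mu_v f x1 eta Heta ltac:(intros; apply Hcont; lra)) as M4.
  rewrite mu_down in M1 by lra. rewrite mu_up in M2 by lra.
  assert (EM : edges_int (fun u => f u * mu u)%C x0 x1 (- eta) eta).
  { unfold edges_int. split; [|split; [|split]]; eexists; eassumption. }
  assert (Em : edges_int (fun u => f u * mm h u)%C x0 x1 (- eta) eta).
  { apply edges_int_ccont; try lra. intros x y Hx' Hy Hb.
    apply hol_ccont, hol_mult; [now apply Hf|]. apply hol_mm.
    destruct Hb as [E|[E|[E|E]]]; subst.
    - apply (Csin_warg_neq_0_x x0 y 0). lra.
    - apply (Csin_warg_neq_0_x x1 y (Z.of_nat n)). now rewrite <- INR_IZR_INZ.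
    - apply Csin_warg_neq_0_y. lra.
    - apply Csin_warg_neq_0_y. lra. }
  assert (Ed : forall u, (f u * mu u + -1 * (f u * mm h u) = f u * delta h u)%C)
    by (intros; unfold delta; ring).
  split; [eapply edges_int_ext; [exact Ed|now apply edges_int_lin]|].
  rewrite <- (RI_ext _ _ _ _ _ _ Ed).
  rewrite (RI_lin (-1)%C (fun u => f u * mu u)%C (fun u => f u * mm h u)%C) by assumption.
  rewrite (RI_mm f x0 eta) with (n := n) by assumption.
  replace (RI (fun u => f u * mu u)%C x0 x1 (- eta) eta) with (CInt (fun t => f (RtoC t)) x0 x1); [ring|].
  (* The values of [mu] are 1/2 below and -1/2 above, while the axis is run through in opposite
     directions as top side of the lower half and bottom side of the upper half: the contributions
     add up instead of cancelling. *)
  pose proof (goursat f x0 x1 (- eta) 0 Hx ltac:(lra) ltac:(intros; apply Hf; lra)) as G1.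
  pose proof (goursat f x0 x1 0 eta Hx ltac:(lra) ltac:(intros; apply Hf; lra)) as G2.
  unfold RI in *.
  rewrite (is_CInt_unique _ _ _ _ M1), (is_CInt_unique _ _ _ _ M2), (is_CInt_unique _ _ _ _ M3),
    (is_CInt_unique _ _ _ _ M4).
  change (fun t => f (RtoC t)) with (fun t => f (t, 0)).
  set (P := CInt (fun t => f (t, 0)) x0 x1) in *.
  set (Q := CInt (fun t => f (t, eta)) x0 x1) in *.
  set (S := CInt (fun t => f (t, - eta)) x0 x1) in *.
  replace P with (RtoC (1/2) * P + RtoC (1/2) * P)%C by (rewrite <- Cmult_plus_distr_r, <- RtoC_plus;
     replace (1/2+1/2) with 1 by field; ring).
  match type of G1 with (?a = _)%C => set (A := a) in G1 end.
  match type of G2 with (?a = _)%C => set (B := a) in G2 end.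
  transitivity (RtoC (1/2) * P + RtoC (1/2) * P + RtoC (1/2) * A - RtoC (1/2) * B)%C;
    [rewrite G1, G2; as_C; ring|as_C].
  unfold A, B. replace (RtoC (-1/2)) with (- RtoC (1/2))%C by (rewrite <- RtoC_opp; f_equal; field).
  ring.
Qed.

Lemma Im_warg u : Im (warg u) = PI * Im u / h.
Proof. destruct u. now rewrite warg_pair. Qed.

(* With q = exp (2 i pi u / h), delta u is q / (1 - q) above the axis and -1 / (q - 1) below. *)
Lemma delta_bound u : exp (- (2 * PI * Rabs (Im u) / h)) <= 1 / 2 -> Im u <> 0 ->
  Cmod (delta h u) <= 2 * exp (- (2 * PI * Rabs (Im u) / h)).
Proof.
  intros HQ Hu. set (Q := exp _) in *.
  assert (Hi : Ci <> 0) by apply Ci_neq_0.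
  assert (H2 : RtoC 2 <> 0) by (apply RtoC_neq_0; lra).
  set (E := Cexp (Ci * warg u)).
  assert (HE0 : E <> 0) by apply Cexp_neq_0.
  assert (HE : Cmod (E * E) = exp (- (2 * PI * Im u / h))).
  { unfold E. rewrite <- Cexp_plus, Cmod_Cexp. f_equal. pose proof (Im_warg u) as W.
    destruct (warg u) as [a b]. simpl in *. rewrite W. field. lra. }
  assert (Hm : mm h u = (- (Ci / 2) * (((E + / E) / 2) / ((E - / E) / (2 * Ci))))%C).
  { unfold mm, Ccot, Ccos, Csin. fold (warg u). rewrite Cexp_opp. reflexivity. }
  assert (Hmu : mu u = if Rle_dec 0 (Im u) then RtoC (-1/2) else RtoC (1/2)) by reflexivity.
  assert (HQ0 : 0 < Q) by apply exp_pos.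
  assert (Hh1 : RtoC (1/2) = (/ 2)%C).
  { unfold RtoC, Cinv; simpl. f_equal; field. }
  assert (Hh2 : RtoC (-1/2) = (- / 2)%C).
  { rewrite <- Hh1, <- RtoC_opp. f_equal. field. }
  assert (Fin : forall q : C, Cmod q = Q -> Cmod (q / (1 - q)) <= 2 * Q).
  { intros q Hq. pose proof (Cmod_minus_le 1 q) as A. rewrite Cmod_1, Hq in A.
    rewrite Cmod_div by (apply Cmod_pos_neq0; lra). rewrite Hq.
    apply Rmult_le_reg_r with (Cmod (1 - q)); [lra|].
    unfold Rdiv. rewrite Rmult_assoc, Rinv_l by lra. nra. }
  unfold delta. rewrite Hm, Hmu. destruct Rle_dec as [p|p].
  - assert (Hq : Cmod (E * E) = Q) by (rewrite HE; unfold Q; rewrite Rabs_pos_eq by lra; reflexivity).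
    assert (Hn : (1 - E * E)%C <> 0).
    { apply Cmod_pos_neq0. pose proof (Cmod_minus_le 1 (E * E)) as A. rewrite Cmod_1, Hq in A. lra. }
    assert (Hn' : (E * E - 1)%C <> 0).
    { intros X. apply Hn. replace (1 - E * E)%C with (- (E * E - 1))%C by ring. rewrite X. ring. }
    rewrite Hh2.
    transitivity (Cmod ((E * E) / (1 - E * E))); [right; f_equal|now apply Fin].
    replace (E - / E)%C with ((E * E - 1) / E)%C by (field; auto).
    transitivity (- / 2 + Ci * Ci / 2 * ((E * E + 1) / (E * E - 1)))%C.
    + field. auto.
    + rewrite Ci_sqr. field. auto.
  - assert (Hq : Cmod (/ (E * E)) = Q).
    { rewrite Cmod_inv by (intros X; apply C_integral in X; tauto). rewrite HE. unfold Q.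
      rewrite Rabs_left by lra. rewrite <- exp_Ropp. f_equal. field. lra. }
    assert (Hn : (1 - / (E * E))%C <> 0).
    { apply Cmod_pos_neq0. pose proof (Cmod_minus_le 1 (/ (E * E))) as A. rewrite Cmod_1, Hq in A. lra. }
    assert (Hn' : (E * E - 1)%C <> 0).
    { intros X. apply Hn. replace (1 - / (E * E))%C with ((E * E - 1) / (E * E))%C by (field; auto).
      rewrite X. unfold Cdiv. ring. }
    rewrite Hh1.
    transitivity (Cmod ((/ (E * E)) / (1 - / (E * E)))); [right|now apply Fin].
    replace (1 - / (E * E))%C with ((E * E - 1) / (E * E))%C by (field; auto).
    replace (E - / E)%C with ((E * E - 1) / E)%C by (field; auto).
    rewrite <- Cmod_opp. f_equal.
    transitivity (- (/ 2 + Ci * Ci / 2 * ((E * E + 1) / (E * E - 1))))%C.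
    + field. auto.
    + rewrite Ci_sqr. field. auto.
Qed.

(** Off the real axis [mu] is constant in a disc of radius |Im u|, and the poles of [mm] all lie on
    the axis. *)
Lemma hol_delta u : Im u <> 0 -> hol (delta h) u.
Proof.
  intros Hu. unfold delta. apply hol_minus.
  - apply (hol_ext_loc (fun _ => mu u) _ u (Rabs (Im u))); [now apply Rabs_pos_lt| |apply hol_const].
    intros w Hw. pose proof (Im_le_Cmod (w - u)) as A.
    assert (B : Rabs (Im w - Im u) < Rabs (Im u)) by (eapply Rle_lt_trans; [exact A|exact Hw]).
    unfold mu. unfold Rabs in B.
    repeat destruct Rcase_abs; repeat destruct Rle_dec; try reflexivity; lra.
  - apply hol_mm. destruct u as [x y]. now apply Csin_warg_neq_0_y.
Qed.
End Trapezoid.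

Lemma exp_le x y : x <= y -> exp x <= exp y.
Proof. intros [H| ->]; [apply Rlt_le, exp_increasing, H|apply Rle_refl]. Qed.

Lemma edges_int_join g x0 x1 y0 ym y1 :
  edges_int g x0 x1 y0 ym -> edges_int g x0 x1 ym y1 -> edges_int g x0 x1 y0 y1.
Proof.
  intros [A1 [A2 [A3 A4]]] [B1 [B2 [B3 B4]]]. unfold edges_int.
  split; [exact A1|split; [|split; [exact B3|]]];
    (eapply (ex_RInt_Chasles (V := C_R_NormedModule)); eassumption).
Qed.

(** * The poles of the integrand inside the contour *)

Definition fden (T : R) (z u : C) : C := (Cexp (2 * (Csqrt u - RtoC T)) + z)%C.
Definition fnum (T : R) (z u : C) : C := (z / RtoC PI * / Csqrt u * Cexp (Csqrt u - RtoC T))%C.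

Lemma fT_quot T z u : fT T u z = (fnum T z u / fden T z u)%C.
Proof. reflexivity. Qed.

Lemma hol_fnum T z u : 0 < Re u -> hol (fnum T z) u.
Proof.
  intros Hu. unfold fnum. apply hol_mult; [apply hol_mult; [apply hol_const|]|].
  - apply hol_inv; [now apply hol_Csqrt|now apply Csqrt_neq_0].
  - apply hol_Cexp, hol_minus; [now apply hol_Csqrt|apply hol_const].
Qed.

Lemma cderiv_fden T z u : 0 < Re u ->
  cderiv (fden T z) u (Cexp (2 * (Csqrt u - RtoC T)) / Csqrt u)%C.
Proof.
  intros Hu. pose proof (Csqrt_neq_0 u Hu) as Hs.
  assert (H2 : RtoC 2 <> 0) by (apply RtoC_neq_0; lra).
  pose proof (cderiv_plus _ _ u _ _ (cderiv_Csqrt u Hu) (cderiv_const (- RtoC T)%C u)) as D1.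
  pose proof (cderiv_mult _ _ u _ _ (cderiv_const (RtoC 2) u) D1) as D2. cbv beta in D2.
  pose proof (cderiv_comp Cexp _ u _ _ D2 (cderiv_Cexp _)) as D3. cbv beta in D3.
  pose proof (cderiv_plus _ _ u _ _ D3 (cderiv_const z u)) as D4. cbv beta in D4.
  match type of D4 with cderiv _ _ ?l =>
    replace l with (Cexp (2 * (Csqrt u - RtoC T)) / Csqrt u)%C in D4 end.
  - exact D4.
  - unfold Cminus. field. auto.
Qed.

Lemma hol_fT T z u : 0 < Re u -> fden T z u <> 0 -> hol (fun u => fT T u z) u.
Proof.
  intros Hu Hd. apply (hol_div (fnum T z) (fden T z)); [now apply hol_fnum| |exact Hd].
  eexists. now apply cderiv_fden.
Qed.

Section Contour.
Variables (h T r phi : R).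
Hypothesis h_pos : 0 < h.
Hypothesis r_pos : 0 < r.
Let z : C := (RtoC r * Cexp (0, phi))%C.
Let L : R := T + / 2 * ln r.
Hypothesis L_ge : 2 <= L.
Hypothesis phi_lt : Rabs phi < PI.
Hypothesis h_le : h / (4 * PI) <= (PI - Rabs phi) / 2.

Definition upole (L theta : R) : C := ((L, theta) * (L, theta))%C.

Lemma upole_pair theta : upole L theta = (L * L - theta * theta, 2 * L * theta).
Proof. unfold upole, Cmult; simpl. f_equal; ring. Qed.

Lemma Csqrt_upole theta : Csqrt (upole L theta) = (L, theta).
Proof. apply Csqrt_unique; [simpl; lra|reflexivity]. Qed.

Lemma Cexp_sqrt_pair a b :
  Cexp (2 * ((a, b) - RtoC T))%C = (exp (2 * (a - T)) * cos (2 * b), exp (2 * (a - T)) * sin (2 * b)).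
Proof.
  unfold Cexp. replace (Re (2 * ((a, b) - RtoC T)))%C with (2 * (a - T)) by (simpl; ring).
  replace (Im (2 * ((a, b) - RtoC T)))%C with (2 * b) by (simpl; ring). reflexivity.
Qed.

Lemma z_pair : z = (r * cos phi, r * sin phi).
Proof. unfold z, Cexp, Cmult, RtoC; simpl. rewrite exp_0. f_equal; ring. Qed.

Lemma exp_2L : exp (2 * (L - T)) = r.
Proof.
  replace (2 * (L - T)) with (ln r) by (unfold L; field). now apply exp_ln.
Qed.

Lemma fden_upole theta : theta = (phi + PI) / 2 \/ theta = (phi - PI) / 2 ->
  fden T z (upole L theta) = 0.
Proof.
  intros Ht. unfold fden. rewrite Csqrt_upole, Cexp_sqrt_pair, z_pair, exp_2L.
  assert (E : cos (2 * theta) = - cos phi /\ sin (2 * theta) = - sin phi).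
  { destruct Ht as [-> | ->].
    - replace (2 * ((phi + PI) / 2)) with (phi + PI) by field.
      now rewrite neg_cos, neg_sin.
    - replace (2 * ((phi - PI) / 2)) with (- (- phi + PI)) by field.
      rewrite cos_neg, sin_neg, neg_cos, neg_sin, cos_neg, sin_neg. lra. }
  destruct E as [-> ->]. unfold Cplus, RtoC; simpl. f_equal; ring.
Qed.

(** Write sqrt u = a + i b. The modulus forces a = L and the argument forces b = (phi + pi) / 2
    modulo pi. The height 2 pi L of Gamma means |b| <= pi, which leaves only two of these values. *)
Lemma fden_zero x y : 0 < x -> - (2 * PI * L) <= y <= 2 * PI * L -> fden T z (x, y) = 0 ->
  (x, y) = upole L ((phi + PI) / 2) \/ (x, y) = upole L ((phi - PI) / 2).
Proof.
  intros Hx Hy H. pose proof (Csqrt_sqr (x, y)) as S. pose proof (Re_Csqrt_pos (x, y) Hx) as P.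
  unfold fden in H. destruct (Csqrt (x, y)) as [a b]. simpl in P.
  rewrite Cexp_sqrt_pair, z_pair in H.
  assert (H1 : exp (2 * (a - T)) * cos (2 * b) + r * cos phi = 0) by exact (f_equal Re H).
  assert (H2 : exp (2 * (a - T)) * sin (2 * b) + r * sin phi = 0) by exact (f_equal Im H).
  set (E := exp (2 * (a - T))) in *. assert (HE : 0 < E) by apply exp_pos.
  pose proof (sin2_cos2 (2 * b)) as T1. pose proof (sin2_cos2 phi) as T2. unfold Rsqr in T1, T2.
  assert (Er : E = r).
  { assert (Q : E * E = r * r).
    { replace (E * E) with (E * E * (sin (2 * b) * sin (2 * b) + cos (2 * b) * cos (2 * b))) by (rewrite T1; ring).
      replace (r * r) with (r * r * (sin phi * sin phi + cos phi * cos phi)) by (rewrite T2; ring).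
      assert (X1 : E * cos (2 * b) = - (r * cos phi)) by lra.
      assert (X2 : E * sin (2 * b) = - (r * sin phi)) by lra.
      transitivity ((E * sin (2 * b)) * (E * sin (2 * b)) + (E * cos (2 * b)) * (E * cos (2 * b))); [ring|].
      rewrite X1, X2. ring. }
    nra. }
  assert (Ea : a = L).
  { unfold E in Er. rewrite <- exp_2L in Er. apply exp_inv in Er. lra. }
  rewrite Er in H1, H2.
  assert (C1 : cos (2 * b) = - cos phi) by nra.
  assert (C2 : sin (2 * b) = - sin phi) by nra.
  assert (S0 : sin (b - (phi + PI) / 2) = 0).
  { assert (D : cos (2 * (b - (phi + PI) / 2)) = 1).
    { replace (2 * (b - (phi + PI) / 2)) with (2 * b - (phi + PI)) by field.
      rewrite cos_minus, neg_cos, neg_sin, C1, C2. lra. }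
    rewrite cos_2a_sin in D. set (s := sin (b - (phi + PI) / 2)) in *.
    destruct (Rmult_integral s s); [lra|easy|easy]. }
  apply sin_eq_0_0 in S0. destruct S0 as [k Hk].
  assert (Eb : y = 2 * L * b).
  { apply (f_equal Im) in S. simpl in S. rewrite Ea in S. lra. }
  pose proof PI_RGT_0 as HP.
  assert (Bb : - PI <= b <= PI) by (rewrite Eb in Hy; split; nra).
  pose proof (Rabs_def2 _ _ phi_lt) as [P1 P2].
  assert (K : IZR (-2) < IZR k < IZR 1).
  { split; apply Rmult_lt_reg_r with PI; lra. }
  destruct K as [K1 K2]. apply lt_IZR in K1, K2.
  rewrite <- S, Ea. assert (K3 : (k = 0 \/ k = -1)%Z) by lia. destruct K3 as [-> | ->].
  - left. replace ((phi + PI) / 2) with b by lra. reflexivity.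
  - right. replace ((phi - PI) / 2) with b by lra. reflexivity.
Qed.

(** At a zero p of the denominator, z = - e^(2 (sqrt p - T)), so z and the factor 1 / sqrt p cancel
    from the residue of f, which is just - e^(sqrt p - T) / pi. *)
Definition res (theta : R) : C :=
  (- (/ RtoC PI) * Cexp ((L, theta) - RtoC T) * delta h (upole L theta))%C.

Lemma simple_pole_upole theta : theta = (phi + PI) / 2 \/ theta = (phi - PI) / 2 ->
  0 < Re (upole L theta) -> theta <> 0 ->
  simple_pole (fun u => fT T u z * delta h u)%C (upole L theta) (res theta).
Proof.
  intros Ht Hre Hth. set (p := upole L theta) in *.
  assert (HPI : RtoC PI <> 0) by (apply RtoC_neq_0, Rgt_not_eq, PI_RGT_0).
  pose proof (fden_upole theta Ht) as D0. fold p in D0.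
  pose proof (Csqrt_neq_0 p Hre) as Hs.
  assert (Him : Im p <> 0).
  { unfold p. rewrite upole_pair. simpl. intros E. apply Rmult_integral in E. lra. }
  pose proof (Cexp_neq_0 (2 * (Csqrt p - RtoC T))) as He.
  pose proof (Cexp_neq_0 (Csqrt p - RtoC T)) as He1.
  pose proof (simple_pole_quotient (fun u => fnum T z u * delta h u)%C (fden T z) p _
     ltac:(apply hol_ccont, hol_mult; [now apply hol_fnum|now apply hol_delta])
     (cderiv_fden T z p Hre) D0 ltac:(now apply Cdiv_neq_0)) as Q.
  eapply simple_pole_ext in Q.
  - match type of Q with simple_pole _ _ ?c => replace c with (res theta) in Q end; [exact Q|].
    assert (Ez : z = (- (Cexp (Csqrt p - RtoC T) * Cexp (Csqrt p - RtoC T)))%C).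
    { unfold fden in D0. rewrite <- Cexp_plus.
      replace (Csqrt p - RtoC T + (Csqrt p - RtoC T))%C with (2 * (Csqrt p - RtoC T))%C by ring.
      apply Cminus_eq_0. rewrite <- D0. ring. }
    unfold fnum, res. rewrite Ez.
    replace (2 * (Csqrt p - RtoC T))%C with (Csqrt p - RtoC T + (Csqrt p - RtoC T))%C by ring.
    rewrite Cexp_plus. fold p.
    replace (L, theta) with (Csqrt p) by apply Csqrt_upole.
    set (e := Cexp (Csqrt p - RtoC T)) in *. field. auto.
  - intros w. cbv beta. rewrite fT_quot. unfold Cdiv. ring.
Qed.

Lemma Cmod_res theta : (PI - Rabs phi) / 2 <= Rabs theta -> Cmod (res theta) <= 2 / PI * exp (- T).
Proof.
  intros Ht. pose proof PI_RGT_0 as HP.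
  assert (HPI : RtoC PI <> 0) by (apply RtoC_neq_0; lra).
  assert (Hth : 0 < Rabs theta) by lra.
  assert (Him : Im (upole L theta) = 2 * L * theta) by now rewrite upole_pair.
  assert (Hle : exp (- (2 * PI * Rabs (Im (upole L theta)) / h)) <= exp (- L)).
  { apply exp_le. rewrite Him, Rabs_mult, (Rabs_pos_eq (2 * L)) by lra.
    apply Ropp_le_contravar.
    apply Rmult_le_reg_r with h; [easy|].
    replace (2 * PI * (2 * L * Rabs theta) / h * h) with (L * (4 * PI * Rabs theta)) by (field; lra).
    apply Rmult_le_compat_l; [lra|].
    (* Here the step size enters: the exponent 4 pi L |theta| / h is at least L precisely when h <=
       4 pi |theta|. *)
    apply Rle_trans with (4 * PI * (h / (4 * PI))); [right; field; lra|].
    apply Rmult_le_compat_l; lra. }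
  assert (He2 : exp (- L) <= 1 / 2).
  { rewrite exp_Ropp. unfold Rdiv. rewrite Rmult_1_l. apply Rinv_le_contravar; [lra|].
    pose proof (exp_ineq1_le L). lra. }
  unfold res. rewrite !Cmod_mult, Cmod_opp, Cmod_inv, Cmod_R, Rabs_pos_eq, Cmod_Cexp by (auto; lra).
  replace (Re ((L, theta) - RtoC T)) with (L - T) by (simpl; ring).
  pose proof (delta_bound h h_pos (upole L theta) ltac:(lra)
     ltac:(rewrite Him; intros E; apply Rmult_integral in E; destruct E as [E|E]; [lra|];
           rewrite E, Rabs_R0 in Hth; lra)) as B.
  apply Rle_trans with (/ PI * exp (L - T) * (2 * exp (- L))).
  - apply Rmult_le_compat_l; [|lra].
    apply Rmult_le_pos; [apply Rlt_le, Rinv_0_lt_compat, HP|apply Rlt_le, exp_pos].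
  - right. replace (- T) with ((L - T) + - L) by ring. rewrite exp_plus. field. lra.
Qed.

Lemma strip_residue x0 x1 y0 y1 theta :
  theta = (phi + PI) / 2 \/ theta = (phi - PI) / 2 -> theta <> 0 ->
  0 < x0 -> x0 < L * L - theta * theta < x1 -> y0 < 2 * L * theta < y1 ->
  (forall x y, x0 <= x <= x1 -> y0 <= y <= y1 -> y <> 0 /\ (fden T z (x, y) = 0 -> (x, y) = upole L theta)) ->
  edges_int (fun u => fT T u z * delta h u)%C x0 x1 y0 y1 /\
  RI (fun u => fT T u z * delta h u)%C x0 x1 y0 y1 = (2 * PI * Ci * res theta)%C.
Proof.
  intros Ht Hth Hx0 Hx Hy HD.
  assert (HG : forall x y, x0 <= x <= x1 -> y0 <= y <= y1 -> (x, y) <> upole L theta ->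
     hol (fun u => fT T u z * delta h u)%C (x, y)).
  { intros x y Hx' Hy' Hn. destruct (HD x y Hx' Hy') as [N1 N2].
    apply hol_mult; [|now apply hol_delta]. apply hol_fT; [simpl; lra|]. auto. }
  split.
  - apply edges_int_ccont; try lra. intros x y Hx' Hy' Hb. apply hol_ccont, HG; auto.
    rewrite upole_pair. intros E. injection E as -> ->. destruct Hb as [E|[E|[E|E]]]; lra.
  - apply residue_rect with (p := upole L theta).
    + rewrite upole_pair. exact Hx.
    + rewrite upole_pair. exact Hy.
    + exact HG.
    + apply simple_pole_upole; auto. rewrite upole_pair. simpl. lra.
Qed.

(** The outer strips contribute 2 pi i times a residue each. With |res| <= (2 / pi) e^(-T) for both,
    the total is at most 8 e^(-T). *)
Lemma contour_estimate x0 x1 n : 0 < x0 < h / 2 -> INR n * h < x1 < (INR n + 1) * h ->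
  x0 < L * L - ((PI + Rabs phi) / 2) * ((PI + Rabs phi) / 2) -> L * L < x1 ->
  Cmod (RI (fun u => fT T u z * delta h u)%C x0 x1 (- (2 * PI * L)) (2 * PI * L)
        - (CInt (fun t => fT T (RtoC t) z) x0 x1
           - RtoC h * csum (fun k => fT T (RtoC (INR (S k) * h)) z) n))%C <= 8 * exp (- T).
Proof.
  intros Hx0 Hx1 HxL HxL'. pose proof PI_RGT_0 as HP.
  pose proof (Rabs_def2 _ _ phi_lt) as [P1 P2].
  assert (HA : phi <= Rabs phi /\ - phi <= Rabs phi /\ 0 <= Rabs phi).
  { split; [apply Rle_abs|split; [rewrite <- Rabs_Ropp; apply Rle_abs|apply Rabs_pos]]. }
  set (tp := (phi + PI) / 2). set (tm := (phi - PI) / 2).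
  assert (Htp : (PI - Rabs phi) / 2 <= tp <= (PI + Rabs phi) / 2) by (unfold tp; lra).
  assert (Htm : (PI - Rabs phi) / 2 <= - tm <= (PI + Rabs phi) / 2) by (unfold tm; lra).
  assert (Hpos : 0 < (PI - Rabs phi) / 2) by lra.
  (* The poles have imaginary parts 2 L tp and 2 L tm, so eta is half the smaller distance from them
     to the axis: the middle strip avoids both. *)
  set (eta := L * Rmin tp (- tm)).
  assert (Heta : 0 < eta) by (apply Rmult_lt_0_compat; [lra|apply Rmin_pos; lra]).
  assert (Heta1 : eta <= L * tp) by (apply Rmult_le_compat_l; [lra|apply Rmin_l]).
  assert (Heta2 : eta <= - (L * tm)) by (rewrite Ropp_mult_distr_r; apply Rmult_le_compat_l; [lra|apply Rmin_r]).
  assert (HLp : 0 < L * tp) by nra. assert (HLm : L * tm < 0) by nra.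
  assert (Hap : 2 * L * tp < 2 * PI * L) by (unfold tp; nra).
  assert (Ham : - (2 * PI * L) < 2 * L * tm) by (unfold tm; nra).
  assert (Hsq : forall t, - ((PI + Rabs phi) / 2) <= t <= (PI + Rabs phi) / 2 -> x0 < L * L - t * t < x1).
  { intros t Ht. split; [|nra]. nra. }
  assert (Hx01 : x0 <= x1) by (specialize (Hsq 0); lra).
  destruct (strip_residue x0 x1 eta (2 * PI * L) tp) as [U1 U2]; try lra.
  { left; reflexivity. }
  { apply Hsq. lra. }
  { intros x y Hx Hy. split; [lra|]. intros D.
    apply fden_zero in D; [|lra|lra]. destruct D as [D|D]; [exact D|].
    exfalso. rewrite upole_pair in D. injection D as _ E. fold tm in E. lra. }
  destruct (strip_residue x0 x1 (- (2 * PI * L)) (- eta) tm) as [D1 D2]; try lra.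
  { right; reflexivity. }
  { apply Hsq. lra. }
  { intros x y Hx Hy. split; [lra|]. intros D.
    apply fden_zero in D; [|lra|lra]. destruct D as [D|D]; [|exact D].
    exfalso. rewrite upole_pair in D. injection D as _ E. fold tp in E. lra. }
  destruct (middle_strip h h_pos (fun u => fT T u z) x0 x1 eta n) as [M1 M2]; auto.
  { intros x y Hx Hy. apply hol_fT; [simpl; lra|]. intros D.
    apply fden_zero in D; [|lra|lra].
    destruct D as [D|D]; rewrite upole_pair in D; injection D as _ E; [fold tp in E|fold tm in E]; lra. }
  rewrite (RI_split_h _ x0 x1 _ (- eta)); [|exact D1|eapply edges_int_join; eassumption].
  rewrite (RI_split_h _ x0 x1 (- eta) eta); [|exact M1|exact U1].
  rewrite U2, D2, M2.
  match goal with |- Cmod ?c <= _ => replace c with (2 * PI * Ci * (res tm + res tp))%C by ring end.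
  rewrite !Cmod_mult, Cmod_Ci, !Cmod_R, (Rabs_pos_eq 2), (Rabs_pos_eq PI) by lra.
  pose proof (Cmod_triangle (res tm) (res tp)).
  pose proof (Cmod_res tp ltac:(rewrite (Rabs_pos_eq tp); lra)).
  pose proof (Cmod_res tm ltac:(rewrite (Rabs_left tm); lra)).
  apply Rle_trans with (2 * PI * 1 * (2 / PI * exp (- T) + 2 / PI * exp (- T))).
  - apply Rmult_le_compat_l; lra.
  - right. field. lra.
Qed.
End Contour.

(** * The truncated integral representation of the square root *)

Lemma atan_lipschitz a b : Rabs (atan b - atan a) <= Rabs (b - a).
Proof.
  destruct (MVT_gen atan a b (fun x => / (1 + x ^ 2))) as [c [_ H]].
  - intros x _. auto_derive; [easy|]. field. nra.
  - intros x _. apply derivable_continuous_pt, derivable_pt_atan.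
  - rewrite H, Rabs_mult. rewrite <- (Rmult_1_l (Rabs (b - a))) at 2.
    apply Rmult_le_compat_r; [apply Rabs_pos|].
    assert (1 <= 1 + c ^ 2) by nra.
    rewrite Rabs_pos_eq by (apply Rlt_le, Rinv_0_lt_compat; lra).
    rewrite <- Rinv_1. apply Rinv_le_contravar; lra.
Qed.

Lemma atan_compl_bound s : 0 < s -> Rabs (atan s - PI / 2) <= / s.
Proof.
  intros Hs. pose proof (atan_inv s Hs) as E.
  replace (atan s - PI / 2) with (- (atan (/ s) - atan 0)) by (rewrite E, atan_0; ring).
  rewrite Rabs_Ropp. eapply Rle_trans; [apply atan_lipschitz|].
  rewrite Rminus_0_r, Rabs_pos_eq; [lra|]. apply Rlt_le, Rinv_0_lt_compat, Hs.
Qed.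

Lemma ln_diff_bound p m d : 0 < d -> d <= p -> d <= m -> Rabs (ln p - ln m) <= Rabs (p - m) / d.
Proof.
  intros Hd Hp Hm.
  assert (B : forall u v, d <= u -> d <= v -> ln u - ln v <= Rabs (u - v) / d).
  { intros u v Hu Hv. rewrite <- ln_div by lra.
    assert (Q : 0 < u / v) by (apply Rdiv_lt_0_compat; lra).
    pose proof (exp_ineq1_le (ln (u / v))) as E. rewrite exp_ln in E by exact Q.
    apply Rle_trans with ((u - v) / v).
    - replace ((u - v) / v) with (u / v - 1) by (field; lra). lra.
    - unfold Rdiv. apply Rle_trans with (Rabs (u - v) * / v).
      + apply Rmult_le_compat_r; [apply Rlt_le, Rinv_0_lt_compat; lra|apply Rle_abs].
      + apply Rmult_le_compat_l; [apply Rabs_pos|apply Rinv_le_contravar; lra]. }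
  apply Rabs_le. pose proof (B p m Hp Hm). pose proof (B m p Hm Hp) as B2.
  rewrite Rabs_minus_sym in B2. lra.
Qed.

(* [catan x q E] is arctan (E / w) for w = x + i q with x > 0. *)
Definition catan (x q E : R) : C :=
  ((atan ((E + q) / x) + atan ((E - q) / x)) / 2,
   - (ln (x * x + (q + E) * (q + E)) - ln (x * x + (q - E) * (q - E))) / 4).

Definition catan' (x q E : R) : C :=
  ((x / (x * x + (q + E) * (q + E)) + x / (x * x + (q - E) * (q - E))) / 2,
   - ((q + E) / (x * x + (q + E) * (q + E)) + (q - E) / (x * x + (q - E) * (q - E))) / 2).

Lemma catan'_eq x q E : 0 < x -> 
  let w : C := (x, q) in (w * w + RtoC (E * E))%C <> 0 /\ catan' x q E = (w / (w * w + RtoC (E * E)))%C.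
Proof.
  intros Hx w.
  assert (H1 : (w + Ci * RtoC E)%C <> 0).
  { intros H. apply (f_equal Re) in H. unfold w in H. simpl in H. lra. }
  assert (H2 : (w - Ci * RtoC E)%C <> 0).
  { intros H. apply (f_equal Re) in H. unfold w in H. simpl in H. lra. }
  assert (F : (w * w + RtoC (E * E) = (w + Ci * RtoC E) * (w - Ci * RtoC E))%C).
  { rewrite RtoC_mult.
    transitivity (w * w - (Ci * Ci) * (RtoC E * RtoC E))%C; [rewrite Ci_sqr|]; ring. }
  split.
  - rewrite F. intros H. apply C_integral in H. tauto.
  - rewrite F. transitivity (/ 2 * (/ (w + Ci * RtoC E) + / (w - Ci * RtoC E)))%C.
    + unfold catan', w, Cinv, Cmult, Cplus, Cminus, Copp, Ci, RtoC; simpl.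
      assert (P1 : 0 < x * x + (q + E) * (q + E)) by (pose proof (Rle_0_sqr (q + E)); unfold Rsqr in *; nra).
      assert (P2 : 0 < x * x + (q - E) * (q - E)) by (pose proof (Rle_0_sqr (q - E)); unfold Rsqr in *; nra).
      f_equal; field; repeat split; apply Rgt_not_eq; lra.
    + field. auto.
Qed.

(** With E = e^(sqrt t - T), so that dE = E / (2 sqrt t) dt, and z = w^2, the integrand becomes (2
    w^2 / pi) dE / (E^2 + w^2), whose primitive is (2 w / pi) arctan (E / w). Working with w in the
    right half-plane keeps arctan on one branch. *)
Lemma is_CInt_fT T x q x0 x1 : 0 < x -> 0 < x0 <= x1 ->
  let w : C := (x, q) in
  is_CInt (fun t => fT T (RtoC t) (w * w)) x0 x1
    (2 * w / RtoC PI * (catan x q (exp (sqrt x1 - T)) - catan x q (exp (sqrt x0 - T))))%C.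
Proof.
  intros Hx Hx01 w.
  set (EE := fun t => exp (sqrt t - T)).
  assert (I : is_CInt (fun t => catan' x q (EE t) * RtoC (EE t / (2 * sqrt t)))%C x0 x1
     (catan x q (EE x1) - catan x q (EE x0))%C).
  { apply is_CInt_pair.
    - apply is_RInt_ext with
        (fun t => (x / (x * x + (q + EE t) * (q + EE t)) + x / (x * x + (q - EE t) * (q - EE t))) / 2
            * (EE t / (2 * sqrt t))); [intros; simpl; ring|].
      apply (is_RInt_derive (fun t => (atan ((EE t + q) / x) + atan ((EE t - q) / x)) / 2));
        intros t Ht; rewrite Rmin_left, Rmax_right in Ht by lra;
        assert (St : 0 < sqrt t) by (apply sqrt_lt_R0; lra);
        pose proof (sqsum_pos (q + EE t) x Hx); pose proof (sqsum_pos (q - EE t) x Hx).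
      + unfold EE in *. auto_derive;
        change (sqrt t + - T) with (sqrt t - T); set (e := exp (sqrt t - T)) in *;
        [repeat split; lra|]. field. repeat split; apply Rgt_not_eq; try lra; nra.
      + apply (ex_derive_continuous (V := R_NormedModule)). unfold EE in *. auto_derive.
        change (sqrt t + - T) with (sqrt t - T). set (e := exp (sqrt t - T)) in *.
        repeat split; try lra; apply Rgt_not_eq; lra.
    - apply is_RInt_ext with
        (fun t => - ((q + EE t) / (x * x + (q + EE t) * (q + EE t)) + (q - EE t) / (x * x + (q - EE t) * (q - EE t))) / 2
            * (EE t / (2 * sqrt t))); [intros; simpl; ring|].
      apply (is_RInt_derive (fun t => - (ln (x * x + (q + EE t) * (q + EE t)) - ln (x * x + (q - EE t) * (q - EE t))) / 4));
        intros t Ht; rewrite Rmin_left, Rmax_right in Ht by lra;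
        assert (St : 0 < sqrt t) by (apply sqrt_lt_R0; lra);
        pose proof (sqsum_pos (q + EE t) x Hx); pose proof (sqsum_pos (q - EE t) x Hx).
      + unfold EE in *. auto_derive;
        change (sqrt t + - T) with (sqrt t - T); set (e := exp (sqrt t - T)) in *;
        [repeat split; lra|]. field. repeat split; apply Rgt_not_eq; try lra; nra.
      + apply (ex_derive_continuous (V := R_NormedModule)). unfold EE in *. auto_derive.
        change (sqrt t + - T) with (sqrt t - T). set (e := exp (sqrt t - T)) in *.
        repeat split; try lra; apply Rgt_not_eq; lra. }
  eapply is_CInt_ext; [lra| |apply (is_CInt_scal (2 * w / RtoC PI)%C), I].
  intros t Ht. cbv beta. as_C.
  destruct (catan'_eq x q (EE t) Hx) as [N ->]. fold w. fold w in N.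
  assert (St : 0 < sqrt t) by (apply sqrt_lt_R0; lra).
  unfold fT. rewrite Csqrt_RtoC by lra.
  replace (2 * (RtoC (sqrt t) - RtoC T))%C with ((RtoC (sqrt t) - RtoC T) + (RtoC (sqrt t) - RtoC T))%C by ring.
  rewrite Cexp_plus.
  replace (Cexp (RtoC (sqrt t) - RtoC T)) with (RtoC (EE t)).
  2:{ unfold Cexp, EE, RtoC, Rminus; simpl. replace (0 + - 0) with 0 by ring. rewrite cos_0, sin_0. f_equal; ring. }
  rewrite RtoC_mult in N |- *.
  rewrite RtoC_div, RtoC_mult by lra.
  assert (HPI : RtoC PI <> 0) by (apply RtoC_neq_0, Rgt_not_eq, PI_RGT_0).
  assert (Hs : RtoC (sqrt t) <> 0) by (apply RtoC_neq_0; lra).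
  rewrite Cplus_comm in N. field. auto.
Qed.

Lemma Csqrt_ray r phi : 0 < r -> Rabs phi < PI ->
  0 < cos (phi / 2) /\
  Csqrt (RtoC r * Cexp (0, phi)) = (sqrt r * cos (phi / 2), sqrt r * sin (phi / 2)).
Proof.
  intros Hr Hp. apply Rabs_def2 in Hp.
  assert (Hc : 0 < cos (phi / 2)) by (apply cos_gt_0; lra).
  split; [exact Hc|]. apply Csqrt_unique.
  - apply Rmult_lt_0_compat; [now apply sqrt_lt_R0|exact Hc].
  - unfold Cexp, RtoC, Cmult; simpl. rewrite exp_0.
    replace (cos phi) with (cos (2 * (phi / 2))) by (f_equal; field).
    replace (sin phi) with (sin (2 * (phi / 2))) by (f_equal; field).
    rewrite cos_2a, sin_2a.
    pose proof (sqrt_sqrt r ltac:(lra)) as S. set (a := sqrt r) in *. set (b := phi / 2).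
    rewrite <- S. f_equal; ring.
Qed.

(** The arctangent is close to 0 at the lower end and to pi / 2 at the upper end, which leaves w =
    sqrt z. The lower error grows like 1 / sqrt r, but the prefactor 2 w / pi has size sqrt r, so
    the bound is uniform in r. *)
Lemma sqrt_integral_estimate T r phi x0 x1 : 0 < r <= 1 -> Rabs phi < PI -> 0 < x0 <= x1 ->
  2 <= exp (sqrt x1 - T) ->
  let z := (RtoC r * Cexp (0, phi))%C in
  let c := cos (phi / 2) in
  Cmod (CInt (fun t => fT T (RtoC t) z) x0 x1 - Csqrt z)%C
    <= 2 / (c * c) * exp (sqrt x0 - T) + 6 / exp (sqrt x1 - T).
Proof.
  intros Hr Hphi Hx01 HE1 z c. destruct (Csqrt_ray r phi ltac:(lra) Hphi) as [Hc Hw]. fold z c in Hc, Hw.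
  set (a := sqrt r) in *. set (s := sin (phi / 2)) in *. fold c in Hw.
  assert (Ha : 0 < a <= 1).
  { split; [now apply sqrt_lt_R0|]. unfold a. rewrite <- sqrt_1. apply sqrt_le_1; lra. }
  set (x := a * c) in *. set (q := a * s) in *.
  assert (Hx : 0 < x) by (unfold x; nra).
  assert (Hc1 : c <= 1) by apply COS_bound.
  assert (Hx1 : x <= a) by (unfold x; nra).
  assert (Hq : Rabs q <= a).
  { unfold q. rewrite Rabs_mult, (Rabs_pos_eq a) by lra. pose proof (SIN_bound (phi / 2)).
    assert (Rabs s <= 1) by (apply Rabs_le; unfold s; lra). nra. }
  set (w := (x, q) : C). assert (Hz : z = (w * w)%C) by (unfold w; rewrite <- Hw; symmetry; apply Csqrt_sqr).
  assert (Hmw : Cmod w = a).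
  { unfold w. rewrite <- Hw, Cmod_Csqrt. unfold z. rewrite Cmod_mult, Cmod_R, Cmod_Cexp. simpl.
    rewrite exp_0, Rmult_1_r, Rabs_pos_eq by lra. reflexivity. }
  pose proof (is_CInt_fT T x q x0 x1 Hx Hx01) as I. cbv zeta in I. fold w in I. rewrite <- Hz in I.
  rewrite (is_CInt_unique _ _ _ _ I), Hw. fold w.
  set (E0 := exp (sqrt x0 - T)) in *. set (E1 := exp (sqrt x1 - T)) in *.
  assert (HE0 : 0 < E0) by apply exp_pos.
  assert (HPI := PI_RGT_0).
  assert (HPI0 : RtoC PI <> 0) by (apply RtoC_neq_0; lra).
  assert (H20 : RtoC 2 <> 0) by (apply RtoC_neq_0; lra).
  assert (Sq : forall u, 0 <= u * u) by (intros u; apply Rle_0_sqr).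
  assert (B0 : Cmod (catan x q E0) <= E0 / x + Rabs q * E0 / (x * x)).
  { eapply Rle_trans; [apply Cmod_le_abs|]. unfold catan; simpl. apply Rplus_le_compat.
    (* Oddness of atan turns the sum into a difference of values at distance 2 E0 / x, so q drops
       out of the Lipschitz bound. *)
    - replace ((E0 - q) / x) with (- ((q - E0) / x)) by (field; lra). rewrite atan_opp.
      pose proof (atan_lipschitz ((q - E0) / x) ((E0 + q) / x)) as A.
      replace ((E0 + q) / x - (q - E0) / x) with (2 * (E0 / x)) in A by (field; lra).
      assert (0 < E0 / x) by (apply Rdiv_lt_0_compat; lra).
      rewrite (Rabs_pos_eq (2 * _)) in A by lra.
      rewrite (Rabs_div _ 2), (Rabs_pos_eq 2) by lra. unfold Rminus at 1 in A. lra.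
    - pose proof (ln_diff_bound (x * x + (q + E0) * (q + E0)) (x * x + (q - E0) * (q - E0)) (x * x)
        ltac:(nra) ltac:(pose proof (Sq (q + E0)); lra) ltac:(pose proof (Sq (q - E0)); lra)) as A.
      replace (x * x + (q + E0) * (q + E0) - (x * x + (q - E0) * (q - E0))) with (4 * E0 * q) in A by ring.
      rewrite (Rabs_mult (4 * E0) q), (Rabs_pos_eq (4 * E0)) in A by lra.
      rewrite (Rabs_div _ 4), (Rabs_pos_eq 4), Rabs_Ropp by lra.
      replace (Rabs q * E0 / (x * x)) with (4 * E0 * Rabs q / (x * x) / 4) by (field; lra).
      apply Rmult_le_compat_r; [lra|exact A]. }
  assert (Hqa : - a <= q <= a) by (apply Rabs_le_between; exact Hq).
  assert (B1 : Cmod (catan x q E1 - RtoC (PI / 2)) <= 6 / E1).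
  { eapply Rle_trans; [apply Cmod_le_abs|]. unfold catan; simpl.
    replace (6 / E1) with (2 / E1 + 4 / E1) by (field; lra).
    assert (K : forall p, - a <= p <= a -> / ((E1 + p) / x) <= 2 / E1).
    { intros p Hp. replace (/ ((E1 + p) / x)) with (x / (E1 + p)) by (field; lra).
      apply Rmult_le_reg_r with ((E1 + p) * E1); [nra|].
      replace (x / (E1 + p) * ((E1 + p) * E1)) with (x * E1) by (field; lra).
      replace (2 / E1 * ((E1 + p) * E1)) with (2 * (E1 + p)) by (field; lra). nra. }
    apply Rplus_le_compat.
    - pose proof (atan_compl_bound ((E1 + q) / x) ltac:(apply Rdiv_lt_0_compat; lra)) as A1.
      pose proof (atan_compl_bound ((E1 - q) / x) ltac:(apply Rdiv_lt_0_compat; lra)) as A2.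
      pose proof (K q ltac:(lra)). pose proof (K (- q) ltac:(lra)) as K2.
      replace (E1 + - q) with (E1 - q) in K2 by ring.
      replace ((atan ((E1 + q) / x) + atan ((E1 - q) / x)) / 2 + - (PI / 2))
        with (((atan ((E1 + q) / x) - PI / 2) + (atan ((E1 - q) / x) - PI / 2)) * / 2) by field.
      rewrite Rabs_mult, (Rabs_pos_eq (/ 2)) by lra.
      pose proof (Rabs_triang (atan ((E1 + q) / x) - PI / 2) (atan ((E1 - q) / x) - PI / 2)). lra.
    (* Since |q| <= 1 and E1 >= 2, both |q + E1| and |q - E1| are at least E1 / 2; hence the lower
       bound E1^2 / 4. *)
    - pose proof (ln_diff_bound (x * x + (q + E1) * (q + E1)) (x * x + (q - E1) * (q - E1)) (E1 * E1 / 4)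
        ltac:(nra) ltac:(pose proof (Sq x); assert (0 <= (E1 / 2 + q) * (3 * E1 / 2 + q)) by (apply Rmult_le_pos; lra); lra)
        ltac:(pose proof (Sq x); assert (0 <= (E1 / 2 - q) * (3 * E1 / 2 - q)) by (apply Rmult_le_pos; lra); lra)) as A.
      replace (x * x + (q + E1) * (q + E1) - (x * x + (q - E1) * (q - E1))) with (4 * E1 * q) in A by ring.
      rewrite (Rabs_mult (4 * E1) q), (Rabs_pos_eq (4 * E1)) in A by lra.
      rewrite Ropp_0, Rplus_0_r. rewrite (Rabs_div _ 4), (Rabs_pos_eq 4), Rabs_Ropp by lra.
      apply Rle_trans with (4 * E1 * Rabs q / (E1 * E1 / 4) / 4); [apply Rmult_le_compat_r; lra|].
      replace (4 * E1 * Rabs q / (E1 * E1 / 4) / 4) with (4 * Rabs q * / E1) by (field; lra).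
      unfold Rdiv. apply Rmult_le_compat_r; [apply Rlt_le, Rinv_0_lt_compat; lra|lra]. }
  replace (2 * w / RtoC PI * (catan x q E1 - catan x q E0) - w)%C
    with (2 * w / RtoC PI * ((catan x q E1 - RtoC (PI / 2)) + - catan x q E0))%C
    by (rewrite RtoC_div by lra; field; auto).
  rewrite Cmod_mult, Cmod_div, Cmod_mult, !Cmod_R, Hmw, (Rabs_pos_eq 2), (Rabs_pos_eq PI) by (auto; lra).
  assert (HPI2 := PI2_1).
  assert (Hk : 2 * a / PI <= a).
  { apply Rmult_le_reg_r with PI; [lra|]. unfold Rdiv. rewrite Rmult_assoc, Rinv_l by lra. nra. }
  apply Rle_trans with (a * (6 / E1 + (E0 / x + Rabs q * E0 / (x * x)))).
  - apply Rmult_le_compat; [|apply Cmod_ge_0|exact Hk|].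
    + apply Rlt_le, Rdiv_lt_0_compat; lra.
    + eapply Rle_trans; [apply Cmod_triangle|]. rewrite Cmod_opp. lra.
  - rewrite Rmult_plus_distr_l, Rplus_comm. apply Rplus_le_compat.
    + apply Rle_trans with (a * (E0 / x + a * E0 / (x * x))).
      * apply Rmult_le_compat_l; [lra|]. apply Rplus_le_compat_l. unfold Rdiv.
        apply Rmult_le_compat_r; [apply Rlt_le, Rinv_0_lt_compat; nra|]. nra.
      * unfold x. replace (a * (E0 / (a * c) + a * E0 / (a * c * (a * c)))) with ((c + 1) * (/ (c * c) * E0))
          by (field; lra).
        replace (2 / (c * c) * E0) with (2 * (/ (c * c) * E0)) by (field; lra).
        apply Rmult_le_compat_r; [|lra]. apply Rmult_le_pos; [|lra].
        apply Rlt_le, Rinv_0_lt_compat. nra.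
    + rewrite <- (Rmult_1_l (6 / E1)) at 2. apply Rmult_le_compat_r; [|lra].
      apply Rlt_le, Rdiv_lt_0_compat; lra.
Qed.

(** * The quadrature sum and its polynomial part *)

Lemma csum_ext f g n : (forall k, (k < n)%nat -> f k = g k) -> csum f n = csum g n.
Proof.
  induction n as [|n IH]; intros H; simpl; [easy|].
  rewrite IH, H; auto.
Qed.

Lemma csum_plus f g n : csum (fun k => f k + g k)%C n = (csum f n + csum g n)%C.
Proof. induction n as [|n IH]; simpl; [ring|rewrite IH; ring]. Qed.

Lemma csum_scal c f n : csum (fun k => c * f k)%C n = (c * csum f n)%C.
Proof. induction n as [|n IH]; simpl; [ring|rewrite IH; ring]. Qed.

Lemma csum_add f n m : csum f (n + m) = (csum f n + csum (fun k => f (n + k)%nat) m)%C.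
Proof.
  induction m as [|m IH]; [rewrite Nat.add_0_r; simpl; ring|].
  rewrite Nat.add_succ_r. simpl. rewrite IH. ring.
Qed.

Lemma csum_shift f n : csum f (S n) = (f 0%nat + csum (fun k => f (S k)) n)%C.
Proof. rewrite <- (Nat.add_1_l n), csum_add. simpl. ring. Qed.

Lemma Cmod_csum_le f g n : (forall k, (k < n)%nat -> Cmod (f k) <= g k) ->
  Cmod (csum f n) <= sum_f_R0 (fun k => match k with O => 0 | S j => g j end) n.
Proof.
  induction n as [|n IH]; intros H; simpl; [rewrite Cmod_0; lra|].
  eapply Rle_trans; [apply Cmod_triangle|]. apply Rplus_le_compat; auto.
Qed.

(* Each term is at most the integral of exp (- sqrt u) / sqrt u over a cell of length h. *)
Lemma exp_sqrt_sum h n : 0 < h ->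
  sum_f_R0 (fun k => match k with O => 0 | S j =>
     h * (exp (- sqrt (INR (S j) * h)) / sqrt (INR (S j) * h)) end) n
  <= 2 * (1 - exp (- sqrt (INR n * h))).
Proof.
  intros Hh. induction n as [|n IH].
  - simpl. rewrite Rmult_0_l, sqrt_0, Ropp_0, exp_0. lra.
  - rewrite tech5. set (A := sum_f_R0 _ n) in *.
    pose proof (pos_INR n) as Hn. rewrite S_INR.
    set (s := sqrt (INR n * h)) in *. set (t := sqrt ((INR n + 1) * h)).
    assert (Ht : 0 < t) by (apply sqrt_lt_R0; nra).
    assert (Hs : 0 <= s) by apply sqrt_pos.
    assert (Est : t * t = s * s + h).
    { unfold s, t. rewrite !sqrt_sqrt by nra. ring. }
    assert (Hst : s <= t) by nra.
    assert (K : h * (exp (- t) / t) <= 2 * (exp (- s) - exp (- t))).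
    { replace (- s) with ((t - s) + - t) by ring. rewrite exp_plus.
      pose proof (exp_ineq1_le (t - s)) as E. pose proof (exp_pos (- t)) as P.
      apply Rle_trans with (2 * (t - s) * exp (- t)); [|nra].
      apply Rmult_le_reg_r with t; [easy|].
      replace (h * (exp (- t) / t) * t) with (h * exp (- t)) by (field; lra).
      replace h with ((t - s) * (t + s)) by lra.
      assert ((t - s) * (t + s) <= 2 * (t - s) * t) by nra. nra. }
    lra.
Qed.

(** Rotating by -phi / 2 places the two summands symmetrically about the real axis, and each then
    has real part cos (phi / 2) times its modulus. *)
Lemma ray_plus_lower r phi X : 0 <= r -> 0 <= X ->
  (X + r) * cos (phi / 2) <= Cmod (RtoC X + RtoC r * Cexp (0, phi)).
Proof.
  intros Hr HX.
  replace (Cmod (RtoC X + RtoC r * Cexp (0, phi)))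
    with (Cmod (Cexp (0, (- (phi / 2))%R) * (RtoC X + RtoC r * Cexp (0, phi)))).
  2:{ rewrite Cmod_mult, Cmod_Cexp. simpl. rewrite exp_0. ring. }
  eapply Rle_trans; [|apply re_le_Cmod]. eapply Rle_trans; [|apply Rle_abs]. right.
  rewrite Cmult_plus_distr_l.
  replace (Cexp (0, (- (phi / 2))%R) * (RtoC r * Cexp (0, phi)))%C with (RtoC r * Cexp (0, (phi / 2)%R))%C.
  - unfold Cexp, RtoC; simpl. rewrite exp_0, cos_neg. ring.
  - transitivity (RtoC r * (Cexp (0, (- (phi / 2))%R) * Cexp (0, phi)))%C; [|ring].
    rewrite <- Cexp_plus. f_equal. f_equal. unfold Cplus; simpl. f_equal; field.
Qed.

(** A trapezoidal term is [qC] z / ([qX] + z), see [fT_node]: minus [qX] is the pole attached to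
    node j, and [qC] is its weight. *)
Definition qX (T h : R) (j : nat) : R := exp (2 * (sqrt (INR j * h) - T)).
Definition qC (T h : R) (j : nat) : R :=
  h / PI / sqrt (INR j * h) * exp (sqrt (INR j * h) - T).

Lemma Cexp_RtoC x : Cexp (RtoC x) = RtoC (exp x).
Proof. unfold Cexp, RtoC; simpl. rewrite cos_0, sin_0. f_equal; ring. Qed.

Lemma sqrt_node_pos h k : 0 < h -> 0 < sqrt (INR (S k) * h).
Proof.
  intros Hh. apply sqrt_lt_R0, Rmult_lt_0_compat; [|easy]. apply lt_0_INR. lia.
Qed.

Lemma fT_node T h z k : 0 < h -> (RtoC (qX T h (S k)) + z)%C <> 0 ->
  (RtoC h * fT T (RtoC (INR (S k) * h)) z
   = RtoC (qC T h (S k)) * (z / (RtoC (qX T h (S k)) + z)))%C.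
Proof.
  intros Hh Hn. pose proof (sqrt_node_pos h k Hh) as Hs.
  assert (Hj : 0 < INR (S k) * h) by (apply Rmult_lt_0_compat; [apply lt_0_INR; lia|easy]).
  unfold fT, qC. rewrite Csqrt_RtoC by exact Hj. set (s := sqrt (INR (S k) * h)) in *.
  rewrite <- RtoC_minus, <- RtoC_mult, !Cexp_RtoC.
  fold s in Hn. unfold qX in *. fold s in Hn. fold s.
  pose proof PI_RGT_0.
  rewrite RtoC_mult, !RtoC_div by lra.
  field. repeat split; auto; apply RtoC_neq_0; lra.
Qed.

(** In |X + z| only X cos (phi / 2) is kept. The quotient [qC] / [qX] then produces e^(T - s) / s
    with s = sqrt (j h), which [exp_sqrt_sum] can sum over j. *)
Lemma node_bound T h r phi k : 0 < h -> 0 <= r -> 0 < cos (phi / 2) ->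
  let z := (RtoC r * Cexp (0, phi))%C in
  (RtoC (qX T h (S k)) + z)%C <> 0 /\
  Cmod (RtoC (qC T h (S k)) * (z / (RtoC (qX T h (S k)) + z)))
   <= r * exp T / (PI * cos (phi / 2))
      * (h * (exp (- sqrt (INR (S k) * h)) / sqrt (INR (S k) * h))).
Proof.
  intros Hh Hr Hc z. pose proof (sqrt_node_pos h k Hh) as Hs. pose proof PI_RGT_0 as HP.
  set (c := cos (phi / 2)) in *.
  assert (HX : 0 < qX T h (S k)) by apply exp_pos.
  pose proof (ray_plus_lower r phi (qX T h (S k)) Hr ltac:(lra)) as B. fold c z in B.
  assert (B' : qX T h (S k) * c <= Cmod (RtoC (qX T h (S k)) + z)) by nra.
  assert (HXc : 0 < qX T h (S k) * c) by now apply Rmult_lt_0_compat.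
  assert (Hn : (RtoC (qX T h (S k)) + z)%C <> 0) by (apply Cmod_pos_neq0; lra).
  split; [exact Hn|].
  assert (HC : 0 < qC T h (S k)).
  { unfold qC. apply Rmult_lt_0_compat; [|apply exp_pos].
    apply Rdiv_lt_0_compat; [apply Rdiv_lt_0_compat|]; easy. }
  rewrite Cmod_mult, Cmod_R, Cmod_div, (Rabs_pos_eq (qC _ _ _)) by (auto; lra).
  replace (Cmod z) with r.
  2:{ unfold z. rewrite Cmod_mult, Cmod_R, Cmod_Cexp. simpl. rewrite exp_0, Rabs_pos_eq; lra. }
  apply Rle_trans with (qC T h (S k) * (r / (qX T h (S k) * c))).
  - apply Rmult_le_compat_l; [lra|]. unfold Rdiv. apply Rmult_le_compat_l; [easy|].
    apply Rinv_le_contravar; easy.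
  - right. unfold qC, qX. set (s := sqrt (INR (S k) * h)) in *.
    replace (2 * (s - T)) with ((s - T) + (s - T)) by ring. rewrite exp_plus.
    replace (s - T) with (s + - T) by ring. rewrite exp_plus, !exp_Ropp.
    pose proof (exp_pos s). pose proof (exp_pos T). field. repeat split; lra.
Qed.

(** Serves twice: with K a power of [kappa] and the first m terms cancelled it bounds the polynomial
    error, and with K = 1, m = 0 it bounds the whole quadrature sum for small r. *)
Lemma node_sum_bound T h r phi (g : nat -> C) K m n : 0 < h -> 0 <= r -> 0 < cos (phi / 2) ->
  let z := (RtoC r * Cexp (0, phi))%C in
  0 <= K -> (m <= n)%nat ->
  (forall k, (m <= k)%nat -> (k < n)%nat ->
     Cmod (g k) <= K * Cmod (RtoC (qC T h (S k)) * (z / (RtoC (qX T h (S k)) + z)))) ->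
  (forall k, (k < m)%nat -> g k = 0) ->
  Cmod (csum g n) <= K * (r * exp T / cos (phi / 2)).
Proof.
  intros Hh Hr Hc z HK Hmn Hg Hg0. set (c := cos (phi / 2)) in *. pose proof PI_RGT_0 as HP.
  set (A := r * exp T / (PI * c)).
  assert (HA : 0 <= A).
  { apply Rmult_le_pos; [apply Rmult_le_pos; [easy|apply Rlt_le, exp_pos]|].
    apply Rlt_le, Rinv_0_lt_compat. nra. }
  eapply Rle_trans.
  { apply Cmod_csum_le with
      (g := fun k => K * A * (h * (exp (- sqrt (INR (S k) * h)) / sqrt (INR (S k) * h)))).
    intros k Hk. destruct (node_bound T h r phi k Hh Hr Hc) as [_ B]. fold c z A in B.
    destruct (Nat.lt_ge_cases k m) as [Hm|Hm].
    - rewrite Hg0, Cmod_0 by exact Hm. pose proof (sqrt_node_pos h k Hh).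
      apply Rmult_le_pos; [nra|]. apply Rmult_le_pos; [lra|].
      apply Rlt_le, Rdiv_lt_0_compat; [apply exp_pos|easy].
    - eapply Rle_trans; [now apply Hg|]. rewrite Rmult_assoc.
      apply Rmult_le_compat_l; [easy|exact B]. }
  rewrite (sum_eq _ (fun k => (match k with O => 0 | S j =>
     h * (exp (- sqrt (INR (S j) * h)) / sqrt (INR (S j) * h)) end) * (K * A))).
  2:{ intros i _. destruct i; ring. }
  rewrite <- scal_sum.
  pose proof (exp_sqrt_sum h n Hh) as S. pose proof (exp_pos (- sqrt (INR n * h))) as P.
  apply Rle_trans with (K * A * 2); [apply Rmult_le_compat_l; nra|].
  rewrite Rmult_assoc. apply Rmult_le_compat_l; [easy|].
  assert (HPI2 := PI2_1).
  replace (A * 2) with (r * exp T / c * (2 / PI)) by (unfold A; field; lra).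
  rewrite <- (Rmult_1_r (r * exp T / c)) at 2. apply Rmult_le_compat_l.
  - apply Rmult_le_pos; [apply Rmult_le_pos; [easy|apply Rlt_le, exp_pos]|].
    apply Rlt_le, Rinv_0_lt_compat, Hc.
  - apply Rmult_le_reg_r with PI; [easy|]. unfold Rdiv. rewrite Rmult_assoc, Rinv_l by lra. lra.
Qed.

(** * Polynomials in coefficient form and the geometric expansion *)

Definition is_poly (n : nat) (p : C -> C) : Prop :=
  exists c : nat -> C, forall z, p z = csum (fun k => c k * Defs.Cpow z k)%C (S n).

Lemma is_poly_ext n p q : (forall z, p z = q z) -> is_poly n p -> is_poly n q.
Proof. intros E [c H]. exists c. intros z. now rewrite <- E. Qed.

Lemma csum_0 (f : nat -> C) n : (forall k, (k < n)%nat -> f k = 0) -> csum f n = 0.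
Proof.
  intros H. induction n as [|n IH]; simpl; [easy|]. rewrite IH, H by auto. ring.
Qed.

Lemma is_poly_const n a : is_poly n (fun _ => a).
Proof.
  exists (fun k => match k with O => a | _ => RtoC 0 end). intros z.
  rewrite csum_shift.
  rewrite (csum_0 (fun k => 0 * Defs.Cpow z (S k))%C) by (intros; ring). simpl. ring.
Qed.

Lemma is_poly_plus n p q : is_poly n p -> is_poly n q -> is_poly n (fun z => p z + q z)%C.
Proof.
  intros [c H] [d K]. exists (fun k => c k + d k)%C. intros z.
  rewrite H, K, <- csum_plus. apply csum_ext. intros; ring.
Qed.

Lemma is_poly_scal n a p : is_poly n p -> is_poly n (fun z => a * p z)%C.
Proof.
  intros [c H]. exists (fun k => a * c k)%C. intros z.
  rewrite H, <- csum_scal. apply csum_ext. intros; ring.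
Qed.

Lemma is_poly_X n p : is_poly n p -> is_poly (S n) (fun z => z * p z)%C.
Proof.
  intros [c H]. exists (fun k => match k with O => RtoC 0 | S j => c j end). intros z.
  rewrite csum_shift, H, <- csum_scal.
  rewrite (csum_ext (fun k => c k * Defs.Cpow z (S k))%C (fun k => z * (c k * Defs.Cpow z k))%C)
    by (intros; simpl; ring).
  simpl. ring.
Qed.

Lemma is_poly_S n p : is_poly n p -> is_poly (S n) p.
Proof.
  intros [c H]. exists (fun k => if Nat.ltb n k then RtoC 0 else c k). intros z.
  change (csum ?f (S (S n))) with (csum f (S n) + f (S n))%C. rewrite H.
  assert (E : Nat.ltb n (S n) = true) by (apply Nat.ltb_lt; lia). rewrite E.
  rewrite (csum_ext (fun k => (if Nat.ltb n k then RtoC 0 else c k) * Defs.Cpow z k)%C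
     (fun k => c k * Defs.Cpow z k)%C); [ring|].
  intros k Hk. assert (F : Nat.ltb n k = false) by (apply Nat.ltb_ge; lia). now rewrite F.
Qed.

Lemma is_poly_csum n (p : nat -> C -> C) m : (forall k, is_poly n (p k)) ->
  is_poly n (fun z => csum (fun k => p k z) m).
Proof.
  intros H. induction m as [|m IH]; simpl; [apply is_poly_const|].
  now apply is_poly_plus.
Qed.

(* Truncation at order m of the expansion of 1 / (X + z) in powers of (1 - z) / (1 + X). *)
Fixpoint geo (X : R) (m : nat) (z : C) : C :=
  match m with
  | O => (/ (1 + RtoC X))%C
  | S k => (/ (1 + RtoC X) + (1 - z) / (1 + RtoC X) * geo X k z)%C
  end.

Lemma is_poly_geo X m : is_poly m (geo X m).
Proof.
  induction m as [|m IH]; simpl; [apply (is_poly_const 0)|].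
  apply is_poly_plus; [apply is_poly_const|].
  apply is_poly_ext with (fun z => / (1 + RtoC X) * geo X m z + (- / (1 + RtoC X)) * (z * geo X m z))%C.
  { intros z. unfold Cdiv. ring. }
  apply is_poly_plus; apply is_poly_scal; [now apply is_poly_S|now apply is_poly_X].
Qed.

(** An exact telescoping identity: replacing 1 / (X + z) by [geo] has relative error exactly
    t^(m+1), t = (1 - z) / (1 + X). So the error of each term is a small factor times the term
    itself. *)
Lemma geo_error X m z : 0 < X ->
  ((RtoC X + z) * geo X m z = 1 - Defs.Cpow ((1 - z) / (1 + RtoC X)) (S m))%C.
Proof.
  intros HX. assert (N : (1 + RtoC X)%C <> 0).
  { rewrite <- RtoC_plus. apply RtoC_neq_0. lra. }
  induction m as [|m IH].
  - simpl. field. exact N.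
  - change (Defs.Cpow ?t (S (S m))) with (t * Defs.Cpow t (S m))%C.
    set (t := ((1 - z) / (1 + RtoC X))%C) in *.
    transitivity ((RtoC X + z) * / (1 + RtoC X) + t * ((RtoC X + z) * geo X m z))%C.
    + simpl. fold t. ring.
    + rewrite IH. unfold t. set (P := Defs.Cpow _ _). field. exact N.
Qed.

Lemma Cmod_Cpow z n : Cmod (Defs.Cpow z n) = Cmod z ^ n.
Proof. induction n as [|n IH]; simpl; [apply Cmod_1|]. now rewrite Cmod_mult, IH. Qed.

(** Splitting 1 - z = (1 - r) + r (1 - e^(i phi)) gives a convex combination of 1 and 2 |sin (phi /
    2)|; the floor 1/2 in the maximum accounts for the end r = 0. *)
Lemma one_minus_ray r phi : 0 <= r <= 1 ->
  Cmod (1 - RtoC r * Cexp (0, phi)) <= 2 * Rmax (1 / 2) (Rabs (sin (phi / 2))).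
Proof.
  intros Hr. set (M := Rmax _ _).
  assert (M1 : 1 / 2 <= M) by apply Rmax_l. assert (M2 : Rabs (sin (phi / 2)) <= M) by apply Rmax_r.
  replace (1 - RtoC r * Cexp (0, phi))%C with (RtoC (1 - r) + RtoC r * (1 - Cexp (0, phi)))%C
    by (rewrite RtoC_minus; ring).
  eapply Rle_trans; [apply Cmod_triangle|]. rewrite Cmod_mult, !Cmod_R, !Rabs_pos_eq by lra.
  replace (Cmod (1 - Cexp (0, phi))) with (2 * Rabs (sin (phi / 2))); [nra|].
  replace (1 - Cexp (0, phi))%C with ((0, (-2 * sin (phi / 2))%R) * Cexp (0, (phi / 2)%R))%C.
  - rewrite Cmod_mult, Cmod_Cexp. simpl. rewrite exp_0, Rmult_1_r.
    replace (0, (-2 * sin (phi / 2))%R) with (Ci * RtoC (-2 * sin (phi / 2)))%C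
      by (unfold Ci, RtoC, Cmult; simpl; f_equal; ring).
    rewrite Cmod_mult, Cmod_Ci, Cmod_R, Rabs_mult, Rmult_1_l. f_equal.
    rewrite Rabs_left; lra.
  - unfold Cexp, RtoC, Cmult, Cminus, Cplus, Copp; simpl. rewrite exp_0.
    replace (cos phi) with (cos (2 * (phi / 2))) by (f_equal; field).
    replace (sin phi) with (sin (2 * (phi / 2))) by (f_equal; field).
    rewrite cos_2a_sin, sin_2a. f_equal; ring.
Qed.

(** * Rational approximants on the two rays *)

Definition ray_arg (beta : R) (s : bool) : R := (if s then 1 else -1) * beta * PI / 2.
(** Bounds |1 - z| / (1 + X) for X >= 1 on both rays. It stays below 1 because beta < 2, and the
    floor 1/2 also keeps its logarithm meaningful when beta = 0. *)
Definition kappa (beta : R) : R := Rmax (1 / 2) (Rabs (sin (beta * PI / 4))).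

Lemma Rabs_ray_arg beta s : 0 <= beta -> Rabs (ray_arg beta s) = beta * PI / 2.
Proof.
  intros Hb. pose proof PI_RGT_0. unfold ray_arg. destruct s.
  - rewrite Rabs_pos_eq; nra.
  - replace (-1 * beta * PI / 2) with (- (beta * PI / 2)) by field.
    rewrite Rabs_Ropp, Rabs_pos_eq; nra.
Qed.

Lemma cos_ray_arg beta s : cos (ray_arg beta s / 2) = cos (beta * PI / 4).
Proof.
  unfold ray_arg. destruct s.
  - f_equal. field.
  - rewrite <- cos_neg. f_equal. field.
Qed.

Lemma Rabs_sin_ray_arg beta s : Rabs (sin (ray_arg beta s / 2)) = Rabs (sin (beta * PI / 4)).
Proof.
  unfold ray_arg. destruct s.
  - do 2 f_equal. field.
  - rewrite <- Rabs_Ropp, <- sin_neg. do 2 f_equal. field.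
Qed.

Lemma kappa_bounds beta : 0 <= beta < 2 -> 0 < cos (beta * PI / 4) /\ 1 / 2 <= kappa beta < 1.
Proof.
  intros Hb. pose proof PI_RGT_0.
  assert (Hc : 0 < cos (beta * PI / 4)) by (apply cos_gt_0; nra).
  split; [exact Hc|]. split; [apply Rmax_l|]. apply Rmax_lub_lt; [lra|].
  pose proof (sin2_cos2 (beta * PI / 4)) as E. unfold Rsqr in E.
  apply Rabs_def1; nra.
Qed.

Lemma hh_pos beta : 0 <= beta < 2 -> 0 < hh beta.
Proof. intros Hb. unfold hh. pose proof PI_RGT_0. apply Rmult_lt_0_compat; nra. Qed.

Lemma sqrt_hh beta : 0 <= beta < 2 -> sqrt (hh beta) = sqrt (2 - beta) * PI.
Proof.
  intros Hb. pose proof PI_RGT_0. unfold hh. rewrite sqrt_mult by nra.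
  rewrite sqrt_pow2 by lra. reflexivity.
Qed.

Lemma TT_4 beta N1 : 0 <= beta < 2 -> TT beta (4 * N1) = sqrt (INR N1) * sqrt (hh beta).
Proof.
  intros Hb. pose proof (hh_pos beta Hb). unfold TT. rewrite mult_INR.
  replace (INR 4 * INR N1 * hh beta / 4) with (INR N1 * hh beta) by (simpl; field).
  apply sqrt_mult; [apply pos_INR|lra].
Qed.

(** By [TT_4], T = sqrt N1 sqrt h, and [sigma] is 2 sqrt h; so the exponent 2 (sqrt (j h) - T) is
    the one prescribed for p_j. *)
Lemma pole_eq beta N1 j : 0 <= beta < 2 ->
  pole beta N1 j = - qX (TT beta (4 * N1)) (hh beta) j.
Proof.
  intros Hb. pose proof (hh_pos beta Hb). unfold pole, qX. do 2 f_equal.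
  rewrite TT_4, (sqrt_mult (INR j)), sqrt_hh by (auto; try apply pos_INR; lra).
  unfold Defs.sigma. ring.
Qed.

Lemma ceil_nat x : 0 < x -> exists n : nat, (1 <= n)%nat /\ x <= INR n <= x + 1.
Proof.
  intros Hx. destruct (archimed x) as [A1 A2]. exists (Z.to_nat (up x)).
  assert (P : (0 < up x)%Z) by (apply lt_IZR; lra).
  rewrite INR_IZR_INZ, Z2Nat.id by lia. split; [lia|lra].
Qed.

Lemma csum_extend (f : nat -> C) n m :
  csum f n = csum (fun k => if Nat.ltb k n then f k else RtoC 0) (n + m).
Proof.
  set (g := fun k => if Nat.ltb k n then f k else RtoC 0). rewrite csum_add.
  rewrite (csum_0 (fun k => g (n + k)%nat)).
  - rewrite (csum_ext g f); [ring|]. intros k Hk. unfold g. apply Nat.ltb_lt in Hk. now rewrite Hk.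
  - intros k _. unfold g.
    assert (E : Nat.ltb (n + k) n = false) by (apply Nat.ltb_ge; lia). now rewrite E.
Qed.

(** The first N1 terms are matched exactly and the other 3 N1 up to a relative error [kappa]^(m+1).
    Multiplying [geo] by z raises its degree to m + 1, hence the degree [S m]. *)
Lemma rat_approx_sum beta N1 m : 0 <= beta < 2 ->
  let T := TT beta (4 * N1) in
  kappa beta ^ S m <= exp (- (2 * T)) ->
  exists a c : nat -> C, forall r s, 0 <= r <= 1 ->
    Cmod (rat_approx beta N1 (S m) a c (ray_pt beta r s)
          - RtoC (hh beta) * csum (fun k => fT T (RtoC (INR (S k) * hh beta)) (ray_pt beta r s)) (4 * N1))
      <= / cos (beta * PI / 4) * exp (- T).
Proof.
  intros Hb T Hm. set (h := hh beta). pose proof (hh_pos beta Hb) as Hh. fold h in Hh.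
  destruct (kappa_bounds beta Hb) as [Hc Hk]. set (cc := cos (beta * PI / 4)) in *.
  set (P := fun z => csum (fun k => if Nat.ltb k N1 then RtoC (qC T h (S k))
       else (RtoC (qC T h (S k)) * (z * geo (qX T h (S k)) m z))%C) (4 * N1)).
  assert (HP : is_poly (S m) P).
  { apply (is_poly_csum (S m) (fun k z => if Nat.ltb k N1 then RtoC (qC T h (S k))
       else (RtoC (qC T h (S k)) * (z * geo (qX T h (S k)) m z))%C)).
    intros k. destruct (Nat.ltb k N1); [apply is_poly_const|].
    apply is_poly_scal, is_poly_X, is_poly_geo. }
  destruct HP as [c HPc].
  (* From z / (X + z) = 1 - X / (z + X): the residue is minus [qC] times [qX], and the constant [qC]
     left over is absorbed by the polynomial. *)
  exists (fun j => (- (RtoC (qC T h j) * RtoC (qX T h j)))%C), c. intros r s Hr.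
  unfold rat_approx. rewrite <- HPc. unfold P. clear HPc P.
  change (ray_pt beta r s) with (RtoC r * Cexp (0, ray_arg beta s))%C.
  set (phi := ray_arg beta s). set (z := (RtoC r * Cexp (0, phi))%C).
  assert (Hcphi : cos (phi / 2) = cc) by apply cos_ray_arg.
  assert (Hc' : 0 < cos (phi / 2)) by now rewrite Hcphi.
  rewrite (csum_extend _ N1 (3 * N1)). replace (N1 + 3 * N1)%nat with (4 * N1)%nat by lia.
  rewrite <- csum_scal, <- csum_plus.
  match goal with |- Cmod (csum ?f _ - csum ?g _) <= _ =>
    replace (csum f (4 * N1) - csum g (4 * N1))%C with (csum (fun k => f k + - 1 * g k)%C (4 * N1))
      by (rewrite csum_plus, csum_scal; ring) end.
  cbv beta.
  apply Rle_trans with (kappa beta ^ S m * (r * exp T / cos (phi / 2))).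
  - apply node_sum_bound with (m := N1) (h := h); auto; try lra.
    + apply pow_le. lra.
    + lia.
    + intros k Hk1 Hk2. fold z.
      destruct (node_bound T h r phi k Hh ltac:(lra) Hc') as [Hn _]. fold z in Hn.
      assert (E : Nat.ltb k N1 = false) by (apply Nat.ltb_ge; lia). rewrite E.
      rewrite fT_node by assumption.
      set (X := qX T h (S k)) in *. set (Q := RtoC (qC T h (S k))).
      (* The index k is offset by one: k >= N1 refers to node k + 1, and T is the square root of
         node N1, so X >= 1. This makes |t| <= 2 kappa / (1 + X) <= kappa. *)
      assert (HX : 1 <= X).
      { unfold X, qX. rewrite <- exp_0. apply exp_le.
        assert (T <= sqrt (INR (S k) * h)); [|lra].
        unfold T. rewrite TT_4 by exact Hb. fold h. rewrite <- sqrt_mult by (try apply pos_INR; lra). apply sqrt_le_1.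
        - apply Rmult_le_pos; [apply pos_INR|lra].
        - apply Rmult_le_pos; [apply pos_INR|lra].
        - apply Rmult_le_compat_r; [lra|]. apply le_INR. lia. }
      pose proof (geo_error X m z ltac:(lra)) as G. set (t := ((1 - z) / (1 + RtoC X))%C) in *.
      replace (0 + Q * (z * geo X m z) + -1 * (Q * (z / (RtoC X + z))))%C
        with (- (Q * (z / (RtoC X + z))) * Defs.Cpow t (S m))%C.
      2:{ replace (Defs.Cpow t (S m)) with (1 - (RtoC X + z) * geo X m z)%C by (rewrite G; ring).
          field. exact Hn. }
      rewrite Cmod_mult, Cmod_opp, Rmult_comm. apply Rmult_le_compat_r; [apply Cmod_ge_0|].
      rewrite Cmod_Cpow. apply pow_incr. split; [apply Cmod_ge_0|].
      unfold t. rewrite <- RtoC_plus.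
      rewrite Cmod_div by (apply RtoC_neq_0; lra). rewrite Cmod_R, Rabs_pos_eq by lra.
      pose proof (one_minus_ray r phi Hr) as O. fold z in O.
      unfold phi in O. rewrite Rabs_sin_ray_arg in O. fold (kappa beta) in O.
      apply Rmult_le_reg_r with (1 + X); [lra|].
      unfold Rdiv. rewrite Rmult_assoc, Rinv_l by lra. nra.
    + intros k Hk'. assert (E : Nat.ltb k N1 = true) by (apply Nat.ltb_lt; lia). rewrite E.
      destruct (node_bound T h r phi k Hh ltac:(lra) Hc') as [Hn _]. fold z in Hn.
      rewrite fT_node by assumption. rewrite pole_eq by exact Hb. fold T h.
      rewrite RtoC_opp.
      assert (Hn' : (z - - RtoC (qX T h (S k)))%C <> 0).
      { intros X. apply Hn. rewrite <- X. ring. }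
      field. auto.
  - rewrite Hcphi. pose proof (exp_pos T) as PT.
    (* One factor e^(-T) pays for the size e^T of the sum; the other is the accuracy that
       remains. *)
    apply Rle_trans with (exp (- (2 * T)) * (1 * exp T / cc)).
    + apply Rmult_le_compat; [apply pow_le; lra| |exact Hm|].
      * apply Rmult_le_pos; [apply Rmult_le_pos; lra|]. apply Rlt_le, Rinv_0_lt_compat, Hc.
      * apply Rmult_le_compat_r; [apply Rlt_le, Rinv_0_lt_compat, Hc|].
        apply Rmult_le_compat_r; lra.
    + right. replace (- (2 * T)) with (- T + - T) by ring. rewrite exp_plus, exp_Ropp.
      field. split; lra.
Qed.

(** At beta = 0 and L = 2 the poles lie right of the left side of Gamma iff 4 - pi^2 / 4 > 1, that
    is, pi^2 < 12. *)
Lemma PI_sqr_lt_12 : PI * PI < 12.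
Proof.
  pose proof (PI_ineq 2) as [_ H]. unfold tg_alt, PI_tg in H. simpl in H.
  pose proof PI_RGT_0. assert (PI < 3.4) by lra. nra.
Qed.

Theorem theorem5p2 (beta : R) (Hbeta : 0 <= beta < 2) :
  (exists K : R, exists N0 : nat,
     forall Nt : nat, (0 < Nt)%nat -> (N0 <= Nt)%nat ->
     forall (r : R) (s : bool),
       exp (4 + 2 * beta - 2 * TT beta Nt) <= r <= 1 ->
       Cmod (Gamma_integral beta Nt r
               (fun u => (fT (TT beta Nt) u (ray_pt beta r s)
                          * delta (hh beta) u)%C))
         <= K * exp (- TT beta Nt)) ->
  exists C0 C2 : R, exists M : nat,
    forall N1 : nat, (0 < N1)%nat -> (M <= N1)%nat ->
    exists N2 : nat,
      INR N2 <= C2 * sqrt (INR N1) /\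
      exists a c : nat -> C,
        forall (r : R) (s : bool), 0 <= r <= 1 ->
          Cmod (rat_approx beta N1 N2 a c (ray_pt beta r s)
                - Csqrt (ray_pt beta r s))%C
            <= C0 * exp (- PI * sqrt ((2 - beta) * INR (N1 + N2))).
Proof.
  intros [K [N0 HK]].
  pose proof (hh_pos beta Hbeta) as Hh. set (h := hh beta) in *.
  destruct (kappa_bounds beta Hbeta) as [Hc Hk]. set (cc := cos (beta * PI / 4)) in *.
  set (lam := - ln (kappa beta)).
  assert (Hlam : 0 < lam).
  { unfold lam. rewrite <- Ropp_0. apply Ropp_lt_contravar. rewrite <- ln_1. apply ln_increasing; lra. }
  (* The degree will be 2 T / lam rounded up, with T = sqrt N1 sqrt h; the 1 absorbs the rounding,
     as sqrt N1 >= 1. *)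
  set (C2 := 2 * sqrt h / lam + 1).
  (* In order: the assumed contour bound, the two residues, the truncation of the integral, the
     polynomial; then, for small r only, the quadrature sum and the square root. *)
  set (C1 := Rabs K + 8 + (2 / (cc * cc) * exp 1 + 6) + / cc + exp 8 / cc + exp 4).
  assert (Hsh : 0 < sqrt h) by now apply sqrt_lt_R0.
  assert (HC2 : 0 < C2) by (unfold C2; pose proof (Rdiv_lt_0_compat (2 * sqrt h) lam); lra).
  (* N1 >= 1 / h gives T^2 = N1 h >= 1, so that e^T >= 1 + T >= 2 as [sqrt_integral_estimate]
     needs. *)
  destruct (ceil_nat (/ h)) as [M [_ [HM _]]]; [now apply Rinv_0_lt_compat|].
  exists (C1 * exp (sqrt h * (C2 / 2))), C2, (Nat.max N0 M).
  intros N1 HN1 HMN. set (T := TT beta (4 * N1)).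
  assert (HT : T = sqrt (INR N1) * sqrt h) by now apply TT_4.
  assert (HN1' : 1 <= INR N1) by (change 1 with (INR 1); apply le_INR; lia).
  assert (HsN : 1 <= sqrt (INR N1)) by (rewrite <- sqrt_1; apply sqrt_le_1; lra).
  assert (HTT : T * T = INR N1 * h).
  { rewrite HT. transitivity ((sqrt (INR N1) * sqrt (INR N1)) * (sqrt h * sqrt h)); [ring|].
    rewrite !sqrt_sqrt; lra. }
  assert (HT0 : 0 < T) by (rewrite HT; apply Rmult_lt_0_compat; lra).
  assert (HT1 : 1 <= T).
  { assert (/ h <= INR N1) by (eapply Rle_trans; [exact HM|apply le_INR; lia]).
    assert (1 <= INR N1 * h).
    { replace 1 with (/ h * h) by (field; lra). apply Rmult_le_compat_r; lra. }
    nra. }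
  (* The smallest order of the expansion, up to rounding, for which [kappa] to the power N2 is at
     most e^(-2 T). *)
  destruct (ceil_nat (2 * T / lam)) as [N2 [HN2 [HN2a HN2b]]]; [apply Rdiv_lt_0_compat; lra|].
  assert (HN2C : INR N2 <= C2 * sqrt (INR N1)).
  { unfold C2. eapply Rle_trans; [exact HN2b|]. rewrite HT.
    replace (2 * (sqrt (INR N1) * sqrt h) / lam) with (2 * sqrt h / lam * sqrt (INR N1)) by (field; lra). lra. }
  exists N2. split; [exact HN2C|].
  destruct N2 as [|m]; [lia|].
  assert (Hkm : kappa beta ^ S m <= exp (- (2 * T))).
  { rewrite <- Rpower_pow by lra. unfold Rpower. apply exp_le.
    replace (ln (kappa beta)) with (- lam) by (unfold lam; ring).
    assert (2 * T <= INR (S m) * lam); [|lra].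
    replace (2 * T) with (2 * T / lam * lam) by (field; lra). apply Rmult_le_compat_r; lra. }
  destruct (rat_approx_sum beta N1 m Hbeta Hkm) as [a [c Hac]]. fold T h cc in Hac.
  exists a, c. intros r s Hr. specialize (Hac r s Hr).
  (* Passing from N1 to N = N1 + N2 costs a constant: N2 <= C2 sqrt N1 gives sqrt N <= sqrt N1 + C2
     / 2, and T = sqrt h sqrt N1. *)
  assert (Hexp : exp (- T) <= exp (sqrt h * (C2 / 2)) * exp (- PI * sqrt ((2 - beta) * INR (N1 + S m)))).
  { rewrite <- exp_plus. apply exp_le.
    replace (- PI * sqrt ((2 - beta) * INR (N1 + S m))) with (- (sqrt h * sqrt (INR (N1 + S m)))).
    2:{ unfold h. rewrite sqrt_hh by exact Hbeta. rewrite sqrt_mult by (try apply pos_INR; lra). ring. }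
    assert (sqrt (INR (N1 + S m)) <= sqrt (INR N1) + C2 / 2).
    { rewrite <- (sqrt_square (sqrt (INR N1) + C2 / 2)) by lra. apply sqrt_le_1; [apply pos_INR|nra|].
      rewrite plus_INR. pose proof (sqrt_sqrt (INR N1) ltac:(lra)). nra. }
    rewrite HT. nra. }
  assert (Hcc : 0 < / cc) by now apply Rinv_0_lt_compat.
  assert (Pos1 : 0 < 2 / (cc * cc) * exp 1).
  { apply Rmult_lt_0_compat; [|apply exp_pos]. apply Rdiv_lt_0_compat; nra. }
  assert (Pos2 : 0 < exp 8 / cc) by (apply Rdiv_lt_0_compat; [apply exp_pos|easy]).
  pose proof (exp_pos 4) as Pos3. pose proof (Rabs_pos K) as Pos4.
  pose proof (exp_pos (- T)) as PT.
  assert (HC1 : 0 < C1) by (unfold C1; lra).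
  rewrite Rmult_assoc. apply Rle_trans with (C1 * exp (- T)); [|apply Rmult_le_compat_l; [lra|exact Hexp]].
  change (ray_pt beta r s) with (RtoC r * Cexp (0, ray_arg beta s))%C in *.
  specialize (HK (4 * N1)%nat ltac:(lia) ltac:(lia) r s). fold T h in HK.
  change (ray_pt beta r s) with (RtoC r * Cexp (0, ray_arg beta s))%C in HK.
  set (phi := ray_arg beta s) in *. set (z := (RtoC r * Cexp (0, phi))%C) in *.
  assert (Hcphi : cos (phi / 2) = cc) by apply cos_ray_arg.
  assert (Hc' : 0 < cos (phi / 2)) by now rewrite Hcphi.
  pose proof PI_RGT_0 as HPI.
  assert (Haphi : Rabs phi = beta * PI / 2) by (apply Rabs_ray_arg; lra).
  assert (Hphi : Rabs phi < PI) by (rewrite Haphi; nra).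
  set (S := (RtoC h * csum (fun k => fT T (RtoC (INR (S k) * h)) z) (4 * N1))%C) in *.
  set (A := rat_approx beta N1 (Datatypes.S m) a c z) in *.
  destruct (Rle_dec (exp (4 + 2 * beta - 2 * T)) r) as [Hbig|Hsmall].
  - specialize (HK (conj Hbig (proj2 Hr))).
    assert (Hr0 : 0 < r) by (pose proof (exp_pos (4 + 2 * beta - 2 * T)); lra).
    set (L := T + / 2 * ln r).
    assert (HL : 2 + beta <= L).
    { apply ln_le in Hbig; [|apply exp_pos]. rewrite ln_exp in Hbig. unfold L. lra. }
    assert (HLT : L <= T).
    { assert (ln r <= 0) by (rewrite <- ln_1; apply ln_le; lra). unfold L. lra. }
    set (x0 := 1 - beta / 2) in *. set (x1 := 4 * T ^ 2 + 1 - beta / 2).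
    assert (Hx0 : 0 < x0 <= 1) by (unfold x0; lra).
    assert (Hhx : h = 2 * x0 * (PI * PI)) by (unfold h, hh, x0; field).
    assert (HPI2 := PI2_1). assert (H12 := PI_sqr_lt_12).
    assert (Hx1 : x1 = 4 * (T * T) + x0) by (unfold x1, x0; ring).
    assert (HPP : 4 < PI * PI) by nra.
    pose proof (contour_estimate h T r phi Hh Hr0 ltac:(fold L; lra) Hphi) as CE.
    fold z L in CE.
    (* The condition linking h to the rays holds with equality: both sides are (2 - beta) pi / 4. *)
    specialize (CE ltac:(rewrite Haphi; unfold h, hh; right; field; lra) x0 x1 (4 * N1)%nat).
    assert (H4N : INR (4 * N1) * h = 4 * (T * T)) by (rewrite mult_INR, HTT; simpl; ring).
    (* The vertical sides pass between nodes: x0 = h / (2 pi^2) is below h / 2, and x1 exceeds node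
       4 N1 by x0. *)
    specialize (CE ltac:(nra) ltac:(rewrite Rmult_plus_distr_r, H4N; nra)).
    (* The farther pole has |theta| = (2 + beta) pi / 4, so L >= 2 + beta bounds its real part below
       by (2 + beta)^2 (1 - pi^2 / 16), which exceeds x0 because pi^2 < 12. *)
    specialize (CE ltac:(rewrite Haphi; replace ((PI + beta * PI / 2) / 2) with ((2 + beta) * PI / 4) by field; nra)).
    specialize (CE ltac:(nra)).
    assert (Sx1 : 2 * T <= sqrt x1).
    { rewrite <- (sqrt_square (2 * T)) by lra. apply sqrt_le_1; nra. }
    assert (ET : exp T <= exp (sqrt x1 - T)) by (apply exp_le; lra).
    pose proof (exp_ineq1_le T) as ET1.
    pose proof (sqrt_integral_estimate T r phi x0 x1 ltac:(lra) Hphi ltac:(nra) ltac:(lra)) as SE.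
    cbv zeta in SE. fold z in SE. rewrite Hcphi in SE.
    assert (SE1 : 2 / (cc * cc) * exp (sqrt x0 - T) <= 2 / (cc * cc) * exp 1 * exp (- T)).
    { rewrite Rmult_assoc, <- exp_plus. apply Rmult_le_compat_l.
      - apply Rlt_le, Rdiv_lt_0_compat; nra.
      - apply exp_le. assert (sqrt x0 <= 1) by (rewrite <- sqrt_1; apply sqrt_le_1; lra). lra. }
    assert (SE2 : 6 / exp (sqrt x1 - T) <= 6 * exp (- T)).
    { unfold Rdiv. apply Rmult_le_compat_l; [lra|]. rewrite exp_Ropp. apply Rinv_le_contravar; [apply exp_pos|easy]. }
    set (I := CInt (fun t => fT T (RtoC t) z) x0 x1) in *.
    unfold Gamma_integral, rect_integral in HK. cbv zeta in HK. fold T x0 x1 L in HK.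
    unfold RI in CE. change Defs.Ci with Ci in HK.
    match type of HK with Cmod ?g <= _ => set (G := g) in HK, CE end.
    fold S in CE.
    (* A chain from approximant to quadrature sum S, to integral I, to square root; G is the contour
       integral bounded by hypothesis. *)
    replace (A - Csqrt z)%C with ((A - S) + ((G - (I - S)) + ((I - Csqrt z) + - G)))%C by ring.
    assert (KK : K * exp (- T) <= Rabs K * exp (- T)) by (apply Rmult_le_compat_r; [lra|apply Rle_abs]).
    pose proof (Cmod_triangle (A - S) ((G - (I - S)) + ((I - Csqrt z) + - G))).
    pose proof (Cmod_triangle (G - (I - S)) ((I - Csqrt z) + - G)).
    pose proof (Cmod_triangle (I - Csqrt z) (- G)) as X3. rewrite Cmod_opp in X3.
    unfold C1. nra.
  - apply Rnot_le_lt in Hsmall.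
    (* The 8 bounds 4 + 2 beta, since beta < 2. With r = O(e^(-2 T)), the sum bound r e^T and sqrt r
       are both O(e^(-T)). *)
    assert (Hr8 : r <= exp 8 * (exp (- T) * exp (- T))).
    { rewrite <- !exp_plus. apply Rlt_le. eapply Rlt_le_trans; [exact Hsmall|]. apply exp_le. lra. }
    assert (BS : Cmod S <= exp 8 / cc * exp (- T)).
    { apply Rle_trans with (1 * (r * exp T / cos (phi / 2))).
      - unfold S. rewrite <- csum_scal. apply node_sum_bound with (m := 0%nat) (h := h); auto; try lra; try lia.
        intros k _ _. destruct (node_bound T h r phi k Hh ltac:(lra) Hc') as [Hn _]. fold z in Hn |- *.
        rewrite fT_node by assumption. lra.
      - rewrite Hcphi, Rmult_1_l. apply Rle_trans with (exp 8 * (exp (- T) * exp (- T)) * exp T / cc).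
        + apply Rmult_le_compat_r; [lra|]. apply Rmult_le_compat_r; [apply Rlt_le, exp_pos|exact Hr8].
        + right. rewrite !exp_Ropp. pose proof (exp_pos T). field. lra. }
    assert (BZ : Cmod (Csqrt z) <= exp 4 * exp (- T)).
    { rewrite Cmod_Csqrt. unfold z. rewrite Cmod_mult, Cmod_R, Cmod_Cexp. simpl Re.
      rewrite exp_0, Rmult_1_r, Rabs_pos_eq by lra.
      rewrite <- (sqrt_square (exp 4 * exp (- T))) by (apply Rmult_le_pos; apply Rlt_le, exp_pos).
      apply sqrt_le_1; [lra|apply Rle_0_sqr|].
      replace (exp 4 * exp (- T) * (exp 4 * exp (- T))) with (exp 4 * exp 4 * (exp (- T) * exp (- T))) by ring.
      rewrite <- (exp_plus 4 4). replace (4 + 4) with 8 by ring. exact Hr8. }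
    replace (A - Csqrt z)%C with ((A - S) + (S + - Csqrt z))%C by ring.
    pose proof (Cmod_triangle (A - S) (S + - Csqrt z)).
    pose proof (Cmod_triangle S (- Csqrt z)) as X3. rewrite Cmod_opp in X3.
    unfold C1. nra.
Qed.
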